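(* Let $k\ge 2$ and $n\ge 4$ be integers. Then for generic vectors $\vec{\alpha}_1,\dots,\vec{\alpha}_k\in\mathbb{R}^{n-1}$, the $n$-linear operator $nHT_{\vec{\alpha}_1,\dots,\vec{\alpha}_k}$ does not satisfy any $L^p$ estimates of Hölder type. That is, for every choice of exponents $1<p_1,\dots,p_n\le\infty$ and $0<p<\infty$ with $\frac1{p_1}+\dots+\frac1{p_n}=\frac1p$, there is no finite constant $C$ such that $$\|nHT_{\vec{\alpha}_1,\dots,\vec{\alpha}_k}(f,f_1,\dots,f_{n-1})\|_{L^p(\mathbb{R})}\le C\,\|f\|_{L^{p_1}(\mathbb{R})}\prod_{j=1}^{n-1}\|f_j\|_{L^{p_{j+1}}(\mathbb{R})}$$ for all Schwartz functions $f,f_1,\dots,f_{n-1}$ on $\mathbb{R}$.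
   Context: For $\vec{\alpha}_1,\dots,\vec{\alpha}_k\in\mathbb{R}^{n-1}$, written $\vec{\alpha}_j=(\alpha_{j\,1},\dots,\alpha_{j\,n-1})$, the operator $nHT_{\vec{\alpha}_1,\dots,\vec{\alpha}_k}$ is defined for Schwartz functions $f,f_1,\dots,f_{n-1}$ on $\mathbb{R}$ and $x\in\mathbb{R}$ by $$nHT_{\vec{\alpha}_1,\dots,\vec{\alpha}_k}(f,f_1,\dots,f_{n-1})(x)=\int_{\mathbb{R}^n}\Big[\prod_{j=1}^k\operatorname{sgn}(\xi+\alpha_{j\,1}\xi_1+\dots+\alpha_{j\,n-1}\xi_{n-1})\Big]\widehat f(\xi)\widehat{f_1}(\xi_1)\cdots\widehat{f_{n-1}}(\xi_{n-1})\,e^{2\pi i x(\xi+\xi_1+\dots+\xi_{n-1})}\,d\xi\,d\xi_1\cdots d\xi_{n-1}.$$ ''Generic vectors $\vec{\alpha}_1,\dots,\vec{\alpha}_k$'' means: all $(\vec{\alpha}_1,\dots,\vec{\alpha}_k)\in(\mathbb{R}^{n-1})^k$ outside some proper real algebraic subset of $(\mathbb{R}^{n-1})^k$ (depending only on $k$ and $n$). *)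

(* Defs.v *)
From HB Require Import structures.
From mathcomp Require Import all_boot all_order all_algebra.
From mathcomp Require Import complex.
From mathcomp Require Import all_classical all_reals all_analysis.
(* not imported: the notations of mpoly clash with those of mathcomp-analysis *)
From mathcomp Require mpoly.

Set Implicit Arguments.
Unset Strict Implicit.
Unset Printing Implicit Defensive.

Import Order.TTheory GRing.Theory Num.Theory.
Import numFieldNormedType.Exports.

Local Open Scope classical_set_scope.
Local Open Scope ring_scope.
Local Open Scope complex_scope.

Section cons_measure.
Local Open Scope ereal_scope.
Context d (T : measurableType d) (R : realType) (n : nat).
Variable mu : {sigma_finite_measure set T -> \bar R}.
Variable nu : {sigma_finite_measure set (n.-tuple T) -> \bar R}.

Definition tuple_of_pair (x : T * n.-tuple T) : n.+1.-tuple T :=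
  [tuple of x.1 :: x.2].

Lemma measurable_tuple_of_pair : measurable_fun setT tuple_of_pair.
Proof. exact: measurable_cons. Qed.

Definition cons_measure : set (n.+1.-tuple T) -> \bar R :=
  pushforward (mu \x nu) tuple_of_pair.

Let cons_measure0 : cons_measure set0 = 0.
Proof. by rewrite /cons_measure /pushforward preimage_set0 measure0. Qed.

Let cons_measure_ge0 A : 0 <= cons_measure A.
Proof. by rewrite /cons_measure /pushforward measure_ge0. Qed.

Let cons_measure_sigma_additive : semi_sigma_additive cons_measure.
Proof.
move=> F mF tF mUF; rewrite /cons_measure /pushforward preimage_bigcup.
have mpre B : measurable B -> measurable (tuple_of_pair @^-1` B).
  by move=> mB; rewrite -[X in measurable X]setTI;
    exact: measurable_tuple_of_pair.
apply: measure_semi_sigma_additive => [i||].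
- by apply: mpre; exact: mF.
- apply/trivIsetP => /= i j _ _ ij; rewrite -preimage_setI.
  by move/trivIsetP : tF => /(_ _ _ _ _ ij) ->//; rewrite preimage_set0.
- by rewrite -preimage_bigcup; exact: mpre.
Qed.

HB.instance Definition _ := isMeasure.Build _ _ _ cons_measure
  cons_measure0 cons_measure_ge0 cons_measure_sigma_additive.

Let cons_measure_sigma_finite : sigma_finite setT cons_measure.
Proof.
have /sigma_finiteP[F [TF ndF Foo]] := sigma_finiteT mu.
have /sigma_finiteP[G [TG ndG Goo]] := sigma_finiteT nu.
pose uncons (t : n.+1.-tuple T) : T * n.-tuple T :=
  (thead t, [tuple of behead t]).
have tupleK : uncons \o tuple_of_pair = id.
  by apply/funext => -[x t]; congr pair => //=; exact/val_inj.
exists (fun k => uncons @^-1` (F k `*` G k)).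
  apply/seteqP; split => // t _.
  have [i _ Fi] : (\bigcup_i F i) (uncons t).1 by rewrite -TF.
  have [j _ Gj] : (\bigcup_j G j) (uncons t).2 by rewrite -TG.
  exists (maxn i j) => //; split.
  - by move: Fi; exact/subsetPset/ndF/leq_maxl.
  - by move: Gj; exact/subsetPset/ndG/leq_maxr.
move=> k; have [mF Fkoo] := Foo k; have [mG Gkoo] := Goo k; split.
  rewrite -[X in measurable X]setTI.
  have muncons : measurable_fun setT uncons.
    apply: measurable_fun_pair; first exact: measurable_tnth.
    exact: measurable_behead.
  by apply: muncons => //; exact: measurableX.
rewrite /cons_measure /pushforward -comp_preimage tupleK preimage_id.
by rewrite product_measure1E// lte_mul_pinfty// ge0_fin_numE.
Qed.

HB.instance Definition _ := Measure_isSigmaFinite.Build _ _ _ cons_measure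
  cons_measure_sigma_finite.

End cons_measure.

Fixpoint lebesgue_tuple (R : realType) (n : nat) :
    {sigma_finite_measure set (n.-tuple (measurableTypeR R)) -> \bar R} :=
  if n is m.+1 then cons_measure lebesgue_measure (lebesgue_tuple R m)
  else \d_[tuple].

Lemma lebesgue_tuple_box (R : realType) (n : nat)
    (A : 'I_n -> set (measurableTypeR R)) :
  (forall i, measurable (A i)) ->
  lebesgue_tuple R n [set t | forall i, A i (tnth t i)] =
  (\prod_(i < n) lebesgue_measure (A i))%E.
Proof.
elim: n A => [|n IH] A mA.
  rewrite big_ord0 /= [X in dirac _ X](_ : _ = setT) ?diracT//.
  by apply/seteqP; split => // t _ [].
rewrite big_ord_recl -IH// -product_measure1E//; last first.
  rewrite (_ : [set _ | _] = \bigcap_(i in [set: 'I_n])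
    ((@tnth n (measurableTypeR R))^~ i @^-1` A (lift ord0 i))).
    apply: fin_bigcap_measurable => // i _.
    by rewrite -[X in measurable X]setTI; exact: measurable_tnth.
  by apply/seteqP; split => [t At i _|t At i]; exact: At.
rewrite /= /cons_measure /pushforward; congr product_measure1.
apply/seteqP; split => -[x t] /=.
  move=> At; split => [|i]; first by have := At ord0.
  by have := At (lift ord0 i); rewrite tnthS.
move=> [A0 At] i; case: (unliftP ord0 i) => [j ->|->] //.
by rewrite tnthS.
Qed.

Section complex_valued.
Context {R : realType}.
Implicit Types f : R -> R[i].

Definition Cintegral d (T : measurableType d)
    (mu : {measure set T -> \bar R}) (F : T -> R[i]) : R[i] :=
  (\int[mu]_t complex.Re (F t)) +i* (\int[mu]_t complex.Im (F t)).

Definition expi (t : R) : R[i] := cos t +i* sin t.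

(* A function R -> C is differentiated componentwise, as R[i] carries no
   normed R-module structure. *)
Definition Cderive_n (n : nat) f : R -> R[i] :=
  fun x => derive1n n (@complex.Re R \o f) x +i*
           derive1n n (@complex.Im R \o f) x.

Definition smooth f :=
  forall n x, derivable (derive1n n (@complex.Re R \o f)) x 1 /\
              derivable (derive1n n (@complex.Im R \o f)) x 1.

Definition schwartz f :=
  smooth f /\
  forall m n : nat, exists M : R, forall x,
    `|x| ^+ m * ComplexField.Normc.normc (Cderive_n n f x) <= M.

Definition fourier f (xi : R) : R[i] :=
  Cintegral lebesgue_measure
    (fun x : measurableTypeR R => f x * expi (- (2 * pi * x * xi))).

Definition CLnorm (p : \bar R) f : \bar R :=
  'N[lebesgue_measure]_p[(fun x : measurableTypeR R =>
    (ComplexField.Normc.normc (f x))%:E)]%E.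

(* Here m = n - 1 and the vector alpha_j is row j of alpha. The integration
   variable t in R^n is (xi, xi_1, ..., xi_(n-1)). *)
Definition nHT (k m : nat) (alpha : 'M[R]_(k, m))
    f (fs : 'I_m -> R -> R[i]) (x : R) : R[i] :=
  Cintegral (lebesgue_tuple R m.+1) (fun t =>
    let xi : R := tnth t ord0 in
    let xis (l : 'I_m) : R := tnth t (lift ord0 l) in
    (\prod_(j < k) Num.sg (xi + \sum_(l < m) alpha j l * xis l))%:C
    * fourier f xi * (\prod_(l < m) fourier (fs l) (xis l))
    * expi (2 * pi * x * (xi + \sum_(l < m) xis l))).

(* ps = (p_1, ..., p_n): the index ord0 stands for p_1, and lift ord0 l for the
   exponent attached to the function fs l. *)
Definition nHT_bounded (k m : nat) (alpha : 'M[R]_(k, m))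
    (ps : 'I_m.+1 -> \bar R) (p : \bar R) :=
  exists C : R, forall f (fs : 'I_m -> R -> R[i]),
    schwartz f -> (forall l, schwartz (fs l)) ->
    (CLnorm p (nHT alpha f fs) <=
     C%:E * (CLnorm (ps ord0) f *
             \prod_(l < m) CLnorm (ps (lift ord0 l)) (fs l)))%E.

Definition hoelder_exponents (n : nat) (ps : 'I_n -> \bar R) (p : \bar R) :=
  [/\ forall i, (1 < ps i)%E, (0 < p < +oo)%E &
      (\sum_(i < n) (ps i)^-1 = p^-1)%E].

(* (R^m)^k is the space of k x m matrices; mxvec lists the k * m entries of
   alpha, at which the polynomials q i are evaluated. *)
Definition real_algebraic (k m : nat) (Z : set 'M[R]_(k, m)) :=
  exists (N : nat) (q : 'I_N -> mpoly.mpoly (k * m) R),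
    Z = [set alpha | forall i, mpoly.meval (mxvec alpha 0) (q i) = 0].

Definition generic (k m : nat) (P : 'M[R]_(k, m) -> Prop) :=
  exists Z : set 'M[R]_(k, m),
    [/\ real_algebraic Z, Z != setT & forall alpha, ~ Z alpha -> P alpha].

End complex_valued.

(* Main.v *)
(* The operator is tested on modulated chirps
     f_l(y) = exp(- pi (1 + i la c_l) y^2 + 2 pi i N om_l y),
   all of modulus exp(- pi y^2), so that the right-hand side of the estimate
   does not depend on la and N. Let p and q be the first two coefficient
   vectors, extended by a leading coefficient 1. For generic coefficients and
   n >= 4 there are a vector c with
     sum c p = sum c q = sum c q^2 = 0 and sum c p q = 1,
   and a vector om in the kernel of the forms p and q but of no other form.
   As N grows, the Fourier transforms concentrate around N om, where the signs
   of all forms but p and q are constant; their product is replaced by +1 or -1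
   up to an error O_la(1/N).
   What is left is a bilinear Hilbert transform type integral. Writing the signs
   as integrals of sin(2 pi s u) / (pi s) turns it into
     iint G(s, t) exp(- pi i la (a s^2 + 2 s t)) ds dt / (s t)
   for a Gaussian G and a = sum c p^2. Differentiating in the coefficient th
   of the cross term 2 s t removes the singularity and leaves an explicit
   Gaussian integral of real part at least a multiple of
   1 / (sqrt la + |th|); integrating over [0, la] gives a lower bound
   k0 ln(1 + sqrt la) - C, uniform for x near 0. This contradicts the
   estimate as la tends to infinity. *)

From HB Require Import structures.
Require Import Defs.
From mathcomp Require Import all_boot all_order all_algebra.
From mathcomp Require Import complex.
From mathcomp Require Import all_classical all_reals all_analysis.
From mathcomp Require Import measurable_realfun ess_sup_inf.
From mathcomp Require Import ring lra.
From mathcomp Require mpoly.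
Import (canonicals, coercions) mpoly.

Set Implicit Arguments.
Unset Strict Implicit.
Unset Printing Implicit Defensive.

Import Order.TTheory GRing.Theory Num.Theory.
Import numFieldNormedType.Exports.

Local Open Scope classical_set_scope.
Local Open Scope ring_scope.
Local Open Scope complex_scope.

Local Notation normc := ComplexField.Normc.normc.
Local Notation Re := complex.Re.
Local Notation Im := complex.Im.

(** * Complex-valued integrals *)

(** The four conditions on c use four coordinates, which is where n >= 4 enters; also imposing sum c
    p^2 = 0 would cost a fifth. The surviving a gives the s^2 coefficient an imaginary part of size
    la, so the bound is 1 / (sqrt la + |th|) rather than 1 / (1 + |th|), but its integral is still
    logarithmic. The conditions sum c p = sum c q = 0 keep la out of the terms x s and x t, hence
    the uniformity in x. The integration in th starts at th = 0 with la a fixed. There the phase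
    exp(- pi i la a s^2) is even in s, factors out of the sum over sign changes of s and t, and
    leaves a bound free of la. The kernel sin(2 pi s u) / (pi s) is not absolutely integrable, so
    Gaussian cut-offs of width K are inserted in s and t. They smooth the signs and merely add K^-2
    to the diagonal coefficients of the Gaussian, so the estimates stay uniform in K >= 1. The
    parameter la is fixed before N, because the constant in the error of order 1/N depends on la. *)

HB.lock Definition cexp (R : realType) (z : R[i]) : R[i] :=
  (expR (Re z))%:C * expi (Im z).

Section complex_facts.
Context {R : realType}.
Implicit Types z w : R[i].

Lemma cReE z w : (Re (z * w) = Re z * Re w - Im z * Im w)
 * (Im (z * w) = Re z * Im w + Im z * Re w).
Proof. by case: z w => a b [c d]; split => //=; rewrite addrC. Qed.

Lemma cReD z w : Re (z + w) = Re z + Re w. Proof. by case: z w => ? ? []. Qed.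
Lemma cImD z w : Im (z + w) = Im z + Im w. Proof. by case: z w => ? ? []. Qed.
Lemma cReN z : Re (- z) = - Re z. Proof. by case: z. Qed.
Lemma cImN z : Im (- z) = - Im z. Proof. by case: z. Qed.
Lemma cReM z w : Re (z * w) = Re z * Re w - Im z * Im w.
Proof. by rewrite cReE. Qed.
Lemma cImM z w : Im (z * w) = Re z * Im w + Im z * Re w.
Proof. by rewrite cReE. Qed.

Lemma ncE z : normc z = Num.sqrt (Re z ^+ 2 + Im z ^+ 2).
Proof. by case: z. Qed.

Lemma nc_ge0 z : 0 <= normc z. Proof. by rewrite ncE sqrtr_ge0. Qed.

Lemma sqr_nc z : normc z ^+ 2 = Re z ^+ 2 + Im z ^+ 2.
Proof. by rewrite ncE sqr_sqrtr// addr_ge0// sqr_ge0. Qed.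

Lemma ncM z w : normc (z * w) = normc z * normc w.
Proof. exact: ComplexField.Normc.normcM. Qed.

Lemma nc_prod n (F : 'I_n -> R[i]) :
  normc (\prod_i F i) = \prod_i normc (F i).
Proof.
elim/big_rec2: _ => [|i y1 y2 _ <-]; last by rewrite ncM.
by rewrite ncE /= expr0n/= addr0 expr1n sqrtr1.
Qed.

Lemma ncN z : normc (- z) = normc z.
Proof. by rewrite !ncE cReN cImN !sqrrN. Qed.

Lemma ncD z w : normc (z + w) <= normc z + normc w.
Proof.
exact: (@le_normcD R z w).
Qed.

Lemma ncB z w : normc z - normc w <= normc (z - w).
Proof. by rewrite lerBlDr -{1}(subrK w z); exact: ncD. Qed.

Lemma ncR (x : R) : normc x%:C = `|x|.
Proof. by rewrite ncE /= expr0n/= addr0 sqrtr_sqr. Qed.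

Lemma ler_Re_nc z : `|Re z| <= normc z.
Proof.
by rewrite ncE -sqrtr_sqr ler_wsqrtr// lerDl sqr_ge0.
Qed.

Lemma ler_Im_nc z : `|Im z| <= normc z.
Proof.
by rewrite ncE -sqrtr_sqr ler_wsqrtr// lerDr sqr_ge0.
Qed.

Lemma nc_le_ReIm z : normc z <= `|Re z| + `|Im z|.
Proof.
rewrite -(ler_pXn2r (_ : (0 < 2)%N)) ?nnegrE ?nc_ge0 ?addr_ge0// sqr_nc.
rewrite sqrrD !real_normK ?num_real// lerD2r lerDl.
by rewrite mulrn_wge0// mulr_ge0.
Qed.

Lemma ReIm_eq z w : Re z = Re w -> Im z = Im w -> z = w.
Proof. by case: z w => ? ? [? ?] /= -> ->. Qed.

Lemma Re_cexp z : Re (cexp z) = expR (Re z) * cos (Im z).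
Proof. by rewrite cexp.unlock cReM /= mul0r subr0. Qed.

Lemma Im_cexp z : Im (cexp z) = expR (Re z) * sin (Im z).
Proof. by rewrite cexp.unlock cImM /= mul0r addr0. Qed.

Lemma cexpD z w : cexp (z + w) = cexp z * cexp w.
Proof.
apply: ReIm_eq; rewrite ?cReM ?cImM !(Re_cexp, Im_cexp) cReD cImD expRD ?cosD ?sinD; ring.
Qed.

Lemma cexp0 : cexp (0 : R[i]) = 1.
Proof. by apply: ReIm_eq; rewrite ?Re_cexp ?Im_cexp /= expR0 ?cos0 ?sin0 mul1r. Qed.

Lemma nc_cexp z : normc (cexp z) = expR (Re z).
Proof.
rewrite ncE Re_cexp Im_cexp !exprMn -mulrDr cos2Dsin2 mulr1 sqrtr_sqr.
by rewrite ger0_norm// expR_ge0.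
Qed.

Lemma cexp_sum n (z : 'I_n -> R[i]) : cexp (\sum_i z i) = \prod_i cexp (z i).
Proof. by elim/big_rec2: _ => [|i y1 y2 _ <-]; rewrite ?cexp0// cexpD. Qed.

Lemma expiE (b : R) : expi b = cexp (0 +i* b).
Proof. by apply: ReIm_eq; rewrite ?Re_cexp ?Im_cexp /= expR0 mul1r. Qed.

Lemma nc_expi (b : R) : normc (expi b) = 1.
Proof. by rewrite expiE nc_cexp expR0. Qed.

Lemma nc_unit z : exists2 u : R[i], normc u = 1 & u * z = (normc z)%:C.
Proof.
have [z0|z0] := eqVneq (normc z) 0.
  exists 1; first exact: ComplexField.Normc.normc1.
  by rewrite z0 (ComplexField.Normc.eq0_normc z0) mulr0.
exists ((normc z)^-1%:C * (Re z -i* Im z)).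
  rewrite ncM ncR ger0_norm ?invr_ge0 ?nc_ge0// [normc (_ -i* _)]ncE /= sqrrN.
  by rewrite -ncE mulVf.
have E := sqr_nc z.
apply: ReIm_eq; rewrite !(cReM, cImM) /=; last by ring.
apply: (mulfI z0); rewrite -[RHS]expr2 E.
by field.
Qed.

End complex_facts.

Section complex_measurable.
Context {R : realType} d (T : measurableType d).
Implicit Types F G : T -> R[i].

Definition Cmeasurable F :=
  measurable_fun setT (fun t => Re (F t)) /\
  measurable_fun setT (fun t => Im (F t)).

Lemma Cmeasurable_cst z : Cmeasurable (fun _ => z).
Proof. by split; exact: measurable_cst. Qed.

Lemma CmeasurableD F G : Cmeasurable F -> Cmeasurable G ->
  Cmeasurable (fun t => F t + G t).
Proof.
move=> [F1 F2] [G1 G2]; split.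
  by under eq_fun do rewrite cReD; exact: measurable_funD.
by under eq_fun do rewrite cImD; exact: measurable_funD.
Qed.

Lemma CmeasurableM F G : Cmeasurable F -> Cmeasurable G ->
  Cmeasurable (fun t => F t * G t).
Proof.
move=> [F1 F2] [G1 G2]; split.
  by under eq_fun do rewrite cReM; apply: measurable_funB; exact: measurable_funM.
by under eq_fun do rewrite cImM; apply: measurable_funD; exact: measurable_funM.
Qed.

Lemma CmeasurableN F : Cmeasurable F -> Cmeasurable (fun t => - F t).
Proof.
move=> [F1 F2]; split.
  by under eq_fun do rewrite cReN; exact: measurableT_comp.
by under eq_fun do rewrite cImN; exact: measurableT_comp.
Qed.

Lemma CmeasurableR (f : T -> R) : measurable_fun setT f ->
  Cmeasurable (fun t => (f t)%:C).
Proof. by move=> mf; split => //=; exact: measurable_cst. Qed.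

Lemma Cmeasurable_pair (f g : T -> R) : measurable_fun setT f ->
  measurable_fun setT g -> Cmeasurable (fun t => f t +i* g t).
Proof. by move=> mf; split. Qed.

Lemma Cmeasurable_prod (I : Type) (s : seq I) (F : I -> T -> R[i]) :
  (forall i, Cmeasurable (F i)) -> Cmeasurable (fun t => \prod_(i <- s) F i t).
Proof.
move=> mF; elim: s => [|i s IH].
  by under eq_fun do rewrite big_nil; exact: Cmeasurable_cst.
by under eq_fun do rewrite big_cons; exact: CmeasurableM.
Qed.

Lemma Cmeasurable_cexp F : Cmeasurable F -> Cmeasurable (fun t => cexp (F t)).
Proof.
move=> [F1 F2]; split.
  under eq_fun do rewrite Re_cexp; apply: measurable_funM.
    exact: measurableT_comp.
  by apply: measurableT_comp => //; apply: continuous_measurable_fun;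
    exact: continuous_cos.
under eq_fun do rewrite Im_cexp; apply: measurable_funM.
  exact: measurableT_comp.
by apply: measurableT_comp => //; apply: continuous_measurable_fun;
  exact: continuous_sin.
Qed.

Lemma measurable_normc F : Cmeasurable F ->
  measurable_fun setT (fun t => normc (F t)).
Proof.
move=> [F1 F2]; under eq_fun do rewrite ncE.
apply: (@measurableT_comp _ _ _ _ _ _ (@Num.sqrt R)).
  by apply: continuous_measurable_fun; exact: sqrt_continuous.
by apply: measurable_funD; exact: measurable_funX.
Qed.

End complex_measurable.

Section complex_integral.
Context {R : realType} d (T : measurableType d) (mu : {measure set T -> \bar R}).
Implicit Types F G : T -> R[i].

Definition Cintegrable F :=
  mu.-integrable setT (fun t => (Re (F t))%:E) /\
  mu.-integrable setT (fun t => (Im (F t))%:E).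

Lemma Cintegrable_measurable F : Cintegrable F -> Cmeasurable F.
Proof.
by move=> [/integrableP[/measurable_EFinP ? _] /integrableP[/measurable_EFinP]].
Qed.

Lemma le_Cintegrable F (g : T -> R) : Cmeasurable F ->
  mu.-integrable setT (EFin \o g) -> (forall t, normc (F t) <= g t) ->
  Cintegrable F.
Proof.
move=> [F1 F2] ig Fg; split; apply: le_integrable ig => //.
- exact/measurable_EFinP.
- move=> t _ /=; rewrite lee_fin (le_trans (ler_Re_nc _))//.
  by rewrite (le_trans (Fg t))// ler_norm.
- exact/measurable_EFinP.
- move=> t _ /=; rewrite lee_fin (le_trans (ler_Im_nc _))//.
  by rewrite (le_trans (Fg t))// ler_norm.
Qed.

Lemma integrable_normc F : Cintegrable F ->
  mu.-integrable setT (EFin \o (fun t => normc (F t))).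
Proof.
move=> iF; have mF := Cintegrable_measurable iF; case: iF => F1 F2.
have : mu.-integrable setT (fun t => (`|(Re (F t))%:E| + `|(Im (F t))%:E|)%E).
  by apply: integrableD => //; exact: integrable_abse.
apply: le_integrable => //.
  by apply/measurable_EFinP; exact: measurable_normc.
move=> t _ /=; rewrite lee_fin ger0_norm ?nc_ge0//.
by rewrite (le_trans (nc_le_ReIm _))// ler_norm.
Qed.

Lemma CintegrableR (f : T -> R) : mu.-integrable setT (EFin \o f) ->
  Cintegrable (fun t => (f t)%:C).
Proof. by move=> i_f; split => //=; exact: integrable0. Qed.

Lemma CintegrableD F G : Cintegrable F -> Cintegrable G ->
  Cintegrable (fun t => F t + G t).
Proof.
move=> [F1 F2] [G1 G2]; split.
  by under eq_fun do rewrite cReD EFinD; exact: integrableD.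
by under eq_fun do rewrite cImD EFinD; exact: integrableD.
Qed.

Lemma CintegrableZ z F : Cintegrable F -> Cintegrable (fun t => z * F t).
Proof.
move=> iF; apply: (@le_Cintegrable _ (fun t => normc z * normc (F t))).
- apply: CmeasurableM; first exact: Cmeasurable_cst.
  exact: Cintegrable_measurable.
- have := integrable_normc iF => /(@integrableZl _ _ _ mu _ measurableT (normc z)).
  by under eq_fun do rewrite -EFinM.
- by move=> t; rewrite ncM.
Qed.

Lemma CintegralD F G : Cintegrable F -> Cintegrable G ->
  Cintegral mu (fun t => F t + G t) = Cintegral mu F + Cintegral mu G.
Proof.
move=> [F1 F2] [G1 G2]; apply: ReIm_eq; rewrite ?(cReD,cImD) /=.
  by under eq_Rintegral do rewrite cReD; exact: RintegralD.
by under eq_Rintegral do rewrite cImD; exact: RintegralD.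
Qed.

Lemma CintegralZ z F : Cintegrable F ->
  Cintegral mu (fun t => z * F t) = z * Cintegral mu F.
Proof.
have iZ (r : R) (f : T -> R) : mu.-integrable setT (fun t => (f t)%:E) ->
    mu.-integrable setT (fun t => (r * f t)%:E).
  move=> /(@integrableZl _ _ _ mu _ measurableT r).
  by under eq_fun do rewrite -EFinM.
move=> [F1 F2]; apply: ReIm_eq; rewrite ?(cReM,cImM) /=.
  under eq_Rintegral do rewrite cReM.
  by rewrite RintegralB ?RintegralZl//; exact: iZ.
under eq_Rintegral do rewrite cImM.
by rewrite RintegralD ?RintegralZl//; exact: iZ.
Qed.

Lemma CintegralR (f : T -> R) :
  Cintegral mu (fun t => (f t)%:C) = (\int[mu]_t f t)%:C.
Proof.
apply: ReIm_eq => //=; rewrite /Rintegral.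
by under eq_integral do rewrite /=; rewrite integral0.
Qed.

Lemma eq_Cintegral F G : F =1 G -> Cintegral mu F = Cintegral mu G.
Proof. by move=> /funext ->. Qed.

(** A unit scalar rotates the integral onto the positive real axis, which reduces the claim to a
    bound on a real part. *)
Lemma normc_Cintegral F : Cintegrable F ->
  normc (Cintegral mu F) <= \int[mu]_t normc (F t).
Proof.
move=> iF; have [u u1 uE] := nc_unit (Cintegral mu F).
have : Re (u * Cintegral mu F) = normc (Cintegral mu F) by rewrite uE.
rewrite -CintegralZ// => <- /=.
have [iuF _] := CintegrableZ u iF.
apply: le_Rintegral => //; first exact: integrable_normc.
by move=> t _; rewrite (le_trans (ler_norm _))// (le_trans (ler_Re_nc _))// ncM u1 mul1r.
Qed.

Lemma normc_Cintegral_le F (g : T -> R) : Cmeasurable F ->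
  mu.-integrable setT (EFin \o g) -> (forall t, normc (F t) <= g t) ->
  normc (Cintegral mu F) <= \int[mu]_t g t.
Proof.
move=> mF ig Fg; have iF := le_Cintegrable mF ig Fg.
apply: (le_trans (normc_Cintegral iF)); apply: le_Rintegral => //.
exact: integrable_normc.
Qed.

(** The moduli of the differences are dominated by 2 g, so real dominated convergence applies to
    them. *)
Lemma Cdominated_cvg (F_ : nat -> T -> R[i]) F (g : T -> R) :
  (forall n, Cmeasurable (F_ n)) -> Cmeasurable F ->
  mu.-integrable setT (EFin \o g) ->
  (forall n t, normc (F_ n t) <= g t) ->
  (forall t, normc (F t) <= g t) ->
  (forall t, normc (F_ n t - F t) @[n --> \oo] --> 0) ->
  normc (Cintegral mu (F_ n) - Cintegral mu F) @[n --> \oo] --> 0.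
Proof.
move=> mF_ mF ig F_g Fg F_F.
have iF_ n := le_Cintegrable (mF_ n) ig (F_g n).
have iF := le_Cintegrable mF ig Fg.
have mD n : Cmeasurable (fun t => F_ n t - F t).
  by apply: CmeasurableD => //; exact: CmeasurableN.
have iD n : Cintegrable (fun t => F_ n t - F t).
  have iNF := CintegrableZ (-1) iF.
  have := CintegrableD (iF_ n) iNF.
  by under eq_fun do rewrite mulN1r.
have m1 n : measurable_fun setT (fun t => (normc (F_ n t - F t))%:E).
  by apply/measurable_EFinP; exact: measurable_normc.
have h1 : {ae mu, forall t, setT t ->
    (normc (F_ n t - F t))%:E @[n --> \oo] --> (0 : \bar R)%E}.
  by apply: aeW => t _; apply: cvg_EFin; [exact: nearW|exact: F_F].
have h2 : mu.-integrable setT (fun t => (2 * g t)%:E).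
  have := ig => /(@integrableZl _ _ _ mu _ measurableT 2).
  by under eq_fun do rewrite -EFinM.
have h3 : {ae mu, forall t n, setT t ->
    (`|(normc (F_ n t - F t))%:E| <= (2 * g t)%:E)%E}.
  apply: aeW => t n _; rewrite abse_EFin lee_fin ger0_norm ?nc_ge0//.
  by rewrite (le_trans (ncD _ _))// ncN mulr2n mulrDl mul1r lerD.
have [_ _ ] := dominated_convergence measurableT m1
  (measurable_cst _) h1 h2 h3.
rewrite integral0 => cvg0.
have {}cvg0 : \int[mu]_t normc (F_ n t - F t) @[n --> \oo] --> (0 : R).
  by apply: fine_cvg; exact: cvg0.
apply: (squeeze_cvgr _ (cvg_cst (0 : R)) cvg0).
apply: nearW => n; apply/andP; split; first exact: nc_ge0.
rewrite -mulN1r -CintegralZ// -CintegralD//; last exact: CintegrableZ.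
under eq_Cintegral do rewrite mulN1r.
exact: normc_Cintegral.
Qed.

End complex_integral.

Lemma Cmeasurable_comp {R : realType} d d' (T : measurableType d)
    (U : measurableType d') (F : U -> R[i]) (phi : T -> U) :
  Cmeasurable F -> measurable_fun setT phi ->
  Cmeasurable (fun t => F (phi t)).
Proof.
by move=> [F1 F2] mphi; split; [exact: (measurableT_comp F1)|exact: (measurableT_comp F2)].
Qed.

Section complex_fubini.
Context {R : realType} d1 d2 (T1 : measurableType d1) (T2 : measurableType d2).
Variables (m1 : {sigma_finite_measure set T1 -> \bar R})
  (m2 : {sigma_finite_measure set T2 -> \bar R}).

(** Every section is required to be integrable, not almost every one: the inner real integral is
    [fine] of an extended one, and the two agree at each x only where the latter is finite. *)
Let Rintegral12 (f : T1 * T2 -> R) :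
  (m1 \x m2)%E.-integrable setT (fun z => (f z)%:E) ->
  (forall x, m2.-integrable setT (fun y => (f (x, y))%:E)) ->
  m1.-integrable setT (fun x => (\int[m2]_y f (x, y))%:E) /\
  \int[m1]_x \int[m2]_y f (x, y) = \int[(m1 \x m2)%E]_z f z.
Proof.
move=> i_f if1.
have E : (fun x => (\int[m2]_y f (x, y))%:E) = (fun x => \int[m2]_y (f (x, y))%:E)%E.
  by apply/funext => x; rewrite /Rintegral fineK//; exact: integrable_fin_num.
split; first by rewrite E; exact: (integrable_fubini_F i_f).
by rewrite [LHS]/Rintegral E (integral12_prod_meas1 i_f).
Qed.

Let Rintegral21 (f : T1 * T2 -> R) :
  (m1 \x m2)%E.-integrable setT (fun z => (f z)%:E) ->
  (forall y, m1.-integrable setT (fun x => (f (x, y))%:E)) ->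
  measurable_fun setT (fun y => \int[m1]_x f (x, y)) /\
  \int[m2]_y \int[m1]_x f (x, y) = \int[(m1 \x m2)%E]_z f z.
Proof.
move=> i_f if1.
have E : (fun y => (\int[m1]_x f (x, y))%:E) = (fun y => \int[m1]_x (f (x, y))%:E)%E.
  by apply/funext => y; rewrite /Rintegral fineK//; exact: integrable_fin_num.
split; first by apply/measurable_EFinP; rewrite /comp E; exact: (measurable_fubini_G i_f).
by rewrite [LHS]/Rintegral E (integral21_prod_meas1 i_f).
Qed.

Lemma Cfubini12 (F : T1 * T2 -> R[i]) : Cintegrable (m1 \x m2)%E F ->
  (forall x, Cintegrable m2 (fun y => F (x, y))) ->
  Cintegrable m1 (fun x => Cintegral m2 (fun y => F (x, y))) /\
  Cintegral m1 (fun x => Cintegral m2 (fun y => F (x, y))) =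
  Cintegral (m1 \x m2)%E F.
Proof.
move=> [F1 F2] iF.
have [i1 e1] := Rintegral12 F1 (fun x => (iF x).1).
have [i2 e2] := Rintegral12 F2 (fun x => (iF x).2).
by split=> //; apply: ReIm_eq.
Qed.

Lemma Cfubini21 (F : T1 * T2 -> R[i]) : Cintegrable (m1 \x m2)%E F ->
  (forall y, Cintegrable m1 (fun x => F (x, y))) ->
  Cmeasurable (fun y => Cintegral m1 (fun x => F (x, y))) /\
  Cintegral m2 (fun y => Cintegral m1 (fun x => F (x, y))) =
  Cintegral (m1 \x m2)%E F.
Proof.
move=> [F1 F2] iF.
have [i1 e1] := Rintegral21 F1 (fun y => (iF y).1).
have [i2 e2] := Rintegral21 F2 (fun y => (iF y).2).
by split=> //; apply: ReIm_eq.
Qed.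

Lemma Cintegrable_prod2 (F : T1 -> R[i]) (G : T2 -> R[i]) :
  Cintegrable m1 F -> Cintegrable m2 G ->
  Cintegrable (m1 \x m2)%E (fun z => F z.1 * G z.2).
Proof.
move=> iF iG.
have mH : Cmeasurable (fun z : T1 * T2 => F z.1 * G z.2).
  by apply: CmeasurableM; apply: Cmeasurable_comp; [exact: Cintegrable_measurable iF|
    exact: measurable_fst|exact: Cintegrable_measurable iG|exact: measurable_snd].
apply: (@le_Cintegrable _ _ _ _ _ (fun z => normc (F z.1 * G z.2))) => //.
apply/integrable12ltyP; first by apply/measurable_EFinP; exact: measurable_normc.
have nF := integrable_normc iF; have nG := integrable_normc iG.
rewrite [ltLHS](_ : _ = \int[m1]_x ((normc (F x))%:E * (\int[m2]_y (normc (G y))%:E)))%E.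
  rewrite -(@fineK _ (\int[m2]_y (normc (G y))%:E)%E);
  last exact: integrable_fin_num.
  have := nF => /(@integrableZr _ _ _ m1 _ measurableT (\int[m2]_y (normc (G y)))).
  move=> /integrable_lty -/(_ measurableT); apply: le_lt_trans.
  by [].
apply: eq_integral => x _; rewrite -(@fineK _ (\int[m2]_y (normc (G y))%:E)%E);
  last exact: integrable_fin_num.
rewrite fineK; last exact: integrable_fin_num.
rewrite -integralZl//; apply: eq_integral => y _.
by rewrite abse_EFin -EFinM ncM ger0_norm// mulr_ge0// nc_ge0.
Qed.

Lemma Cintegral_prod2 (F : T1 -> R[i]) (G : T2 -> R[i]) :
  Cintegrable m1 F -> Cintegrable m2 G ->
  Cintegral (m1 \x m2)%E (fun z => F z.1 * G z.2) =
  Cintegral m1 F * Cintegral m2 G.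
Proof.
move=> iF iG.
have [_ <-] := Cfubini12 (Cintegrable_prod2 iF iG) (fun x => CintegrableZ (F x) iG).
under eq_Cintegral => x do rewrite /= CintegralZ// mulrC.
by rewrite CintegralZ// mulrC.
Qed.

End complex_fubini.

(** * Product integrals over tuples *)

Section tuple_integral.
Context {R : realType}.
Local Notation mu := (@lebesgue_measure R).

(** [lebesgue_tuple] at n + 1 is the pushforward of a product measure under [tuple_of_pair], so the
    induction step is the product formula for pairs carried along that map. *)
Lemma Cintegral_tuple (n : nat) (F : 'I_n -> R -> R[i]) :
  (forall l, Cintegrable mu (F l)) ->
  Cintegrable (lebesgue_tuple R n) (fun t => \prod_l F l (tnth t l)) /\
  Cintegral (lebesgue_tuple R n) (fun t => \prod_l F l (tnth t l)) =
  \prod_l Cintegral mu (F l).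
Proof.
elim: n F => [|n IH] F iF.
  have -> : (fun t : 0.-tuple (measurableTypeR R) => \prod_l F l (tnth t l)) =
      fun=> 1%:C by apply/funext => t; rewrite big_ord0.
  split; first by apply: CintegrableR; apply/integrableP; split;
    [exact: measurable_cst|rewrite integral_dirac//= diracT mul1e ltry].
  by rewrite CintegralR big_ord0 /Rintegral integral_dirac// diracT mul1e.
have [iH eH] := IH (fun l => F (lift ord0 l)) (fun l => iF _).
have iP := Cintegrable_prod2 (iF ord0) iH.
have E : (fun z : measurableTypeR R * n.-tuple (measurableTypeR R) =>
     F ord0 z.1 * \prod_l F (lift ord0 l) (tnth z.2 l)) =
   (fun t => \prod_l F l (tnth t l)) \o @tuple_of_pair _ (measurableTypeR R) n.
  apply/funext => -[x t] /=; rewrite big_ord_recl; congr (F _ _ * _).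
  by apply: eq_bigr => l _; rewrite tnthS.
have mT : Cmeasurable (fun t : n.+1.-tuple (measurableTypeR R) => \prod_l F l (tnth t l)).
  apply: Cmeasurable_prod => l; apply: Cmeasurable_comp; last exact: measurable_tnth.
  exact: Cintegrable_measurable (iF l).
have mtp := @measurable_tuple_of_pair _ (measurableTypeR R) n.
move: iP; rewrite E => -[i1 i2].
have i1' : Cintegrable (lebesgue_tuple R n.+1) (fun t => \prod_l F l (tnth t l)).
  split.
    apply: (integrable_pushforward mtp _ i1 measurableT).
    by apply/measurable_EFinP; exact: mT.1.
  apply: (integrable_pushforward mtp _ i2 measurableT).
  by apply/measurable_EFinP; exact: mT.2.
split=> //.
rewrite big_ord_recl -eH -Cintegral_prod2// E.
apply: ReIm_eq; congr fine.
  apply: (integral_pushforward mtp _ i1 measurableT).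
  by apply/measurable_EFinP; exact: mT.1.
apply: (integral_pushforward mtp _ i2 measurableT).
by apply/measurable_EFinP; exact: mT.2.
Qed.

End tuple_integral.

(** * Derivatives of complex-valued functions and differentiation under the integral *)

Section complex_derivative.
Context {R : realType}.
Implicit Types F G : R -> R[i].

Definition is_Cderive (x : R) F (dF : R[i]) :=
  is_derive x 1 (fun y => Re (F y)) (Re dF) /\
  is_derive x 1 (fun y => Im (F y)) (Im dF).

Lemma is_Cderive_eq x F a b : is_Cderive x F a -> a = b -> is_Cderive x F b.
Proof. by move=> ? <-. Qed.

Lemma is_Cderive_cst x z : is_Cderive x (fun _ => z) 0.
Proof. by split; exact: is_derive_cst. Qed.

Lemma is_Cderive_id x : is_Cderive x (fun y => y%:C) 1.
Proof. by split; [exact: is_derive_id|exact: is_derive_cst]. Qed.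

Lemma is_CderiveD x F G a b : is_Cderive x F a -> is_Cderive x G b ->
  is_Cderive x (fun y => F y + G y) (a + b).
Proof.
move=> [F1 F2] [G1 G2]; split.
  by under eq_fun do rewrite cReD; rewrite cReD; exact: is_deriveD.
by under eq_fun do rewrite cImD; rewrite cImD; exact: is_deriveD.
Qed.

Lemma is_CderiveM x F G a b : is_Cderive x F a -> is_Cderive x G b ->
  is_Cderive x (fun y => F y * G y) (a * G x + F x * b).
Proof.
move=> [F1 F2] [G1 G2]; split.
  under eq_fun do rewrite cReM.
  apply: (is_derive_eq (is_deriveB (is_deriveM F1 G1) (is_deriveM F2 G2))).
  by rewrite !(cReD, cReM) /GRing.scale/=; ring.
under eq_fun do rewrite cImM.
apply: (is_derive_eq (is_deriveD (is_deriveM F1 G2) (is_deriveM F2 G1))).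
by rewrite !(cImD, cImM) /GRing.scale/=; ring.
Qed.

Lemma is_Cderive_cexp x F a : is_Cderive x F a ->
  is_Cderive x (fun y => cexp (F y)) (a * cexp (F x)).
Proof.
move=> [F1 F2].
have e1 := is_derive1_comp (is_derive_expR (Re (F x))) F1.
have e2 := is_derive1_comp (is_derive_cos (Im (F x))) F2.
have e3 := is_derive1_comp (is_derive_sin (Im (F x))) F2.
split.
  under eq_fun do rewrite Re_cexp.
  apply: (is_derive_eq (is_deriveM e1 e2)).
  by rewrite cReM Re_cexp Im_cexp /GRing.scale/=; ring.
under eq_fun do rewrite Im_cexp.
apply: (is_derive_eq (is_deriveM e1 e3)).
by rewrite cImM Re_cexp Im_cexp /GRing.scale/=; ring.
Qed.

Lemma is_Cderive0_cst F : (forall x, is_Cderive x F 0) -> forall x y, F x = F y.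
Proof.
move=> F0 x y; apply: ReIm_eq.
  by apply: (is_derive_0_is_cst (f := fun x => Re (F x))) => z; exact: (F0 z).1.
by apply: (is_derive_0_is_cst (f := fun x => Im (F x))) => z; exact: (F0 z).2.
Qed.

Lemma is_Cderive_continuous F dF : (forall x, is_Cderive x F (dF x)) ->
  continuous (fun x => Re (F x)) /\ continuous (fun x => Im (F x)).
Proof.
move=> F0; split=> x; apply: differentiable_continuous; apply/derivable1_diffP.
  by have [[]] := F0 x.
by have [_ []] := F0 x.
Qed.

Lemma is_Cderive_measurable F dF : (forall x, is_Cderive x F (dF x)) ->
  Cmeasurable (F : measurableTypeR R -> R[i]).
Proof.
by move=> /is_Cderive_continuous[? ?]; split; exact: continuous_measurable_fun.
Qed.

End complex_derivative.

Section derive_under.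
Context {R : realType} d (T : measurableType d) (mu : {measure set T -> \bar R}).

Lemma is_Cderive_Cintegral (F F' : R -> T -> R[i]) (G : T -> R) (u v a : R) :
  u < a < v ->
  (forall x, u < x < v -> Cintegrable mu (F x)) ->
  (forall x t, u < x < v -> is_Cderive x (F ^~ t) (F' x t)) ->
  mu.-integrable setT (EFin \o G) ->
  (forall x t, u < x < v -> normc (F' x t) <= G t) ->
  is_Cderive a (fun x => Cintegral mu (F x)) (Cintegral mu (F' a)).
Proof.
move=> auv iF dF iG F'G.
have inI x : `]u, v[%classic x -> u < x < v by rewrite /= in_itv.
have G0 t : 0 <= G t by apply: le_trans (F'G a t auv); exact: nc_ge0.
have Ia : `]u, v[%classic a by rewrite /= in_itv.
have real (f f' : R -> T -> R) :
    (forall x, u < x < v -> mu.-integrable setT (EFin \o f x)) ->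
    (forall x t, u < x < v -> is_derive x 1 (f ^~ t) (f' x t)) ->
    (forall x t, u < x < v -> `|f' x t| <= G t) ->
    is_derive a 1 (fun x => \int[mu]_t f x t) (\int[mu]_t f' a t).
  move=> i_f df fG.
  have d1 x t : u < x < v -> partial1of2 f x t = f' x t.
    by move=> xuv; rewrite partial1of2E; have [] := df x t xuv.
  have h1 x : `]u, v[%classic x -> mu.-integrable setT (EFin \o f x).
    by move=> /inI; exact: i_f.
  have h2 x t : `]u, v[%classic x -> setT t -> derivable (f ^~ t) x 1.
    by move=> /inI xuv _; have [] := df x t xuv.
  have h3 x t : `]u, v[%classic x -> setT t -> `|partial1of2 f x t| <= G t.
    by move=> /inI xuv _; rewrite d1//; exact: fG.
  apply: DeriveDef.
    exact: (derivable_under_integral measurableT Ia h1 h2 G0 iG h3).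
  rewrite -derive1E (differentiation_under_integral measurableT Ia h1 h2 G0 iG h3).
  by apply: eq_Rintegral => t _; exact: d1.
split.
  apply: (real (fun x t => Re (F x t)) (fun x t => Re (F' x t))).
  - by move=> x /iF[].
  - by move=> x t /(dF x t)[].
  - by move=> x t xuv; rewrite (le_trans (ler_Re_nc _))// F'G.
apply: (real (fun x t => Im (F x t)) (fun x t => Im (F' x t))).
- by move=> x /iF[].
- by move=> x t /(dF x t)[].
- by move=> x t xuv; rewrite (le_trans (ler_Im_nc _))// F'G.
Qed.

End derive_under.

Section integral_of_derivative.
Context {R : realType}.
Local Notation mu := (@lebesgue_measure R).

Lemma Rintegral_derive_eq0 (F f : R -> R) :
  (forall x : R, is_derive x 1 F (f x)) -> continuous f ->
  mu.-integrable setT (EFin \o f) ->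
  F n%:R @[n --> \oo] --> (0 : R) -> F (- n%:R) @[n --> \oo] --> (0 : R) ->
  \int[mu]_x f x = 0.
Proof.
move=> dF cf i_f F1 F2.
have mf : measurable_fun setT f by exact: continuous_measurable_fun.
have cF : continuous F.
  by move=> x; apply: differentiable_continuous; apply/derivable1_diffP; have [] := dF x.
(* Endpoints n + 1 keep the interval nondegenerate at n = 0, as the fundamental theorem of calculus
   requires. *)
pose D (n : nat) : set R := `[- n.+1%:R, n.+1%:R]%classic.
have mD n : measurable (D n) by exact: measurable_itv.
have E n : (\int[mu]_(x in D n) (f x)%:E = (F n.+1%:R - F (- n.+1%:R))%:E)%E.
  rewrite (@continuous_FTC2 _ f F)//.
  - by rewrite gtrN// ltr0Sn.
  - exact: continuous_subspaceT.
  - split; first by move=> x _; have [] := dF x.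
    + by apply: cvg_at_right_filter; exact: cF.
    + by apply: cvg_at_left_filter; exact: cF.
  - by move=> x _; rewrite derive1E; have [_ ->] := dF x.
have h1 n : measurable_fun setT (fun x => ((f \_ (D n)) x)%:E).
  by apply/measurable_EFinP; apply/(measurable_restrict _ (mD n) measurableT);
    rewrite setTI; exact: measurable_funTS.
have h2 : {ae mu, forall x, setT x -> ((f \_ (D n)) x)%:E @[n --> \oo] --> (f x)%:E}.
  apply: aeW => x _; apply: cvg_near_cst.
  near=> n; rewrite patchE ifT// inE /D /= in_itv/=.
  have : `|x| <= n.+1%:R.
    rewrite (@le_trans _ _ n%:R)// ?ler_nat//; near: n; exact: nbhs_infty_ger.
  by rewrite ler_norml.
have h3 : {ae mu, forall x (n : nat), setT x ->
    (`|((f \_ (D n)) x)%:E| <= (`|f x|)%:E)%E}.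
  apply: aeW => x n _; rewrite abse_EFin lee_fin patchE.
  by case: ifP => // _; rewrite normr0.
have [_ _] := @dominated_convergence _ _ _ mu setT measurableT
  (fun n x => ((f \_ (D n)) x)%:E) (EFin \o f) (fun x => (`|f x|)%:E)
  h1 (measurable_int _ i_f) h2 (integrable_abse i_f) h3.
have -> : (fun n => \int[mu]_x ((f \_ (D n)) x)%:E)%E =
          (fun n => (F n.+1%:R - F (- n.+1%:R))%:E).
  apply/funext => n; rewrite -E [RHS]integral_mkcond.
  by apply: eq_integral => x _; rewrite restrict_EFin.
move=> c1; have c2 : (F n.+1%:R - F (- n.+1%:R))%:E @[n --> \oo] --> (0 - 0 : R)%:E.
  apply: cvg_EFin; first exact: nearW.
  apply: cvgB.
    by have := F1; rewrite -(cvg_shiftS (fun n => F n%:R)).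
  by have := F2; rewrite -(cvg_shiftS (fun n => F (- n%:R))).

by rewrite /Rintegral (cvg_unique _ c1 c2)// subrr.
Unshelve. all: end_near. Qed.

Lemma Cintegral_derive_eq0 (F dF : R -> R[i]) :
  (forall x, is_Cderive x F (dF x)) ->
  continuous (fun x => Re (dF x)) -> continuous (fun x => Im (dF x)) ->
  Cintegrable mu dF ->
  normc (F n%:R) @[n --> \oo] --> (0 : R) ->
  normc (F (- n%:R)) @[n --> \oo] --> (0 : R) ->
  Cintegral mu dF = 0.
Proof.
move=> h cR cI [iR iI] F1 F2.
have sq (f g : nat -> R) : (forall n, `|f n| <= g n) ->
    g n @[n --> \oo] --> (0 : R) -> f n @[n --> \oo] --> (0 : R).
  move=> fg g0; apply: norm_cvg0.
  by apply: (squeeze_cvgr _ (cvg_cst (0 : R)) g0); apply: nearW => n; rewrite normr_ge0/=.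
apply: ReIm_eq => /=.
  apply: (@Rintegral_derive_eq0 (fun x => Re (F x))) => //.
  - by move=> x; have [] := h x.
  - by apply: sq F1 => n; exact: ler_Re_nc.
  - by apply: sq F2 => n; exact: ler_Re_nc.
apply: (@Rintegral_derive_eq0 (fun x => Im (F x))) => //.
- by move=> x; have [] := h x.
- by apply: sq F1 => n; exact: ler_Im_nc.
- by apply: sq F2 => n; exact: ler_Im_nc.
Qed.

End integral_of_derivative.

(** * Complex Gaussian integrals *)

Section gaussian.
Context {R : realType}.
Local Notation mu := (@lebesgue_measure R).
Implicit Types (w b : R[i]) (s r B M : R).

Lemma integral_gauss r m : 0 < r ->
  mu.-integrable setT (EFin \o (fun s => expR (- r * (s - m) ^+ 2))) /\
  \int[mu]_s expR (- r * (s - m) ^+ 2) = Num.sqrt (pi / r).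
Proof.
(* A normal density of deviation sg has exponent - (s - m)^2 / (2 sg^2); this choice makes it - r (s
   - m)^2. *)
move=> r0; pose sg : R := (Num.sqrt (2 * r))^-1.
have sg0 : sg != 0 by rewrite gt_eqF// invr_gt0 sqrtr_gt0 mulr_gt0.
have sgE : sg ^+ 2 = (2 * r)^-1.
  by rewrite exprVn sqr_sqrtr// mulr_ge0// ltW.
have p0 := normal_peak_gt0 sg0.
have E : (fun s => expR (- r * (s - m) ^+ 2)) =
         (fun s => (normal_peak sg)^-1 * normal_pdf m sg s).
  apply/funext => s; rewrite normal_pdfE// mulKf ?gt_eqF// /normal_fun sgE.
  congr expR; field; lra.
have peakE : (normal_peak sg)^-1 = Num.sqrt (pi / r).
  rewrite /normal_peak invrK sgE; congr Num.sqrt; field; lra.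
have i_pdf := integrable_normal_pdf m sg.
rewrite E; split.
  have := i_pdf => /(@integrableZl _ _ _ mu _ measurableT (normal_peak sg)^-1).
  by under eq_fun do rewrite -EFinM.
rewrite RintegralZl//.
by rewrite /Rintegral integral_normal_pdf /= mulr1 peakE.
Qed.

(** Half of the quadratic decay absorbs the linear growth, by completing the square. *)
Lemma le_quadratic r B s : 0 < r ->
  B * `|s| - r * s ^+ 2 <= B ^+ 2 / (2 * r) - (r / 2) * s ^+ 2.
Proof.
move=> r0; rewrite -subr_ge0.
have -> : B ^+ 2 / (2 * r) - r / 2 * s ^+ 2 - (B * `|s| - r * s ^+ 2) =
    (r * `|s| - B) ^+ 2 / (2 * r).
  by rewrite -(real_normK (num_real s)); field; lra.
by rewrite divr_ge0 ?sqr_ge0// mulr_ge0// ltW.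
Qed.

Lemma integrable_gauss_dom r B M : 0 < r ->
  mu.-integrable setT (EFin \o (fun s => M * expR (B * `|s| - r * s ^+ 2))).
Proof.
move=> r0; have r20 : 0 < r / 2 by rewrite divr_gt0.
have [+ _] := integral_gauss 0 r20.
move=> /(@integrableZl _ _ _ mu _ measurableT (`|M| * expR (B ^+ 2 / (2 * r)))).
under eq_fun do rewrite -EFinM.
apply: le_integrable => //.
  apply/measurable_EFinP; apply: measurable_funM => //.
  apply: measurableT_comp => //; apply: measurable_funB.
    by apply: measurable_funM => //; exact: measurableT_comp.
  by apply: measurable_funM => //; exact: measurable_funX.
move=> s _; rewrite lee_fin !normrM normr_id ?subr0 -mulrA ler_wpM2l//.
rewrite !(ger0_norm (expR_ge0 _)) -expRD ler_expR.
by rewrite mulNr; exact: le_quadratic.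
Qed.

Lemma cvg_gauss_dom r B M (u : R ^nat) : 0 < r -> 0 <= M ->
  (forall n, 0 <= u n <= M * expR (B * n%:R - r * n%:R ^+ 2)) ->
  u n @[n --> \oo] --> (0 : R).
Proof.
move=> r0 M0 hu.
(* Using [le_quadratic] with B + 1 in place of B leaves a spare factor [expR (- n%:R)]. *)
have e0 : M * expR ((B + 1) ^+ 2 / (2 * r)) * expR (- n%:R) @[n --> \oo] --> (0 : R).
  rewrite -[X in _ --> X](mulr0 (M * expR ((B + 1) ^+ 2 / (2 * r)))).
  apply: cvgM; first exact: cvg_cst.
  exact: (@cvg_comp _ _ _ (fun n : nat => n%:R : R) (fun x : R => expR (- x)) _ _ _ cvgr_idn (@cvgr_expR R)).
apply: (squeeze_cvgr _ (cvg_cst (0 : R)) e0).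
apply: nearW => n; have /andP[-> /le_trans ->]//= := hu n.
rewrite -mulrA -expRD ler_wpM2l// ler_expR.
have := le_quadratic (B + 1) n%:R r0; rewrite ger0_norm// => h.
have : 0 <= r / 2 * n%:R ^+ 2 by rewrite mulr_ge0 ?sqr_ge0// divr_ge0// ltW.
lra.
Qed.

(** The factor 2 in front of b makes the completed square contribute exactly exp(pi b^2 / w). *)
Definition qexp w b s : R[i] :=
  cexp (- pi%:C * (w * s%:C ^+ 2 + 2 * b * s%:C)).

Lemma Re_qexp w b s : Re (- pi%:C * (w * s%:C ^+ 2 + 2 * b * s%:C)) =
  - pi * (Re w * s ^+ 2 + 2 * Re b * s).
Proof.
have -> : s%:C ^+ 2 = (s ^+ 2)%:C.
  by rewrite !expr2; apply: ReIm_eq; rewrite ?(cReM,cImM) /=; ring.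
have -> : (2 : R[i]) = (2 : R)%:C by rewrite (rmorph_nat (real_complex R)).
by rewrite !(cReM, cImM, cReN, cImN, cReD, cImD) /=; ring.
Qed.

Lemma normc_qexp w b s :
  normc (qexp w b s) = expR (- pi * (Re w * s ^+ 2 + 2 * Re b * s)).
Proof. by rewrite nc_cexp Re_qexp. Qed.

Lemma normc_qexp_le w b s B r : r <= Re w -> `|Re b| <= B ->
  normc (qexp w b s) <= expR (2 * pi * B * `|s| - pi * r * s ^+ 2).
Proof.
move=> rw bB; rewrite normc_qexp ler_expR.
have p0 := pi_gt0 R.
have h1 : 0 <= pi * ((Re w - r) * s ^+ 2).
  by rewrite mulr_ge0// ?(ltW p0)// mulr_ge0 ?sqr_ge0// subr_ge0.
have h2 : 0 <= pi * (B * `|s| + Re b * s).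
  rewrite mulr_ge0 ?(ltW p0)// -lerBlDr sub0r.
  rewrite (le_trans (ler_norm _))// normrN normrM.
  by rewrite ler_wpM2r.
nra.
Qed.

Lemma is_Cderive_qexp w b s :
  is_Cderive s (qexp w b) (- (2 * pi)%:C * (w * s%:C + b) * qexp w b s).
Proof.
have h0 := is_Cderive_id s.
have h1 := is_CderiveM (is_Cderive_cst s w) (is_CderiveM h0 h0).
have h2 := is_CderiveM (is_Cderive_cst s (2 * b)) h0.
have h := is_CderiveM (is_Cderive_cst s (- pi%:C)) (is_CderiveD h1 h2).
apply: (is_Cderive_eq (is_Cderive_cexp h)).
by rewrite rmorphM/= /qexp; congr (_ * _); ring.
Qed.

Lemma Cmeasurable_qexp w b : Cmeasurable (qexp w b : measurableTypeR R -> R[i]).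
Proof. exact: (is_Cderive_measurable (is_Cderive_qexp w b)). Qed.

Lemma Cintegrable_qexp w b : 0 < Re w -> Cintegrable mu (qexp w b).
Proof.
move=> w0; have pw : 0 < pi * Re w by rewrite mulr_gt0// pi_gt0.
apply: (le_Cintegrable (Cmeasurable_qexp w b)
  (integrable_gauss_dom (2 * pi * `|Re b|) 1 pw)) => s.
by rewrite mul1r; exact: normc_qexp_le.
Qed.

Lemma ler_norm_expR (x : R) : `|x| <= expR (`|x|).
Proof. by rewrite (le_trans _ (expR_ge1Dx _))// lerDr. Qed.

(** The second derivative supplies the continuity and measurability of [dF]. *)
Lemma Cintegral_gauss_derive (F dF ddF : R -> R[i]) r B M :
  (forall s, is_Cderive s F (dF s)) -> (forall s, is_Cderive s dF (ddF s)) ->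
  0 < r -> 0 <= M ->
  (forall s, normc (F s) <= M * expR (B * `|s| - r * s ^+ 2)) ->
  (forall s, normc (dF s) <= M * expR (B * `|s| - r * s ^+ 2)) ->
  Cintegrable mu dF /\ Cintegral mu dF = 0.
Proof.
move=> h1 h2 r0 M0 Fle dFle.
have idF : Cintegrable mu dF.
  apply: (le_Cintegrable _ (integrable_gauss_dom B M r0) dFle).
  exact: (is_Cderive_measurable h2).
split=> //; have [c1 c2] := is_Cderive_continuous h2.
apply: (Cintegral_derive_eq0 h1 c1 c2 idF).
  apply: (cvg_gauss_dom (B := B) r0 M0) => n; rewrite nc_ge0 (le_trans (Fle _))//.
  by rewrite ger0_norm.
apply: (cvg_gauss_dom (B := B) r0 M0) => n; rewrite nc_ge0 (le_trans (Fle _))//.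
by rewrite normrN sqrrN ger0_norm.
Qed.

End gaussian.

Section gaussian_integral.
Context {R : realType}.
Local Notation mu := (@lebesgue_measure R).
Implicit Types (w b : R[i]) (s r B M : R).

(* The branch of [w^(-1/2)] with positive real part, see kappaP. *)
Definition kappa w : R[i] := Cintegral mu (qexp w 0).

Lemma sqr_le_expR s : s ^+ 2 <= expR (2 * `|s|).
Proof.
rewrite -(real_normK (num_real s)) expRM_natl ler_pXn2r// ?nnegrE ?expR_ge0//.
exact: ler_norm_expR.
Qed.

(** The integrand is a multiple of the derivative of [qexp w b], which vanishes at infinity. *)
Lemma moment1 w b : 0 < Re w ->
  Cintegrable mu (fun s => (w * s%:C + b) * qexp w b s) /\
  Cintegral mu (fun s => (w * s%:C + b) * qexp w b s) = 0.
Proof.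
move=> w0; have p0 := pi_gt0 R; have tp0 : 0 <= 2 * pi :> R by apply: mulr_ge0 => //; exact: ltW.
have c0 : - (2 * pi)%:C != 0 :> R[i].
  rewrite oppr_eq0; apply/eqP => /(congr1 (@complex.Re R)) /= /eqP.
  by rewrite gt_eqF// mulr_gt0.
pose C := 1 + 2 * pi * (normc w + normc b).
have C1 : 1 <= C by rewrite lerDl mulr_ge0// addr_ge0// nc_ge0.
(* The extra 1 pays for bounding the linear factor by [expR] of |s|. *)
pose B := 2 * pi * `|Re b| + 1.
pose ddF s := (- (2 * pi)%:C * w) * qexp w b s +
  (- (2 * pi)%:C * (w * s%:C + b)) * (- (2 * pi)%:C * (w * s%:C + b) * qexp w b s).
have dFd s : is_Cderive s (fun s => - (2 * pi)%:C * (w * s%:C + b) * qexp w b s) (ddF s).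
  have h1 := is_CderiveM (is_Cderive_cst s w) (is_Cderive_id s).
  have h2 := is_CderiveM (is_Cderive_cst s (- (2 * pi)%:C))
    (is_CderiveD h1 (is_Cderive_cst s b)).
  apply: (is_Cderive_eq (is_CderiveM h2 (is_Cderive_qexp w b s))).
  by rewrite /ddF; ring.
have le1 s : normc (qexp w b s) * expR `|s| <= expR (B * `|s| - pi * Re w * s ^+ 2).
  have := normc_qexp_le s (lexx (Re w)) (lexx `|Re b|).
  move=> /(ler_wpM2r (expR_ge0 `|s|)) /le_trans; apply.
  by rewrite -expRD ler_expR /B; lra.
have hF s : normc (qexp w b s) <= C * expR (B * `|s| - pi * Re w * s ^+ 2).
  apply: (le_trans _ (ler_wpM2l (le_trans ler01 C1) (le1 s))).
  rewrite mulrCA ler_peMr ?nc_ge0// mulr_ege1// -expR0 ler_expR//.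
have hdF s : normc (- (2 * pi)%:C * (w * s%:C + b) * qexp w b s) <=
    C * expR (B * `|s| - pi * Re w * s ^+ 2).
  apply: (le_trans _ (ler_wpM2l (le_trans ler01 C1) (le1 s))).
  rewrite ncM [leRHS]mulrCA [leRHS]mulrC ler_wpM2r ?nc_ge0//.
  rewrite ncM ncN ncR (ger0_norm tp0).
  have h : normc (w * s%:C + b) <= (normc w + normc b) * expR `|s|.
    rewrite (le_trans (ncD _ _))// ncM ncR mulrDl lerD//.
      by rewrite ler_wpM2l ?nc_ge0// ler_norm_expR.
    by rewrite ler_peMr ?nc_ge0// -expR0 ler_expR.
  rewrite (le_trans (ler_wpM2l tp0 h))//.
  by rewrite mulrA ler_wpM2r ?expR_ge0// lerDr.
have [i1 e1] := Cintegral_gauss_derive (is_Cderive_qexp w b) dFd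
  (mulr_gt0 p0 w0) (le_trans ler01 C1) hF hdF.
have E : (fun s => - (2 * pi)%:C^-1 * (- (2 * pi)%:C * (w * s%:C + b) * qexp w b s))
     = (fun s => (w * s%:C + b) * qexp w b s).
    apply/funext => s; rewrite !mulrA mulrNN mulVf ?mul1r//.
    by rewrite -oppr_eq0.
  rewrite -E; split; first exact: CintegrableZ.
  by rewrite CintegralZ// e1 mulr0.
Qed.

(** Integration by parts: the integral of the derivative of s [qexp w 0 s] is zero. *)
Lemma moment2 w : 0 < Re w ->
  Cintegrable mu (fun s => s%:C ^+ 2 * qexp w 0 s) /\
  Cintegral mu (fun s => s%:C ^+ 2 * qexp w 0 s) = kappa w / ((2 * pi)%:C * w).
Proof.
move=> w0; have p0 := pi_gt0 R; have tp0 : 0 <= 2 * pi :> R by apply: mulr_ge0 => //; exact: ltW.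
have w00 : w != 0 by apply/eqP => wE; move: w0; rewrite wE /= ltxx.
have c0 : (2 * pi)%:C != 0 :> R[i].
  by apply/eqP => /(congr1 (@complex.Re R)) /= /eqP; rewrite gt_eqF// mulr_gt0.
pose C := 1 + 2 * pi * normc w.
have C1 : 1 <= C by rewrite lerDl mulr_ge0// nc_ge0.
have F1 s : is_Cderive s (fun s => s%:C * qexp w 0 s)
    (qexp w 0 s - ((2 * pi)%:C * w) * (s%:C ^+ 2 * qexp w 0 s)).
  apply: (is_Cderive_eq (is_CderiveM (is_Cderive_id s) (is_Cderive_qexp w 0 s))).
  by ring.
have F2 s : exists z, is_Cderive s
    (fun s => qexp w 0 s - ((2 * pi)%:C * w) * (s%:C ^+ 2 * qexp w 0 s)) z.
  have h0 := is_Cderive_qexp w 0 s.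
  have h1 := is_CderiveM (is_CderiveM (is_Cderive_id s) (is_Cderive_id s)) h0.
  have h2 := is_CderiveM (is_Cderive_cst s (-1)) 
     (is_CderiveM (is_Cderive_cst s ((2 * pi)%:C * w)) h1).
  eexists; have := is_CderiveD h0 h2.
  by under eq_fun do rewrite mulN1r -expr2; exact.
have le1 s : normc (qexp w 0 s) * expR (2 * `|s|) <= expR (2 * `|s| - pi * Re w * s ^+ 2).
  have := normc_qexp_le s (lexx (Re w)) (lexx `|Re (0 : R[i])|).
  move=> /(ler_wpM2r (expR_ge0 (2 * `|s|))) /le_trans; apply.
  by rewrite -expRD ler_expR normr0; lra.
have hF s : normc (s%:C * qexp w 0 s) <= C * expR (2 * `|s| - pi * Re w * s ^+ 2).
  apply: (le_trans _ (ler_wpM2l (le_trans ler01 C1) (le1 s))).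
  rewrite ncM ncR mulrCA [leLHS]mulrC ler_wpM2l ?nc_ge0//.
  rewrite (le_trans (ler_norm_expR _))// -[leLHS]mul1r ler_pM ?expR_ge0// ler_expR.
  by rewrite ler_peMl// ler1n.
have hdF s : normc (qexp w 0 s - ((2 * pi)%:C * w) * (s%:C ^+ 2 * qexp w 0 s))
    <= C * expR (2 * `|s| - pi * Re w * s ^+ 2).
  apply: (le_trans _ (ler_wpM2l (le_trans ler01 C1) (le1 s))).
  rewrite -{1}[qexp w 0 s]mul1r mulrA -mulrBl ncM [leLHS]mulrC [leRHS]mulrCA ler_wpM2l ?nc_ge0//.
  rewrite (le_trans (ncD _ _))// ncN -(rmorph1 (real_complex R)) ncR normr1 /C [leRHS]mulrDl lerD//.
    by rewrite mul1r -expR0 ler_expR mulr_ge0.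
  rewrite !ncM !ncR -expr2 real_normK ?num_real// (ger0_norm tp0).
  by rewrite ler_wpM2l ?sqr_le_expR// mulr_ge0// nc_ge0.
have [i1 e1] := Cintegral_gauss_derive F1 (fun s => projT2 (cid (F2 s)))
  (mulr_gt0 p0 w0) (le_trans ler01 C1) hF hdF.
have iq := Cintegrable_qexp 0 w0.
  have E : (fun s => ((2 * pi)%:C * w)^-1 * (qexp w 0 s - (qexp w 0 s -
       ((2 * pi)%:C * w) * (s%:C ^+ 2 * qexp w 0 s))))
     = (fun s => s%:C ^+ 2 * qexp w 0 s).
    apply/funext => s; rewrite opprB addrC subrK mulKf//.
    by rewrite mulf_neq0.
  have iN := CintegrableZ (-1) i1.
  have iD := CintegrableD iq iN.
  have E2 : (fun s => qexp w 0 s + -1 * (qexp w 0 s - ((2 * pi)%:C * w) * (s%:C ^+ 2 * qexp w 0 s)))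
    = (fun s => qexp w 0 s - (qexp w 0 s - ((2 * pi)%:C * w) * (s%:C ^+ 2 * qexp w 0 s))).
    by apply/funext => s; rewrite mulN1r.
  rewrite -E; rewrite E2 in iD; split; first exact: CintegrableZ.
  rewrite CintegralZ// -E2 CintegralD// CintegralZ// e1 mulr0 addr0.
  by rewrite mulrC.
Qed.

End gaussian_integral.

Section gaussian_value.
Context {R : realType}.
Local Notation mu := (@lebesgue_measure R).
Implicit Types (w b : R[i]) (s r B M : R).

Let imag (y : R) : R[i] := 0 +i* y.

Lemma Re_gt0_neq0 w : 0 < Re w -> w != 0.
Proof. by move=> w0; apply/eqP => wE; move: w0; rewrite wE /= ltxx. Qed.

(* No contour integration: along w(u) = x + i u y the function kappa solves
   2 w kappa' = - w' kappa, so that kappa ^+ 2 * w is constant. *)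
Lemma is_Cderive_kappa (x y t : R) : 0 < x ->
  is_Cderive t (fun u => kappa (x%:C + u%:C * imag y))
    (- (imag y * kappa (x%:C + t%:C * imag y)) / (2 * (x%:C + t%:C * imag y))).
Proof.
move=> x0; have p0 := pi_gt0 R.
have ReW u : Re (x%:C + u%:C * imag y) = x.
  by rewrite cReD cReM /=; ring.
have dq (u s : R) : is_Cderive u (fun u => qexp (x%:C + u%:C * imag y) 0 s)
    (- pi%:C * imag y * (s%:C ^+ 2 * qexp (x%:C + u%:C * imag y) 0 s)).
  have h1 := is_CderiveD (is_Cderive_cst u x%:C)
     (is_CderiveM (is_Cderive_id u) (is_Cderive_cst u (imag y))).
  have h2 := is_CderiveD (is_CderiveM h1 (is_Cderive_cst u (s%:C ^+ 2)))
     (is_Cderive_cst u (2 * 0 * s%:C)).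
  have h3 := is_CderiveM (is_Cderive_cst u (- pi%:C)) h2.
  apply: (is_Cderive_eq (is_Cderive_cexp h3)).
  by rewrite /qexp; ring.
have px : 0 < pi * x by rewrite mulr_gt0.
have tt1 : t - 1 < t < t + 1 by apply/andP; split; lra.
have Gle (u s : R) : t - 1 < u < t + 1 ->
    normc (- pi%:C * imag y * (s%:C ^+ 2 * qexp (x%:C + u%:C * imag y) 0 s)) <=
    normc (- pi%:C * imag y) * expR (2 * `|s| - pi * x * s ^+ 2).
  move=> _; rewrite ncM ler_wpM2l ?nc_ge0// expRD ncM ler_pM ?nc_ge0//.
    by rewrite expr2 ncM ncR -expr2 real_normK ?num_real// sqr_le_expR.
  by rewrite normc_qexp ler_expR ReW /=; lra.
have := is_Cderive_Cintegral tt1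
  (fun u _ => Cintegrable_qexp 0 (_ : 0 < Re (x%:C + u%:C * imag y)))
  (fun u s _ => dq u s)
  (integrable_gauss_dom 2 (normc (- pi%:C * imag y)) px) Gle.
move=> h; apply: is_Cderive_eq; first by apply: h => u; rewrite ReW.
have w0 : 0 < Re (x%:C + t%:C * imag y) by rewrite ReW.
have [im em] := moment2 w0.
rewrite CintegralZ// em rmorphM/=.
have -> : (2 : R)%:C = (2 : R[i]) by rewrite (rmorph_nat (real_complex R)).
have pC : (pi : R)%:C != 0.
  by apply/eqP => /(congr1 (@complex.Re R)) /= /eqP; rewrite gt_eqF.
have wn0 := Re_gt0_neq0 w0.
move: (pi%:C) pC (x%:C + _) wn0 (kappa _) => p pn0 W wn0 k.
by field; rewrite wn0 pn0.
Qed.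

Lemma kappa_real (x : R) : 0 < x -> kappa x%:C = (Num.sqrt x)^-1%:C.
Proof.
move=> x0; have p0 := pi_gt0 R; have px : 0 < pi * x by rewrite mulr_gt0.
have [_ e] := integral_gauss 0 px.
rewrite /kappa.
have -> : qexp x%:C 0 = (fun s => (expR (- (pi * x) * (s - 0) ^+ 2))%:C).
  apply/funext => s; apply: ReIm_eq; rewrite ?Re_cexp ?Im_cexp Re_qexp;
  have -> : Im (- pi%:C * (x%:C * s%:C ^+ 2 + 2 * 0 * s%:C)) = 0.
  - by rewrite mulr0 mul0r addr0 expr2 !(cReM, cImM, cReN, cImN) /=; ring.
  - by rewrite cos0 mulr1 /=; congr expR; ring.
  - by rewrite mulr0 mul0r addr0 expr2 !(cReM, cImM, cReN, cImN) /=; ring.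
  - by rewrite sin0 mulr0.
rewrite CintegralR e invfM mulrA divff ?gt_eqF// mul1r.
by rewrite sqrtrV// ltW.
Qed.

Lemma kappa_path (x y t : R) : 0 < x ->
  kappa (x%:C + t%:C * imag y) ^+ 2 * (x%:C + t%:C * imag y) = 1.
Proof.
move=> x0.
have w0 u : x%:C + u%:C * imag y != 0.
  by apply: Re_gt0_neq0; rewrite cReD cReM /=; lra.
have h u : is_Cderive u (fun t => kappa (x%:C + t%:C * imag y) ^+ 2 *
    (x%:C + t%:C * imag y)) 0.
  have h1 := is_Cderive_kappa y u x0.
  have h2 := is_CderiveD (is_Cderive_cst u x%:C)
     (is_CderiveM (is_Cderive_id u) (is_Cderive_cst u (imag y))).
  have := is_CderiveM (is_CderiveM h1 h1) h2.
  under eq_fun do rewrite -expr2.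
  move/is_Cderive_eq; apply; field.
  exact: w0.
rewrite (is_Cderive0_cst h t 0) mul0r addr0 kappa_real//.
rewrite -(rmorphXn (real_complex R)) -rmorphM /= exprVn sqr_sqrtr ?ltW//.
by rewrite mulVf ?gt_eqF.
Qed.

(** The identity [kappa w ^+ 2 * w = 1] fixes [kappa] up to sign. Since Re w > 0, it also forces |Im
    kappa| < |Re kappa| along the segment from Re w to w. So the real part never vanishes there; it
    is positive at the real end and, by the intermediate value theorem, at the other end too. *)
Lemma kappaP w : 0 < Re w -> [/\ kappa w ^+ 2 * w = 1, 0 < Re (kappa w)
  & `|Im (kappa w)| <= Re (kappa w)].
Proof.
case: w => x y /= x0.
have wE : x +i* y = x%:C + 1%:C * imag y.
  by apply: ReIm_eq; rewrite ?cReD ?cImD ?cReM ?cImM /=; ring.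
have sq t := kappa_path y t x0.
pose k t := kappa (x%:C + t%:C * imag y).
have key t : Im (k t) ^+ 2 < Re (k t) ^+ 2.
  have e1 := sq t; rewrite -/(k t) in e1.
  (* Multiplying [sq] by the conjugate of w(t) gives k^2 |w|^2 = conj w, whose real part is x >
     0. *)
  have h : k t ^+ 2 * (normc (x%:C + t%:C * imag y) ^+ 2)%:C = x%:C - t%:C * imag y.
    have -> : (normc (x%:C + t%:C * imag y) ^+ 2)%:C =
       (x%:C + t%:C * imag y) * (x%:C - t%:C * imag y).
      rewrite sqr_nc; apply: ReIm_eq;
       rewrite !(cReD, cImD, cReM, cImM, cReN, cImN) /=; ring.
    by rewrite mulrA e1 mul1r.
  move: h; move: (k t) (normc _ ^+ 2) (sqr_ge0 (normc (x%:C + t%:C * imag y))).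
  move=> K N N0 /(congr1 (@complex.Re R)).
  rewrite expr2 !(cReD, cImD, cReM, cImM, cReN, cImN) /= => h2.
  have h4 : 0 < (Re K ^+ 2 - Im K ^+ 2) * N by rewrite !expr2; lra.
  rewrite -subr_gt0 ltNge; apply/negP => h5.
  by move: h4; rewrite ltNge mulr_le0_ge0.
have kn0 t : Re (k t) != 0.
  by apply/eqP => k0; have := key t; rewrite k0 expr0n/= ltNge sqr_ge0.
have ck : continuous (fun t => Re (k t)).
  exact: (is_Cderive_continuous (fun t => is_Cderive_kappa y t x0)).1.
have k0 : 0 < Re (k 0).
  by rewrite /k mul0r addr0 kappa_real//= invr_gt0 sqrtr_gt0.
have k1 : 0 < Re (k 1).
  rewrite ltNge; apply/negP => k1.
  have [||c _ ck0] := @IVT _ (fun t => Re (k t)) 0 1 0 ler01.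
  - exact: continuous_subspaceT.
  - rewrite ge_min le_max k1 (ltW k0) orbT/=//.
  - by have := kn0 c; rewrite ck0 eqxx.
rewrite wE; split; [exact: (sq 1)|exact: k1|].
have := key 1 => /ltW; rewrite -ler_sqrt ?sqr_ge0// !sqrtr_sqr.
by rewrite (gtr0_norm k1).
Qed.

Lemma normc_kappa w : 0 < Re w -> normc (kappa w) ^+ 2 * normc w = 1.
Proof.
move=> /kappaP[h _ _]; have := congr1 (fun z => normc z) h.
by rewrite ncM expr2 ncM -expr2 -(rmorph1 (real_complex R)) ncR normr1.
Qed.

(** In place of a contour shift, b is scaled to t b: by [moment1] the integral I satisfies I' = 2 pi
    t b^2 I / w, so I exp(- pi t^2 b^2 / w) is constant, and its value at t = 0 is [kappa w]. *)
Lemma Cintegral_qexp w b : 0 < Re w ->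
  Cintegral mu (qexp w b) = kappa w * cexp (pi%:C * b ^+ 2 / w).
Proof.
move=> w0; have p0 := pi_gt0 R; have wn0 := Re_gt0_neq0 w0.
pose I t := Cintegral mu (qexp w (t%:C * b)).
pose g t := - (pi%:C * (t%:C * b) ^+ 2 / w).
have dq (u s : R) : is_Cderive u (fun u => qexp w (u%:C * b) s)
    (- (2 * pi)%:C * b * (s%:C * qexp w (u%:C * b) s)).
  have h1 := is_CderiveM (is_Cderive_id u) (is_Cderive_cst u b).
  have h2 := is_CderiveM (is_CderiveM (is_Cderive_cst u 2) h1) (is_Cderive_cst u s%:C).
  have h3 := is_CderiveM (is_Cderive_cst u (- pi%:C))
    (is_CderiveD (is_Cderive_cst u (w * s%:C ^+ 2)) h2).
  apply: (is_Cderive_eq (is_Cderive_cexp h3)).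
  rewrite /qexp rmorphM /=.
  have -> : (2 : R)%:C = (2 : R[i]) by rewrite (rmorph_nat (real_complex R)).
  by ring.
have pw : 0 < pi * Re w by rewrite mulr_gt0.
have m0 t : Cintegrable mu (fun s => s%:C * qexp w (t%:C * b) s) /\
    Cintegral mu (fun s => s%:C * qexp w (t%:C * b) s) = - (t%:C * b / w * I t).
  have [i1 e1] := moment1 (t%:C * b) w0.
  have iq := Cintegrable_qexp (t%:C * b) w0.
  have E : (fun s => w^-1 * ((w * s%:C + t%:C * b) * qexp w (t%:C * b) s) +
      (- (t%:C * b / w)) * qexp w (t%:C * b) s) =
      (fun s => s%:C * qexp w (t%:C * b) s).
    by apply/funext => s; field.
  have i2 := CintegrableZ w^-1 i1; have i3 := CintegrableZ (- (t%:C * b / w)) iq.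
  rewrite -E; split; first exact: CintegrableD.
  by rewrite CintegralD// !CintegralZ// e1 mulr0 add0r mulNr.
have dI t : is_Cderive t I ((2 * pi)%:C * b * (t%:C * b / w * I t)).
  have tt1 : t - 1 < t < t + 1 by apply/andP; split; lra.
  (* For u within distance 1 of t the linear coefficient is at most (|t| + 1) |Re b|; the final 1
     absorbs the factor |s|. *)
  pose B := 2 * pi * ((`|t| + 1) * `|Re b|) + 1.
  have Gle (u s : R) : t - 1 < u < t + 1 ->
      normc (- (2 * pi)%:C * b * (s%:C * qexp w (u%:C * b) s)) <=
      normc (- (2 * pi)%:C * b) * expR (B * `|s| - pi * Re w * s ^+ 2).
    move=> /andP[ut1 ut2]; rewrite ncM ler_wpM2l ?nc_ge0//.
    have -> : B * `|s| - pi * Re w * s ^+ 2 = `|s| +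
       (2 * pi * ((`|t| + 1) * `|Re b|) * `|s| - pi * Re w * s ^+ 2) by rewrite /B; ring.
    rewrite expRD ncM ncR ler_pM ?nc_ge0 ?ler_norm_expR//.
    apply: normc_qexp_le => //; rewrite cReM /= mul0r subr0 normrM ler_wpM2r//.
    rewrite ler_norml; have := ler_norm t; have := ler_norm (- t); rewrite normrN.
    by move=> ? ?; apply/andP; split; lra.
  have h := is_Cderive_Cintegral tt1
    (fun u _ => Cintegrable_qexp (u%:C * b) w0)
    (fun u s _ => dq u s)
    (integrable_gauss_dom B (normc (- (2 * pi)%:C * b)) pw) Gle.
  apply: (is_Cderive_eq h); have [i1 e1] := m0 t.
  by rewrite CintegralZ// e1; ring.
have h t : is_Cderive t (fun t => I t * cexp (g t)) 0.
  have h1 := is_CderiveM (is_Cderive_id t) (is_Cderive_cst t b).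
  have h2 := is_CderiveM (is_Cderive_cst t (- pi%:C / w)) (is_CderiveM h1 h1).
  have h3 := is_CderiveM (dI t) (is_Cderive_cexp h2).
  have E u : - pi%:C / w * (u%:C * b * (u%:C * b)) = g u.
    by rewrite /g; field.
  move: h3; under eq_fun do rewrite E.
  move/is_Cderive_eq; apply; rewrite E rmorphM /=.
  have -> : (2 : R)%:C = (2 : R[i]) by rewrite (rmorph_nat (real_complex R)).
  by field.
have := is_Cderive0_cst h 1 0.
have -> : I 1 = Cintegral mu (qexp w b) by rewrite /I mul1r.
have -> : I 0 = kappa w by rewrite /I mul0r.
have -> : g 0 = 0 by rewrite /g mul0r expr0n/= mulr0 mul0r oppr0.
rewrite cexp0 mulr1 => <-; rewrite -mulrA -cexpD /g mul1r addNr cexp0 mulr1//.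
Qed.

End gaussian_value.

(** * Smooth approximation of the sign function *)

Section real_facts.
Context {R : realType}.
Implicit Types (f g df dg : R -> R) (a b x s u : R).

Lemma le_derive_increment f g df dg a b : a <= b ->
  (forall x, a <= x <= b -> is_derive x 1 f (df x)) ->
  (forall x, a <= x <= b -> is_derive x 1 g (dg x)) ->
  (forall x, a < x < b -> df x <= dg x) ->
  f b - f a <= g b - g a.
Proof.
rewrite le_eqVlt => /predU1P[->|ab] hf hg hfg; first by rewrite !subrr.
pose h := g - f; pose dh x := dg x - df x.
have dhE x : a <= x <= b -> is_derive x 1 h (dh x).
  by move=> xab; have := is_deriveB (hg x xab) (hf x xab).
have sub x : x \in `]a, b[ -> a <= x <= b.
  by rewrite in_itv/= => /andP[/ltW -> /ltW ->].
have ch : {within `[a, b], continuous h}.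
  apply: derivable_within_continuous => x; rewrite in_itv/= => /dhE.
  by case.
have [c cab e] := @MVT _ h dh a b ab (fun x xab => dhE x (sub x xab)) ch.
have : 0 <= h b - h a.
  rewrite e mulr_ge0 ?subr_ge0 ?(ltW ab)//; apply: hfg.
  by move: cab; rewrite in_itv.
rewrite /h /= !fctE; lra.
Qed.

Lemma norm_sin_le x : `|sin x| <= `|x|.
Proof.
have pos (y : R) : 0 <= y -> `|sin y| <= y.
  move=> y0; have h1 := @le_derive_increment (@sin R) id (@cos R) (cst 1) 0 y y0
    (fun x _ => is_derive_sin x) (fun x _ => is_derive_id x 1) (fun x _ => cos_le1 x).
  have h2 := @le_derive_increment (fun x => - x) (@sin R) (cst (-1)) (@cos R) 0 y y0
    (fun x _ => is_deriveNid x 1) (fun x _ => is_derive_sin x) (fun x _ => cos_geN1 x).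
  move: h1 h2; rewrite sin0 /= => h1 h2.
  by rewrite ler_norml; apply/andP; split; lra.
have [x0|x0] := leP 0 x; first by rewrite (ger0_norm x0) pos.
by rewrite -(normrN x) -(normrN (sin x)) -sinN (ger0_norm (_ : 0 <= - x)) ?pos// oppr_ge0 ltW.
Qed.

(** The formula 1/y = y exp(- ln y^2) remains true at y = 0, where the inverse is 0 by
    convention. *)
Lemma measurable_inv d (T : measurableType d) (f : T -> R) :
  measurable_fun setT f -> measurable_fun setT (fun t => (f t)^-1).
Proof.
move=> mf.
have -> : (fun t => (f t)^-1) = (fun t => f t * expR (- ln (f t ^+ 2))).
  apply/funext => t; have [->|f0] := eqVneq (f t) 0; first by rewrite invr0 mul0r.
  by rewrite expRN lnK ?posrE ?exprn_even_gt0//; field.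
apply: measurable_funM => //; apply: measurableT_comp => //.
apply: measurableT_comp => //; apply: measurableT_comp; first exact: measurable_ln.
exact: measurable_funX.
Qed.

(* The kernel sin(2 pi s u) / (pi s) of the sign function, with its removable
   singularity at s = 0 filled in. *)
Definition sin_kernel s u : R :=
  if s == 0 then 2 * u else sin (2 * pi * s * u) / (pi * s).

Lemma norm_sin_kernel_le s u : `|sin_kernel s u| <= 2 * `|u|.
Proof.
have p0 := pi_gt0 R; rewrite /sin_kernel; case: eqVneq => [_|s0].
  by rewrite normrM ger0_norm.
have ps : pi * s != 0 by rewrite mulf_neq0// gt_eqF.
rewrite normrM normfV ler_pdivrMr ?normr_gt0//.
rewrite (le_trans (norm_sin_le _))// !normrM (ger0_norm (ltW p0)) ger0_norm//.
by rewrite le_eqVlt; apply/orP; left; apply/eqP; ring.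
Qed.

Lemma sin_kernelN s u : sin_kernel s (- u) = - sin_kernel s u.
Proof. by rewrite /sin_kernel; case: ifP => _; rewrite ?mulrN// sinN mulNr. Qed.

Lemma measurable_sin_kernel d (T : measurableType d) (f g : T -> R) :
  measurable_fun setT f -> measurable_fun setT g ->
  measurable_fun setT (fun t => sin_kernel (f t) (g t)).
Proof.
move=> mf mg; apply: measurable_fun_ifT.
- exact: measurable_fun_eqr.
- exact: measurable_funM.
apply: measurable_funM.
  apply: measurableT_comp; first by apply: continuous_measurable_fun; exact: continuous_sin.
  by apply: measurable_funM => //; exact: measurable_funM.
by apply: measurable_inv; exact: measurable_funM.
Qed.

Lemma is_derive_sin_kernel s u :
  is_derive u 1 (sin_kernel s) (2 * cos (2 * pi * s * u)).
Proof.
have p0 := pi_gt0 R; rewrite /sin_kernel; case: eqVneq => [->|s0].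
  rewrite mulr0 mul0r cos0 mulr1.
  have := is_deriveZ 2 (is_derive_id u (1 : R)).
  by rewrite /GRing.scale /= mulr1.
have h1 := is_deriveZ (2 * pi * s) (is_derive_id u (1 : R)).
have h2 := is_derive1_comp (is_derive_sin (2 * pi * s * u)) h1.
have h3 := is_deriveZ ((pi * s)^-1) h2.
rewrite (_ : (fun u => _) = (pi * s)^-1 \*: (sin \o (2 * pi * s) \*: id)); last first.
  by apply/funext => x /=; rewrite /GRing.scale /= mulrC.
apply: (is_derive_eq h3).
rewrite /GRing.scale /= mulr1; move: s0 p0; move: (pi) => p s0 p0.
by field; rewrite s0 gt_eqF.
Qed.

End real_facts.

Section smooth_sign.
Context {R : realType}.
Local Notation mu := (@lebesgue_measure R).
Implicit Types (K s u : R).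

Definition gaussK K s : R := expR (- pi * (K^-1 ^+ 2) * s ^+ 2).

(* A smooth approximation of a multiple of the sign function, as a
   superposition of the kernels sin_kernel. *)
Definition chi K u : R := \int[mu]_s (gaussK K s * sin_kernel s u).

Lemma gaussK_ge0 K s : 0 <= gaussK K s. Proof. exact: expR_ge0. Qed.

Lemma measurable_gaussK K : measurable_fun setT (gaussK K).
Proof.
by apply: measurableT_comp => //; apply: measurable_funM.
Qed.

Lemma integrable_gaussK K M : K != 0 ->
  mu.-integrable setT (EFin \o (fun s => M * gaussK K s)).
Proof.
move=> K0; have r0 : 0 < pi * (K^-1) ^+ 2.
  by rewrite mulr_gt0 ?pi_gt0// exprn_even_gt0//= invr_eq0.
have := integrable_gauss_dom 0 M r0.
apply: eq_integrable => // s _ /=; congr (_ * expR _)%:E; ring.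
Qed.

Lemma integrable_gaussK_sin_kernel K u : K != 0 ->
  mu.-integrable setT (fun s => (gaussK K s * sin_kernel s u)%:E).
Proof.
move=> K0; apply: le_integrable (integrable_gaussK (2 * `|u|) K0) => //.
  apply/measurable_EFinP; apply: measurable_funM; first exact: measurable_gaussK.
  exact: measurable_sin_kernel.
move=> s _ /=; rewrite lee_fin mulrC normrM [leRHS]ger0_norm; last first.
  by rewrite !mulr_ge0// gaussK_ge0.
by rewrite (ger0_norm (gaussK_ge0 _ _)) ler_wpM2r ?gaussK_ge0// norm_sin_kernel_le.
Qed.

(** Differentiation turns the kernel into 2 cos(2 pi s u), and what remains is the Fourier transform
    of a Gaussian. *)
Lemma is_derive_chi K u : 0 < K ->
  is_derive u 1 (chi K) (2 * K * expR (- pi * (K * u) ^+ 2)).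
Proof.
move=> K0; have Kn0 : K != 0 by rewrite gt_eqF.
have uu1 : u - 1 < u < u + 1 by apply/andP; split; lra.
have dF (v s : R) : is_Cderive v (fun v => (gaussK K s * sin_kernel s v)%:C)
   (gaussK K s * (2 * cos (2 * pi * s * v)))%:C.
  split; last exact: is_derive_cst.
  exact: (is_deriveZ (gaussK K s) (is_derive_sin_kernel s v)).
have Gle (v s : R) : u - 1 < v < u + 1 ->
    normc (gaussK K s * (2 * cos (2 * pi * s * v)))%:C <= 2 * gaussK K s.
  move=> _; rewrite ncR normrM mulrC (ger0_norm (gaussK_ge0 _ _)).
  rewrite ler_wpM2r ?gaussK_ge0// normrM ger0_norm//.
  by rewrite ler_piMr// cos_max.
have [h _] := is_Cderive_Cintegral uu1
  (fun v _ => CintegrableR (integrable_gaussK_sin_kernel v Kn0))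
  (fun v s _ => dF v s) (integrable_gaussK 2 Kn0) Gle.
pose w : R[i] := (K^-1 ^+ 2)%:C.
have w0 : 0 < Re w by rewrite /= exprn_even_gt0//= invr_eq0.
have wC : w = (K ^- 2)%:C by rewrite /w exprVn.
have e : Re (Cintegral mu (qexp w (0 -i* u))) = K * expR (- pi * (K * u) ^+ 2).
  rewrite Cintegral_qexp//.
  have -> : pi%:C * (0 -i* u) ^+ 2 / w = (- pi * (K * u) ^+ 2)%:C.
    rewrite wC -[((_)^-1)%R](fmorphV (real_complex R)) invrK.
    by apply: ReIm_eq; rewrite expr2 !(cReM, cImM, cReN, cImN) /=; ring.
  rewrite kappa_real// sqrtr_sqr ger0_norm ?invr_ge0 ?(ltW K0)// invrK.
  by rewrite cReM Re_cexp Im_cexp /= sin0 cos0; ring.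
move: h; under eq_fun do rewrite CintegralR.
move=> h; apply: (is_derive_eq h).
rewrite CintegralR /= -mulrA -e /=.
have [iq _] := Cintegrable_qexp (0 -i* u) w0.
rewrite -RintegralZl//; apply: eq_Rintegral => s _.
rewrite Re_cexp Re_qexp /gaussK mulrCA; congr (_ * (expR _ * cos _)).
  by rewrite /=; ring.
by rewrite expr2 !(cReM, cImM, cReN, cImN, cReD, cImD) /=; ring.
Qed.

Lemma chi0 K : chi K 0 = 0.
Proof.
rewrite /chi /Rintegral.
under eq_integral => s _.
  rewrite /sin_kernel; have -> : (if s == 0 then 2 * 0 else sin (2 * pi * s * 0) / (pi * s)) = 0 :> R.
    by case: ifP => _; rewrite mulr0// sin0 mul0r.
  rewrite mulr0; over.
by rewrite integral0.
Qed.

Lemma chiN K u : K != 0 -> chi K (- u) = - chi K u.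
Proof.
move=> K0; rewrite /chi -[RHS]mulN1r -RintegralZl//; last exact: integrable_gaussK_sin_kernel.
by apply: eq_Rintegral => s _; rewrite sin_kernelN mulN1r mulrN.
Qed.

Lemma chi_scale K u : 0 < K -> chi K u = chi 1 (K * u).
Proof.
move=> K0.
have h (v : R) : is_derive v 1 (chi K - (chi 1 \o K \*: id)) 0.
  have h1 := is_derive_chi v K0.
  have h2 := is_derive1_comp (is_derive_chi (K * v) ltr01) (is_deriveZ K (is_derive_id v (1 : R))).
  apply: (is_derive_eq (is_deriveB h1 h2)).
  by rewrite /GRing.scale /= !mulr1 mul1r; ring.
have := is_derive_0_is_cst u 0 h.
rewrite !fctE /= /GRing.scale /= mulr0 !chi0 subrr => /eqP.
by rewrite subr_eq0 => /eqP.
Qed.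

Lemma chi1_homo u v : u <= v -> chi 1 u <= chi 1 v.
Proof.
move=> uv; have := @le_derive_increment R (cst 0) (chi 1) (cst 0)
  (fun u => 2 * 1 * expR (- pi * (1 * u) ^+ 2)) u v uv
  (fun x _ => is_derive_cst _ _ _) (fun x _ => is_derive_chi x ltr01).
rewrite subrr subr_ge0; apply => x _.
by rewrite !mulr_ge0// expR_ge0.
Qed.

(** As exp(- pi x^2) <= 1 / (1 + x^2), comparing derivatives bounds [chi 1] by 2 atan on the
    positive axis. *)
Lemma chi1_le u : chi 1 u <= pi.
Proof.
have p1 : 1 <= pi :> R by rewrite (le_trans _ (pi_ge2 R))// ler1n.
have [u0|u0] := leP u 0.
  by rewrite (le_trans (chi1_homo u0))// chi0 pi_ge0.
have := @le_derive_increment R (chi 1) (2 \*: atan)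
  (fun u => 2 * 1 * expR (- pi * (1 * u) ^+ 2)) (fun x => 2 * (1 + x ^+ 2)^-1) 0 u (ltW u0)
  (fun x _ => is_derive_chi x ltr01) (fun x _ => is_deriveZ 2 (is_derive1_atan x)).
rewrite chi0 subr0 /= atan0 [_ *: 0]mulr0 subr0 => /(_ _)/le_trans -> //.
  move=> x _; rewrite mulr1 mul1r ler_pM2l// mulNr expRN lef_pV2 ?posrE ?expR_gt0//.
    rewrite (le_trans _ (expR_ge1Dx _))// lerD2l ler_peMl// sqr_ge0//.
  by rewrite ltr_pwDl// sqr_ge0.
have := atan_ltpi2 u; rewrite /GRing.scale /=; lra.
Qed.

Lemma chi1_norm_le u : `|chi 1 u| <= pi.
Proof.
rewrite ler_norml chi1_le andbT lerNl -chiN ?oner_neq0//.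
exact: chi1_le.
Qed.

Lemma chi_norm_le K u : 0 < K -> `|chi K u| <= pi.
Proof. by move=> K0; rewrite chi_scale// chi1_norm_le. Qed.

(** The value is the integral of 2 exp(- pi x^2) over the half-line, that is 1. Later constants
    divide by [chi_lim ^+ 2 + 1], which is positive whatever the value. *)
Definition chi_lim : R := sup (range (chi 1)).

Let chi_has_sup : has_sup (range (chi 1)).
Proof.
split; first by exists (chi 1 0), 0.
by exists pi => _ [u _ <-]; exact: chi1_le.
Qed.

(** By [chi_scale] these are values of the increasing function [chi 1] at (n + 1) u, which tend to
    its supremum when u > 0; oddness gives u < 0. *)
Lemma cvg_chi u : chi n.+1%:R u @[n --> \oo] --> chi_lim * Num.sg u.
Proof.
have pos (v : R) : 0 < v -> chi n.+1%:R v @[n --> \oo] --> chi_lim.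
  move=> v0; apply/cvgrPdist_le => e e0.
  have [_ [x0 _ <-] hx0] := sup_adherent e0 chi_has_sup.
  near=> n; rewrite chi_scale ?ltr0Sn//.
  have h1 : chi 1 (n.+1%:R * v) <= chi_lim.
    by apply: (sup_upper_bound chi_has_sup); exists (n.+1%:R * v).
  have h2 : chi 1 x0 <= chi 1 (n.+1%:R * v).
    apply: chi1_homo; rewrite -ler_pdivrMr//.
    rewrite (@le_trans _ _ n%:R)// ?ler_nat//; near: n; exact: nbhs_infty_ger.
  rewrite ger0_norm ?subr_ge0//.
  by move: hx0; rewrite -/chi_lim; lra.
have [u0|u0|->] := ltgtP u 0.
- rewrite ltr0_sg// mulrN1.
  have := pos (- u); rewrite oppr_gt0 => /(_ u0) /cvgN.
  rewrite (_ : (fun n : nat => chi n.+1%:R u) = - (fun n => chi n.+1%:R (- u))) //.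
  by apply/funext => n; rewrite !fctE chiN ?opprK// pnatr_eq0.
- by rewrite gtr0_sg// mulr1; exact: pos.
- by rewrite sgr0 mulr0; under eq_fun do rewrite chi0; exact: cvg_cst.
Unshelve. all: end_near. Qed.

End smooth_sign.

(* The library attaches a sigma-finite structure to products of
   subprobability measures only. *)
Section sigma_finite_product.
Context d1 d2 (T1 : measurableType d1) (T2 : measurableType d2) (R : realType).
Variables (m1 : {sigma_finite_measure set T1 -> \bar R})
  (m2 : {sigma_finite_measure set T2 -> \bar R}).

Definition sf_product : set (T1 * T2)%type -> \bar R := (m1 \x m2)%E.

HB.instance Definition _ := Measure.on sf_product.

Let sf_product_sigma_finite : sigma_finite setT sf_product.
Proof.
have /sigma_finiteP[F [TF ndF Foo]] := sigma_finiteT m1.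
have /sigma_finiteP[G [TG ndG Goo]] := sigma_finiteT m2.
exists (fun n => F n `*` G n).
  apply/seteqP; split => // -[x y] _.
  have [i _ Fi] : (\bigcup_i F i) x by rewrite -TF.
  have [j _ Gj] : (\bigcup_j G j) y by rewrite -TG.
  exists (maxn i j) => //; split.
    by move: Fi; exact/subsetPset/ndF/leq_maxl.
  by move: Gj; exact/subsetPset/ndG/leq_maxr.
move=> k; have [mF Fkoo] := Foo k; have [mG Gkoo] := Goo k.
split; first exact: measurableX.
by rewrite /sf_product product_measure1E// lte_mul_pinfty// ge0_fin_numE.
Qed.

HB.instance Definition _ := Measure_isSigmaFinite.Build _ _ _ sf_product
  sf_product_sigma_finite.

End sigma_finite_product.

(** * From mollified kernels to signs *)

Section sign_transfer.
Context {R : realType} d (X : measurableType d).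
Local Notation mu := (@lebesgue_measure R).
Local Notation mu2 := (sf_product mu mu).
Variables (m : {sigma_finite_measure set X -> \bar R}) (g : X -> R[i]).
Variables (u v W : X -> R).
Hypotheses (mg : Cmeasurable g) (mu_ : measurable_fun setT u)
  (mv : measurable_fun setT v).
Hypotheses (iW : m.-integrable setT (EFin \o W)) (gW : forall x, normc (g x) <= W x)
  (uvgW : forall x, `|u x| * `|v x| * normc (g x) <= W x).

Let W0 x : 0 <= W x. Proof. exact: le_trans (nc_ge0 _) (gW x). Qed.

Let k (K : R) (p : X * (R * R)) : R[i] :=
  (gaussK K p.2.1 * gaussK K p.2.2)%:C *
  ((sin_kernel p.2.1 (u p.1) * sin_kernel p.2.2 (v p.1))%:C * g p.1).

Let k_le K p : normc (k K p) <= W p.1 * (4 * (gaussK K p.2.1 * gaussK K p.2.2)).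
Proof.
rewrite /k !ncM !ncR (ger0_norm (mulr_ge0 (gaussK_ge0 _ _) (gaussK_ge0 _ _))).
rewrite mulrC [leRHS]mulrA ler_wpM2r ?mulr_ge0 ?gaussK_ge0// normrM.
have h1 := norm_sin_kernel_le p.2.1 (u p.1).
have h2 := norm_sin_kernel_le p.2.2 (v p.1).
apply: (@le_trans _ _ (4 * (`|u p.1| * `|v p.1| * normc (g p.1)))).
  rewrite mulrA ler_wpM2r ?nc_ge0//.
  rewrite (_ : 4 * (_ * _) = (2 * `|u p.1|) * (2 * `|v p.1|)); last by ring.
  by rewrite ler_pM.
by rewrite [leRHS]mulrC ler_wpM2l.
Qed.

Let mk K : Cmeasurable (k K : X * (measurableTypeR R * measurableTypeR R) -> R[i]).
Proof.
have m2 : measurable_fun [set: X * (measurableTypeR R * measurableTypeR R)] (fun p => p.2.1).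
  by apply: (@measurableT_comp _ _ _ _ _ _ fst) => //; exact: measurable_fst.
have m3 : measurable_fun [set: X * (measurableTypeR R * measurableTypeR R)] (fun p => p.2.2).
  by apply: (@measurableT_comp _ _ _ _ _ _ snd) => //; exact: measurable_snd.
have m1 : measurable_fun [set: X * (measurableTypeR R * measurableTypeR R)] fst.
  exact: measurable_fst.
apply: CmeasurableM.
  apply: CmeasurableR; apply: measurable_funM.
    by apply: (measurableT_comp (measurable_gaussK K) m2).
  by apply: (measurableT_comp (measurable_gaussK K) m3).
apply: CmeasurableM; last by apply: Cmeasurable_comp.
apply: CmeasurableR; apply: measurable_funM; apply: measurable_sin_kernel => //.
  by apply: (measurableT_comp mu_ m1).
by apply: (measurableT_comp mv m1).
Qed.

Let iGG (K : R) : 0 < K -> Cintegrable mu2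
  (fun z : measurableTypeR R * measurableTypeR R => (gaussK K z.1)%:C * (gaussK K z.2)%:C).
Proof.
move=> K0; have i1 : Cintegrable mu (fun s => (gaussK K s)%:C).
  apply: CintegrableR; have := integrable_gaussK 1 (lt0r_neq0 K0).
  by under eq_fun do rewrite /= mul1r.
exact: (@Cintegrable_prod2 R _ _ _ _ mu mu _ _ i1 i1).
Qed.

Let ik (K : R) : 0 < K -> Cintegrable (m \x mu2)%E (k K).
Proof.
move=> K0.
have iWC : Cintegrable m (fun x => (W x)%:C) by exact: CintegrableR.
have h := integrable_normc (Cintegrable_prod2 iWC (CintegrableZ 4 (iGG K0))).
apply: (le_Cintegrable (mk K) h) => p.
apply: (le_trans (k_le K p)).
rewrite !ncM !ncR -!(rmorph_nat (real_complex R)) ncR !ger0_norm ?gaussK_ge0//.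
Qed.

(** Fubini in (x, (s, t)): the kernels are at most 2 |u| and 2 |v|, so the bound of |u v g| by W
    gives absolute convergence in x, and the Gaussians give it in s and t. *)
Lemma Cintegral_chi_chi K : 0 < K ->
  Cmeasurable (fun z : measurableTypeR R * measurableTypeR R =>
    (gaussK K z.1 * gaussK K z.2)%:C *
    Cintegral m (fun x => (sin_kernel z.1 (u x) * sin_kernel z.2 (v x))%:C * g x)) /\
  Cintegral m (fun x => (chi K (u x) * chi K (v x))%:C * g x) =
  Cintegral mu2 (fun z => (gaussK K z.1 * gaussK K z.2)%:C *
    Cintegral m (fun x => (sin_kernel z.1 (u x) * sin_kernel z.2 (v x))%:C * g x)).
Proof.
move=> K0; have Kn0 := lt0r_neq0 K0.
have mkx x : Cmeasurable (fun z : measurableTypeR R * measurableTypeR R => k K (x, z)).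
  by split; [apply: (measurable_fun_pair2 _ (mk K).1)|apply: (measurable_fun_pair2 _ (mk K).2)].
have mkz z : Cmeasurable (fun x => k K (x, z)).
  by split; [apply: (measurable_fun_pair1 _ (mk K).1)|apply: (measurable_fun_pair1 _ (mk K).2)].
have ikx x : Cintegrable mu2 (fun z => k K (x, z)).
  have h := integrable_normc (CintegrableZ (W x * 4)%:C (iGG K0)).
  apply: (le_Cintegrable (mkx x) h) => z.
  apply: (le_trans (k_le K _)).
  by rewrite !ncM !ncR !ger0_norm ?gaussK_ge0 ?mulr_ge0// mulrA.
have ikz z : Cintegrable m (fun x => k K (x, z)).
  have := iW => /(@integrableZl _ _ _ m _ measurableT (4 * (gaussK K z.1 * gaussK K z.2))) h.
  have {}h : m.-integrable setT (EFin \o (fun x => (4 * (gaussK K z.1 * gaussK K z.2)) * W x)).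
    by move: h; under eq_fun do rewrite -EFinM.
  apply: (le_Cintegrable (mkz z) h) => x.
  by apply: (le_trans (k_le K _)); rewrite mulrC.
have [_ e1] := Cfubini12 (ik K0) ikx.
have [i2 e2] := Cfubini21 (ik K0) ikz.
have iz z : Cintegrable m (fun x =>
    (sin_kernel z.1 (u x) * sin_kernel z.2 (v x))%:C * g x).
  have := iW => /(@integrableZl _ _ _ m _ measurableT 4) h.
  have {}h : m.-integrable setT (EFin \o (fun x => 4 * W x)).
    by move: h; under eq_fun do rewrite -EFinM.
  apply: (le_Cintegrable _ h).
    apply: CmeasurableM => //; apply: CmeasurableR; apply: measurable_funM;
    exact: measurable_sin_kernel.
  move=> x; rewrite ncM ncR normrM.
  have h1 := norm_sin_kernel_le z.1 (u x).
  have h2 := norm_sin_kernel_le z.2 (v x).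
  apply: (@le_trans _ _ (4 * (`|u x| * `|v x| * normc (g x)))); last by rewrite ler_wpM2l.
  rewrite mulrA ler_wpM2r ?nc_ge0//.
  rewrite (_ : 4 * (_ * _) = (2 * `|u x|) * (2 * `|v x|)); last by ring.
  by rewrite ler_pM.
have Ez z : Cintegral m (fun x => k K (x, z)) = (gaussK K z.1 * gaussK K z.2)%:C *
    Cintegral m (fun x => (sin_kernel z.1 (u x) * sin_kernel z.2 (v x))%:C * g x).
  by rewrite -CintegralZ.
split; first by move: i2; rewrite (funext Ez).
transitivity (Cintegral m (fun x => Cintegral mu2 (fun z => k K (x, z)))).
  apply: eq_Cintegral => x.
  have E (z : (measurableTypeR R * measurableTypeR R)%type) : k K (x, z) =
      g x * ((gaussK K z.1 * sin_kernel z.1 (u x))%:C *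
      (gaussK K z.2 * sin_kernel z.2 (v x))%:C).
    by rewrite /k /= !rmorphM /=; ring.
  have iA := CintegrableR (integrable_gaussK_sin_kernel (u x) Kn0).
  have iB := CintegrableR (integrable_gaussK_sin_kernel (v x) Kn0).
  rewrite (eq_Cintegral _ E) CintegralZ; last first.
    exact: (@Cintegrable_prod2 R _ _ _ _ mu mu _ _ iA iB).
  rewrite (@Cintegral_prod2 R _ _ _ _ mu mu _ _ iA iB).
  by rewrite !CintegralR mulrC rmorphM.
by rewrite e1 -e2; apply: eq_Cintegral => z; exact: Ez.
Qed.

Lemma measurable_sg (f : X -> R) : measurable_fun setT f ->
  measurable_fun setT (fun x => Num.sg (f x)).
Proof.
move=> mf.
have -> : (fun x => Num.sg (f x)) =
    (fun x => if f x == 0 then 0 else if f x < 0 then -1 else 1).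
  by apply/funext => x; rewrite /Num.sg.
apply: measurable_fun_ifT => //; first exact: measurable_fun_eqr.
by apply: measurable_fun_ifT => //; exact: measurable_fun_ltr.
Qed.

(** The limit in K is taken on the side of x, where [chi K] converges boundedly to a multiple of the
    sign; on the side of (s, t) a bound uniform in K is enough. *)
Lemma sign_transfer (L : R) :
  (forall K, 1 <= K -> L <= normc (Cintegral mu2 (fun z =>
    (gaussK K z.1 * gaussK K z.2)%:C *
    Cintegral m (fun x => (sin_kernel z.1 (u x) * sin_kernel z.2 (v x))%:C * g x)))) ->
  L <= chi_lim ^+ 2 *
    normc (Cintegral m (fun x => (Num.sg (u x) * Num.sg (v x))%:C * g x)).
Proof.
move=> hL.
(* The constant dominates both the approximants, where |chi| <= pi, and their limit. *)
have iW2 : m.-integrable setT (EFin \o (fun x => (pi ^+ 2 + chi_lim ^+ 2) * W x)).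
  have := iW => /(@integrableZl _ _ _ m _ measurableT (pi ^+ 2 + chi_lim ^+ 2)).
  by under eq_fun do rewrite -EFinM.
have mchi K : 0 < K -> measurable_fun setT (chi K : measurableTypeR R -> R).
  move=> K0; apply: continuous_measurable_fun => x; apply: differentiable_continuous.
  by apply/derivable1_diffP; have [] := is_derive_chi x K0.
have mC n : Cmeasurable (fun x => (chi n.+1%:R (u x) * chi n.+1%:R (v x))%:C * g x).
  apply: CmeasurableM => //; apply: CmeasurableR; apply: measurable_funM.
    by apply: (measurableT_comp (mchi _ (ltr0Sn _ n)) mu_).
  by apply: (measurableT_comp (mchi _ (ltr0Sn _ n)) mv).
pose G x := ((chi_lim * Num.sg (u x)) * (chi_lim * Num.sg (v x)))%:C * g x.
have mSS : Cmeasurable (fun x => (Num.sg (u x) * Num.sg (v x))%:C * g x).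
  apply: CmeasurableM => //; apply: CmeasurableR; apply: measurable_funM;
  exact: measurable_sg.
have mG : Cmeasurable G.
  apply: CmeasurableM => //; apply: CmeasurableR.
  by apply: measurable_funM; apply: measurable_funM => //; exact: measurable_sg.
have ssg (x : R) : `|Num.sg x| <= 1 by case: sgrP => _; rewrite ?normr0 ?normrN ?normr1.
have d1 n x : normc ((chi n.+1%:R (u x) * chi n.+1%:R (v x))%:C * g x)
    <= (pi ^+ 2 + chi_lim ^+ 2) * W x.
  rewrite ncM ncR ler_pM ?nc_ge0// normrM expr2.
  rewrite (@le_trans _ _ (pi * pi))// ?lerDl ?sqr_ge0//.
  by rewrite ler_pM ?chi_norm_le// ltr0Sn.
have d2 x : normc (G x) <= (pi ^+ 2 + chi_lim ^+ 2) * W x.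
  rewrite ncM ncR ler_pM ?nc_ge0// mulrACA -expr2 normrM.
  rewrite (ger0_norm (sqr_ge0 _)) (@le_trans _ _ (chi_lim ^+ 2))// ?lerDr ?sqr_ge0//.
  by rewrite ler_piMr ?sqr_ge0// normrM mulr_ile1.
have lim0 x : normc ((chi n.+1%:R (u x) * chi n.+1%:R (v x))%:C * g x - G x)
    @[n --> \oo] --> (0 : R).
  have E n : normc ((chi n.+1%:R (u x) * chi n.+1%:R (v x))%:C * g x - G x) =
     `|chi n.+1%:R (u x) * chi n.+1%:R (v x) -
      (chi_lim * Num.sg (u x)) * (chi_lim * Num.sg (v x))| * normc (g x).
    by rewrite /G -mulrBl ncM -rmorphB ncR.
  under eq_fun do rewrite E.
  rewrite -(mul0r (normc (g x))); apply: cvgM; last exact: cvg_cst.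
  rewrite -(normr0 R); apply: cvg_norm; apply/subr_cvg0.
  by apply: cvgM; exact: cvg_chi.
have h := Cdominated_cvg mC mG iW2 d1 d2 lim0.
have iSS : Cintegrable m (fun x => (Num.sg (u x) * Num.sg (v x))%:C * g x).
  apply: (le_Cintegrable mSS iW) => x; rewrite ncM ncR normrM.
  by rewrite (le_trans _ (gW x))// ler_piMl ?nc_ge0// mulr_ile1.
have EG : Cintegral m G = (chi_lim ^+ 2)%:C *
    Cintegral m (fun x => (Num.sg (u x) * Num.sg (v x))%:C * g x).
  rewrite -CintegralZ//; apply: eq_Cintegral => x.
  by rewrite /G mulrACA -expr2 rmorphM mulrA.
have <- : normc (Cintegral m G) = chi_lim ^+ 2 *
    normc (Cintegral m (fun x => (Num.sg (u x) * Num.sg (v x))%:C * g x)).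
  by rewrite EG ncM ncR ger0_norm ?sqr_ge0.
apply/ler_addgt0Pr => e e0.
move/cvgrPdist_le : h => /(_ _ e0)[N _ /(_ N (leqnn N))].
rewrite sub0r normrN ger0_norm ?nc_ge0// => hN.
have := hL N.+1%:R; rewrite ler1n => /(_ isT); rewrite -(Cintegral_chi_chi (ltr0Sn R N)).2.
have := ncB (Cintegral m (fun x => (chi N.+1%:R (u x) * chi N.+1%:R (v x))%:C * g x)) (Cintegral m G).
lra.
Qed.

End sign_transfer.

(** * Two-dimensional Gaussians *)

Section gaussian_plane.
Context {R : realType}.
Local Notation mu := (@lebesgue_measure R).
Local Notation mu2 := (sf_product mu mu).
Local Notation RR := (measurableTypeR R * measurableTypeR R)%type.

Definition quad (a11 a12 a22 s t : R) : R :=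
  a11 * s ^+ 2 + 2 * a12 * s * t + a22 * t ^+ 2.

Definition coercive (eta a11 a12 a22 : R) :=
  0 < eta /\ forall s t, eta * (s ^+ 2 + t ^+ 2) <= quad a11 a12 a22 s t.

(** The quadratic form has complex coefficients a11 + i al and a12 + i th, but its t^2 coefficient
    is real: this reflects sum c q^2 = 0. *)
Definition gauss2 (a11 a12 a22 b1 b2 al th s t : R) : R[i] :=
  cexp ((- pi * (quad a11 a12 a22 s t + 2 * (b1 * s + b2 * t))) +i*
        (- pi * (al * s ^+ 2 + 2 * th * s * t))).

Lemma gauss2_sign (e1 e2 : bool) a11 a12 a22 b1 b2 al th s t :
  gauss2 a11 a12 a22 b1 b2 al th ((-1) ^+ e1 * s) ((-1) ^+ e2 * t) =
  gauss2 a11 ((-1) ^+ (e1 (+) e2) * a12) a22 ((-1) ^+ e1 * b1) ((-1) ^+ e2 * b2)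
    al ((-1) ^+ (e1 (+) e2) * th) s t.
Proof.
rewrite /gauss2 /quad; congr (cexp (_ +i* _)).
  by case: e1; case: e2 => /=; rewrite !(expr0, expr1); ring.
by case: e1; case: e2 => /=; rewrite !(expr0, expr1); ring.
Qed.

Lemma coercive_sign (e : bool) eta a11 a12 a22 :
  coercive eta a11 a12 a22 -> coercive eta a11 ((-1) ^+ e * a12) a22.
Proof.
move=> [eta0 h]; split => // s t; have := h ((-1) ^+ e * s) t.
by rewrite /quad; case: e; rewrite !(expr0, expr1); lra.
Qed.

Lemma coercive_gt0 eta a11 a12 a22 : coercive eta a11 a12 a22 ->
  [/\ 0 < eta, eta <= a11, eta <= a22 & eta <= a11 - a12 ^+ 2 / a22].
Proof.
move=> [eta0 h].
have h1 := h 1 0; have h2 := h 0 1; rewrite /quad !expr0n !expr1n /= in h1 h2.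
have ha22 : eta <= a22 by lra.
have a220 : a22 != 0 by rewrite gt_eqF// (lt_le_trans eta0).
split => //; first by lra.
(* The minimum of the form over t at s = 1 is the Schur complement. *)
have := h 1 (- (a12 / a22)); rewrite /quad.
have -> : a11 * 1 ^+ 2 + 2 * a12 * 1 * - (a12 / a22) + a22 * (- (a12 / a22)) ^+ 2 =
   a11 - a12 ^+ 2 / a22 by field.
apply: le_trans; rewrite ler_pMr// expr1n lerDl sqr_ge0//.
Qed.

Lemma normc_gauss2 a11 a12 a22 b1 b2 al th s t :
  normc (gauss2 a11 a12 a22 b1 b2 al th s t) =
  expR (- pi * (quad a11 a12 a22 s t + 2 * (b1 * s + b2 * t))).
Proof. by rewrite nc_cexp. Qed.

Lemma normc_gauss2_le eta rho a11 a12 a22 b1 b2 al th s t :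
  coercive eta a11 a12 a22 -> `|b1| <= rho -> `|b2| <= rho ->
  normc (gauss2 a11 a12 a22 b1 b2 al th s t) <=
  expR (2 * pi * rho * `|s| - pi * eta * s ^+ 2) *
  expR (2 * pi * rho * `|t| - pi * eta * t ^+ 2).
Proof.
move=> [_ h] hb1 hb2; rewrite normc_gauss2 -expRD ler_expR.
have -> : 2 * pi * rho * `|s| - pi * eta * s ^+ 2 +
  (2 * pi * rho * `|t| - pi * eta * t ^+ 2) =
  - pi * (eta * (s ^+ 2 + t ^+ 2) - 2 * (rho * `|s| + rho * `|t|)) by ring.
rewrite !mulNr lerN2 ler_wpM2l ?pi_ge0//.
have k (b y : R) : `|b| <= rho -> - (rho * `|y|) <= b * y.
  move=> hb; rewrite lerNl (le_trans (ler_norm _))// normrN normrM.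
  by rewrite ler_wpM2r.
have := h s t; have := k _ s hb1; have := k _ t hb2; lra.
Qed.

Let m1 : measurable_fun [set: RR] fst. Proof. exact: measurable_fst. Qed.
Let m2 : measurable_fun [set: RR] snd. Proof. exact: measurable_snd. Qed.

Lemma Cmeasurable_gauss2 a11 a12 a22 b1 b2 al th :
  Cmeasurable (fun z : RR => gauss2 a11 a12 a22 b1 b2 al th z.1 z.2).
Proof.
apply: Cmeasurable_cexp; apply: Cmeasurable_pair.
  apply: measurable_funM => //; apply: measurable_funD.
    apply: measurable_funD; last by apply: measurable_funM => //; exact: measurable_funX.
    apply: measurable_funD; first by apply: measurable_funM => //; exact: measurable_funX.
    by apply: measurable_funM => //; exact: measurable_funM.
  by apply: measurable_funM => //; apply: measurable_funD; exact: measurable_funM.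
apply: measurable_funM => //; apply: measurable_funD.
  by apply: measurable_funM => //; exact: measurable_funX.
by apply: measurable_funM => //; exact: measurable_funM.
Qed.

Lemma integrable_gauss_dom2 (r B M : R) : 0 < r ->
  mu2.-integrable setT (EFin \o (fun z : RR => M *
    (expR (B * `|z.1| - r * z.1 ^+ 2) * expR (B * `|z.2| - r * z.2 ^+ 2)))).
Proof.
move=> r0.
have i1 := CintegrableR (integrable_gauss_dom B 1 r0).
have := @CintegrableZ _ _ _ mu2 (M%:C) _ (@Cintegrable_prod2 R _ _ _ _ mu mu _ _ i1 i1).
move=> [+ _]; apply: eq_integrable => // z _.
by rewrite /comp -!rmorphM !mul1r.
Qed.

Lemma Cintegrable_gauss2 eta a11 a12 a22 b1 b2 al th : coercive eta a11 a12 a22 ->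
  Cintegrable mu2 (fun z => gauss2 a11 a12 a22 b1 b2 al th z.1 z.2).
Proof.
move=> co; have [eta0 _ _ _] := coercive_gt0 co.
have r0 : 0 < pi * eta by rewrite mulr_gt0// pi_gt0.
apply: (le_Cintegrable (Cmeasurable_gauss2 a11 a12 a22 b1 b2 al th)
  (integrable_gauss_dom2 (2 * pi * Num.max `|b1| `|b2|) 1 r0)) => z.
by rewrite mul1r; apply: normc_gauss2_le => //; rewrite le_max lexx ?orbT.
Qed.

Let complete_square (p a s c1 c2 d1 d2 : R[i]) : a != 0 ->
  - p * (d2 * s ^+ 2 + 2 * c1 * s) + p * (d1 * s + c2) ^+ 2 / a =
  p * c2 ^+ 2 / a + - p * ((d2 - d1 ^+ 2 / a) * s ^+ 2 + 2 * (c1 - c2 * d1 / a) * s).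
Proof. by move=> a0; field. Qed.

(** Integrating first in t, whose quadratic coefficient is real, leaves a Gaussian in s. Its
    parameter W is the complex Schur complement, and Re W exceeds the real Schur complement by th^2
    / a22. *)
Lemma Cintegral_gauss2 eta a11 a12 a22 b1 b2 al th : coercive eta a11 a12 a22 ->
  let W := (a11 +i* al) - (a12 +i* th) ^+ 2 / a22%:C in
  let b := b1%:C - b2%:C * (a12 +i* th) / a22%:C in
  0 < Re W /\
  Cintegral mu2 (fun z => gauss2 a11 a12 a22 b1 b2 al th z.1 z.2) =
  (Num.sqrt a22)^-1%:C * cexp (pi%:C * b2%:C ^+ 2 / a22%:C) *
  (kappa W * cexp (pi%:C * b ^+ 2 / W)).
Proof.
move=> co W b; have [eta0 ha11 ha22 hD] := coercive_gt0 co.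
have a220 : 0 < a22 by exact: lt_le_trans ha22.
have a22C : a22%:C != 0 :> R[i].
  by apply/eqP => /(congr1 (@complex.Re R)) /= /eqP; rewrite gt_eqF.
have ReW : Re W = a11 - a12 ^+ 2 / a22 + th ^+ 2 / a22.
  rewrite /W -[((_)^-1)%R](fmorphV (real_complex R)) expr2.
  by rewrite !(cReD, cReN, cReM, cImM) /=; ring.
have W0 : 0 < Re W.
  rewrite ReW ltr_wpDr ?divr_ge0 ?sqr_ge0 ?(ltW a220)//.
  exact: lt_le_trans hD.
split => //.
have E (s t : R) : gauss2 a11 a12 a22 b1 b2 al th s t =
   qexp (a11 +i* al) b1%:C s * qexp a22%:C ((a12 +i* th) * s%:C + b2%:C) t.
  rewrite /gauss2 /qexp -cexpD; generalize (pi : R) => p; congr cexp.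
  rewrite -[2]/(1 + 1) !expr2; apply: ReIm_eq; rewrite /quad /=; ring.
have ig := Cintegrable_gauss2 b1 b2 al th co.
have iq s := Cintegrable_qexp ((a12 +i* th) * s%:C + b2%:C) (a220 : 0 < Re a22%:C).
have i1 s : Cintegrable mu (fun t => gauss2 a11 a12 a22 b1 b2 al th s t).
  by under eq_fun do rewrite E; exact: CintegrableZ.
have [_ <-] := @Cfubini12 R _ _ _ _ mu mu _ ig i1.
have E2 (s : R) : Cintegral mu (fun t => gauss2 a11 a12 a22 b1 b2 al th s t) =
  ((Num.sqrt a22)^-1%:C * cexp (pi%:C * b2%:C ^+ 2 / a22%:C)) * qexp W b s.
  under eq_Cintegral do rewrite E.
  rewrite CintegralZ// Cintegral_qexp// kappa_real// /qexp mulrCA -[RHS]mulrA -!cexpD.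
  congr (_ * cexp _); rewrite /W /b.
  exact: complete_square.
transitivity (Cintegral mu (fun s => ((Num.sqrt a22)^-1%:C *
    cexp (pi%:C * b2%:C ^+ 2 / a22%:C)) * qexp W b s)).
  by congr (Cintegral mu _); apply/funext => s; exact: E2.
by rewrite CintegralZ ?Cintegral_qexp//; exact: Cintegrable_qexp.
Qed.

End gaussian_plane.

Section gaussian_plane_bounds.
Context {R : realType}.
Local Notation mu := (@lebesgue_measure R).
Local Notation mu2 := (sf_product mu mu).
Local Notation RR := (measurableTypeR R * measurableTypeR R)%type.

Lemma sqr_le_norm (x y : R) : `|x| <= y -> x ^+ 2 <= y ^+ 2.
Proof.
move=> xy; rewrite -(real_normK (num_real x)) !expr2.
by rewrite ler_pM.
Qed.

Lemma sub1_cos_le (y : R) : 1 - cos y <= `|y|.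
Proof.
have pos (x : R) : 0 <= x -> 1 - cos x <= x.
  move=> x0.
  have d1 (z : R) : is_derive z 1 (fun y => - cos y) (sin z).
    by have := is_deriveN (is_derive_cos z); rewrite opprK.
  have := @le_derive_increment R (fun y => - cos y) id (@sin R) (cst 1) 0 x x0
    (fun z _ => d1 z) (fun z _ => is_derive_id z 1) (fun z _ => sin_le1 z).
  rewrite cos0 /=; lra.
have [y0|y0] := leP 0 y; first by rewrite (ger0_norm y0) pos.
by rewrite -cosN -(normrN y) ger0_norm ?pos// oppr_ge0 ltW.
Qed.

Lemma norm_expR_sub1 (x : R) : `|expR x - 1| <= `|x| * expR `|x|.
Proof.
have pos (y : R) : 0 <= y -> expR y - 1 <= y * expR y.
  move=> y0; have := expR_ge1Dx (- y); rewrite expRN => h.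
  have e0 := expR_gt0 y.
  have : (1 - y) * expR y <= (expR y)^-1 * expR y by rewrite ler_wpM2r// ltW.
  by rewrite mulVf ?gt_eqF//; lra.
have [x0|x0] := leP 0 x.
  by rewrite (ger0_norm x0) ger0_norm ?pos// subr_ge0 -expR0 ler_expR.
rewrite (ltr0_norm x0) ler0_norm; last by rewrite subr_le0 -expR0 ler_expR ltW.
have h := expR_ge1Dx x; have h2 : 1 <= expR (- x) by rewrite -expR0 ler_expR oppr_ge0 ltW.
have : - x * 1 <= - x * expR (- x) by rewrite ler_wpM2l// oppr_ge0 ltW.
lra.
Qed.

(** [kappa W] lies in the sector |Im| <= Re, and multiplication by a number close to 1 cannot move
    it far out of the right half-plane. *)
Lemma Re_kappa_cexp (W z : R[i]) : 0 < Re W -> normc z <= 8^-1 ->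
  Re (kappa W) / 4 <= Re (kappa W * cexp z).
Proof.
move=> W0 z8; have [_ k0 kI] := kappaP W0.
have zr := le_trans (ler_Re_nc z) z8; have zi := le_trans (ler_Im_nc z) z8.
rewrite cReM Re_cexp Im_cexp.
move: k0 kI; move: (Re (kappa W)) (Im (kappa W)) => kr ki k0 kI.
have h1 := sub1_cos_le (Im z); have h2 := norm_sin_le (Im z).
have h3 := expR_ge1Dx (Re z).
have h4 : - Re z <= 8^-1 by rewrite (le_trans (ler_norm _))// normrN.
have e78 : 7 / 8 <= expR (Re z) by lra.
have h5 : ki * sin (Im z) <= kr * 8^-1.
  rewrite (le_trans (ler_norm _))// normrM ler_pM//.
  by rewrite (le_trans h2).
have h6 : kr * (7 / 8) <= kr * cos (Im z) by rewrite ler_pM2l//; lra.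
have h7 : kr * (3 / 4) <= kr * cos (Im z) - ki * sin (Im z) by lra.
have h8 : kr * (3 / 4) * (7 / 8) <= (kr * cos (Im z) - ki * sin (Im z)) * expR (Re z).
  by apply: ler_pM => //; lra.
have -> : kr * (expR (Re z) * cos (Im z)) - ki * (expR (Re z) * sin (Im z)) =
   (kr * cos (Im z) - ki * sin (Im z)) * expR (Re z) by ring.
lra.
Qed.

(** From |kappa|^2 |W| = 1 and |Im kappa| <= Re kappa one gets 1 <= 2 (Re kappa)^2 |W|. The factor 1
    + 2 D avoids the square root of 2 D. *)
Lemma Re_kappa_lower (W : R[i]) (D s : R) : 0 < Re W -> 0 < D -> 0 < s ->
  normc W <= D * s ^+ 2 -> ((1 + 2 * D) * s)^-1 <= Re (kappa W).
Proof.
move=> W0 D0 s0 hW; have [_ k0 kI] := kappaP W0.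
have := normc_kappa W0; rewrite sqr_nc.
have : Im (kappa W) ^+ 2 <= Re (kappa W) ^+ 2.
  rewrite -(real_normK (num_real (Im _))) -(real_normK (num_real (Re _))).
  by rewrite ler_pXn2r// (gtr0_norm k0).
move: k0 {kI}; move: (Re (kappa W)) (Im (kappa W)) => kr ki k0 h1 h2.
have c0 : 0 < (1 + 2 * D) * s by rewrite mulr_gt0// addr_gt0// mulr_gt0.
rewrite -[leRHS]mul1r -[X in _ <= X * _](mulVf (lt0r_neq0 c0)) -mulrA ler_peMr ?invr_ge0 ?(ltW c0)//.
suff : 1 ^+ 2 <= ((1 + 2 * D) * s * kr) ^+ 2.
  have ck : 0 <= (1 + 2 * D) * s * kr by rewrite ltW// mulr_gt0.
  by rewrite ler_pXn2r// ?nnegrE.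
rewrite expr1n -[leLHS]h2.
apply: (@le_trans _ _ (2 * kr ^+ 2 * (D * s ^+ 2))).
  rewrite ler_pM ?nc_ge0 ?addr_ge0 ?sqr_ge0//; lra.
rewrite (_ : ((1 + 2 * D) * s * kr) ^+ 2 = (1 + 2 * D) ^+ 2 * (s * kr) ^+ 2); last by ring.
rewrite (_ : 2 * kr ^+ 2 * (D * s ^+ 2) = (2 * D) * (s * kr) ^+ 2); last by ring.
rewrite ler_wpM2r ?sqr_ge0//.
have := sqr_ge0 D; lra.
Qed.

(** The size comes from |W| being at most a multiple of (sqrt la + |th|)^2. The exponential of pi
    b^2 / W is harmless uniformly in th: |b|^2 may grow like rho^2 th^2, but Re W grows like th^2 as
    well. *)
Lemma gauss2_lower (eta A : R) : 0 < eta -> 0 < A -> exists c rho : R,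
  [/\ 0 < c, 0 < rho, rho <= 1 & forall a11 a12 a22 b1 b2 al la th,
    coercive eta a11 a12 a22 -> a11 <= A -> `|a12| <= A -> a22 <= A ->
    `|b1| <= rho -> `|b2| <= rho -> 1 <= la -> `|al| <= A * la ->
    c / (Num.sqrt la + `|th|) <=
    Re (Cintegral mu2 (fun z => gauss2 a11 a12 a22 b1 b2 al th z.1 z.2))].
Proof.
move=> eta0 A0.
(* Read off from |b|^2 <= rho^2 ((1 + A / eta)^2 + th^2 / eta^2), compared with the lower bound eta
   + th^2 / A of Re W. *)
pose C := (1 + A / eta) ^+ 2 / eta + A / eta ^+ 2.
have C0 : 0 < C.
  by rewrite addr_gt0// divr_gt0// exprn_gt0// addr_gt0// divr_gt0.
(* Gives 32 rho C <= 1; with rho <= 1 and pi <= 4 the exponent pi b^2 / W has modulus at most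
   1/8. *)
pose rho := (1 + 32 * C)^-1.
have rho0 : 0 < rho by rewrite invr_gt0 addr_gt0// mulr_gt0.
have rho1 : rho <= 1 by rewrite invf_le1 ?lerDl ?mulr_ge0 ?(ltW C0)// addr_gt0// mulr_gt0.
(* For |W| <= D (sqrt la + |th|)^2: the terms A and A la give 2 A, th^2 / eta gives 1 / eta, and the
   cross term 2 A |th| / eta gives A / eta. *)
pose D := 2 * A + eta^-1 + A / eta.
have D0 : 0 < D by rewrite !addr_gt0 ?mulr_gt0 ?invr_gt0.
exists ((1 + A)^-1 * (1 + 2 * D)^-1 / 4), rho; split => //.
  by rewrite !mulr_gt0 ?invr_gt0 ?addr_gt0 ?mulr_gt0.
move=> a11 a12 a22 b1 b2 al la th co a11A a12A a22A hb1 hb2 la1 alA.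
have [] := Cintegral_gauss2 b1 b2 al th co.
set W := _ - _; set b := _ - _ => W0 ->.
have [_ ha11 ha22 hD] := coercive_gt0 co.
have a220 : 0 < a22 by exact: lt_le_trans ha22.
have ReW : Re W = a11 - a12 ^+ 2 / a22 + th ^+ 2 / a22.
  rewrite /W -[((_)^-1)%R](fmorphV (real_complex R)) expr2.
  by rewrite !(cReD, cReN, cReM, cImM) /=; ring.
have ImW : Im W = al - 2 * a12 * th / a22.
  rewrite /W -[((_)^-1)%R](fmorphV (real_complex R)) expr2.
  by rewrite !(cImD, cImN, cReM, cImM) /=; ring.
have Reb : Re b = b1 - b2 * a12 / a22.
  rewrite /b -[((_)^-1)%R](fmorphV (real_complex R)).
  by rewrite !(cReD, cReN, cReM, cImM) /=; ring.
have Imb : Im b = - (b2 * th / a22).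
  rewrite /b -[((_)^-1)%R](fmorphV (real_complex R)).
  by rewrite !(cImD, cImN, cReM, cImM) /=; ring.
have ia22 : a22^-1 <= eta^-1 by rewrite lef_pV2.
have iA : A^-1 <= a22^-1 by rewrite lef_pV2.
have ia220 : 0 < a22^-1 by rewrite invr_gt0.
have ieta0 : 0 < eta^-1 by rewrite invr_gt0.
have W1 : eta + th ^+ 2 / A <= Re W.
  by rewrite ReW lerD// ler_wpM2l// sqr_ge0.
have nb : normc b ^+ 2 <= rho ^+ 2 * C * (eta + th ^+ 2 / A).
  rewrite sqr_nc Reb Imb.
  have h1 : `|b1 - b2 * a12 / a22| <= rho * (1 + A / eta).
    rewrite (le_trans (ler_normB _ _))// mulrDr mulr1 lerD//.
    rewrite normrM normrM (ger0_norm (ltW ia220)) -mulrA.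
    by rewrite ler_pM ?mulr_ge0 ?(ltW ia220)// ler_pM ?(ltW ia220).
  have h2 : `|- (b2 * th / a22)| <= rho * (`|th| / eta).
    rewrite normrN normrM normrM (ger0_norm (ltW ia220)) -mulrA.
    by rewrite ler_pM ?mulr_ge0 ?(ltW ia220)// ler_pM ?(ltW ia220).
  have s1 : (b1 - b2 * a12 / a22) ^+ 2 <= (rho * (1 + A / eta)) ^+ 2.
    exact: sqr_le_norm.
  have s2 : (- (b2 * th / a22)) ^+ 2 <= (rho * (`|th| / eta)) ^+ 2.
    exact: sqr_le_norm.
  apply: (le_trans (lerD s1 s2)).
  rewrite !exprMn real_normK ?num_real// -mulrDr -mulrA ler_wpM2l ?sqr_ge0//.
  have -> : C * (eta + th ^+ 2 / A) = (1 + A / eta) ^+ 2 + th ^+ 2 * eta^-1 ^+ 2 +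
     ((1 + A / eta) ^+ 2 / eta * (th ^+ 2 / A) + A / eta).
    by rewrite /C; field; lra.
  rewrite lerDl addr_ge0 ?divr_ge0 ?(ltW A0) ?(ltW eta0)//.
  by rewrite mulr_ge0// divr_ge0 ?sqr_ge0 ?(ltW A0) ?(ltW eta0).
have WnR : Re W <= normc W by rewrite (le_trans (ler_norm _))// ler_Re_nc.
have nW0 : 0 < normc W by exact: lt_le_trans WnR.
have nz : normc (pi%:C * b ^+ 2 / W) <= 8^-1.
  rewrite ncM ncM expr2 ncM -expr2 ncR (ger0_norm (pi_ge0 R)).
  rewrite ComplexField.Normc.normcV ler_pdivrMr//.
  have p4 : pi * (rho ^+ 2 * C) <= 8^-1.
    have pi4 : pi <= 4 :> R by have := @pihalf_lt2 R; lra.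
    have rC : rho ^+ 2 * C <= 32^-1.
      have rc : 32 * (rho * C) <= 1.
        rewrite /rho mulrCA -ler_pdivlMl ?invr_gt0 ?addr_gt0 ?mulr_gt0// invrK; lra.
      have : rho * (rho * C) <= 1 * (rho * C) by rewrite ler_wpM2r// mulr_ge0 ?(ltW C0) ?(ltW rho0).
      by rewrite expr2; lra.
    apply: (@le_trans _ _ (4 * 32^-1)); last by lra.
    by rewrite ler_pM ?pi_ge0// mulr_ge0 ?sqr_ge0 ?(ltW C0).
  have h1 : pi * normc b ^+ 2 <= pi * (rho ^+ 2 * C * (eta + th ^+ 2 / A)).
    by rewrite ler_wpM2l// pi_ge0.
  apply: (le_trans h1); rewrite mulrA ler_pM//.
    by rewrite mulr_ge0 ?pi_ge0// mulr_ge0 ?sqr_ge0 ?(ltW C0).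
  - by rewrite addr_ge0 ?(ltW eta0)// divr_ge0 ?sqr_ge0 ?(ltW A0).
  - exact: le_trans W1 WnR.
have sla1 : 1 <= Num.sqrt la by rewrite -sqrtr1 ler_wsqrtr.
have lasq : la = Num.sqrt la ^+ 2 by rewrite sqr_sqrtr// (le_trans ler01).
have nW : normc W <= D * (Num.sqrt la + `|th|) ^+ 2.
  rewrite (le_trans (nc_le_ReIm W))// (gtr0_norm W0).
  have h1 : Re W <= A + th ^+ 2 / eta.
    rewrite ReW lerD// ?ler_wpM2l ?sqr_ge0//.
    by rewrite (le_trans _ a11A)// gerBl mulr_ge0 ?sqr_ge0 ?(ltW ia220).
  have h2 : `|Im W| <= A * la + 2 * A * `|th| / eta.
    rewrite ImW (le_trans (ler_normB _ _))// lerD// !normrM (ger0_norm (ltW ia220)).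
    rewrite ger0_norm// ler_pM ?mulr_ge0 ?(ltW ia220)//.
    by rewrite ler_wpM2r// ler_wpM2l.
  apply: (le_trans (lerD h1 h2)).
  set y := `|th|; have y0 : 0 <= y by exact: normr_ge0.
  rewrite -(real_normK (num_real th)) -/y.
  move: (Num.sqrt la) sla1 lasq => q q1 ->.
  have q1' : 1 <= q ^+ 2 by rewrite expr2 mulr_ege1.
  have g1 : A <= A * q ^+ 2 by rewrite ler_peMr// ltW.
  have g2 : A / eta * y <= A / eta * (q * y).
    by rewrite ler_wpM2l ?divr_ge0 ?(ltW A0) ?(ltW eta0)// ler_peMl.
  have g3 : 0 <= eta^-1 * q ^+ 2 by rewrite mulr_ge0 ?sqr_ge0 ?(ltW ieta0).
  have g4 : 0 <= eta^-1 * (q * y) by rewrite mulr_ge0 ?(ltW ieta0)// mulr_ge0// (le_trans ler01).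
  have Ae : 0 <= A / eta by rewrite divr_ge0 ?(ltW A0) ?(ltW eta0).
  have g5 : 0 <= A / eta * q ^+ 2 by rewrite mulr_ge0 ?sqr_ge0.
  have g6 : 0 <= A / eta * y ^+ 2 by rewrite mulr_ge0 ?sqr_ge0.
  have g7 : 0 <= A * y ^+ 2 by rewrite mulr_ge0 ?sqr_ge0 ?(ltW A0).
  have g8 : 0 <= A * (q * y) by rewrite mulr_ge0 ?(ltW A0)// mulr_ge0// (le_trans ler01).
  rewrite /D; clear -g1 g2 g3 g4 g5 g6 g7 g8; clearbody y.
  move: (eta^-1) g2 g3 g4 g5 g6 => e *; lra.
have st0 : 0 < Num.sqrt la + `|th| by rewrite ltr_pwDl// (lt_le_trans ltr01).
have k1 := Re_kappa_lower W0 D0 st0 nW.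
have k2 := Re_kappa_cexp W0 nz.
have pre : (Num.sqrt a22)^-1%:C * cexp (pi%:C * b2%:C ^+ 2 / a22%:C) =
    ((Num.sqrt a22)^-1 * expR (pi * b2 ^+ 2 / a22))%:C.
  have -> : pi%:C * b2%:C ^+ 2 / a22%:C = (pi * b2 ^+ 2 / a22)%:C.
    by rewrite !rmorphM fmorphV /= expr2.
  by apply: ReIm_eq; rewrite ?(cReM, cImM) Re_cexp Im_cexp /= cos0 sin0; ring.
rewrite pre cReM [Im _%:C]/= mul0r subr0 [Re _%:C]/=.
have p1 : (1 + A)^-1 <= (Num.sqrt a22)^-1 * expR (pi * b2 ^+ 2 / a22).
  rewrite -[leLHS]mulr1 ler_pM ?invr_ge0 ?addr_ge0 ?(ltW A0)//.
    rewrite lef_pV2 ?posrE ?sqrtr_gt0 ?addr_gt0//.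
    rewrite -[leRHS]ger0_norm ?addr_ge0 ?(ltW A0)// -sqrtr_sqr ler_wsqrtr//.
    have := sqr_ge0 A; lra.
  rewrite -expR0 ler_expR mulr_ge0 ?(ltW ia220)//.
  by rewrite mulr_ge0 ?sqr_ge0 ?pi_ge0.
have k3 : ((1 + 2 * D) * (Num.sqrt la + `|th|))^-1 / 4 <=
     Re (kappa W * cexp (pi%:C * b ^+ 2 / W)).
  by apply: le_trans k2; rewrite ler_pM2r ?invr_gt0.
have -> : (1 + A)^-1 * (1 + 2 * D)^-1 / 4 / (Num.sqrt la + `|th|) =
  (1 + A)^-1 * (((1 + 2 * D) * (Num.sqrt la + `|th|))^-1 / 4).
  by rewrite invfM; ring.
rewrite ler_pM// ?invr_ge0 ?addr_ge0 ?(ltW A0)//.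
by rewrite mulr_ge0// invr_ge0 mulr_ge0 ?(ltW st0)// addr_ge0// mulr_ge0 ?(ltW D0).
Qed.

End gaussian_plane_bounds.

(** * Alternating sums over the signs of s and t *)

Section alternating_sum.
Context {R : realType}.
Local Notation mu := (@lebesgue_measure R).
Local Notation mu2 := (sf_product mu mu).
Local Notation RR := (measurableTypeR R * measurableTypeR R)%type.

Definition altsum (V : zmodType) (F : R -> R -> V) s t : V :=
  F s t - F (- s) t - F s (- t) + F (- s) (- t).

(** Replaces [altsum] after differentiation in th, which brings down a factor s t that is odd in
    each variable. *)
Definition evensum (V : zmodType) (F : R -> R -> V) s t : V :=
  F s t + F (- s) t + F s (- t) + F (- s) (- t).

Let exp_quad (a11 a12 a22 b1 b2 s t : R) : R :=
  expR (- pi * (quad a11 a12 a22 s t + 2 * (b1 * s + b2 * t))).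

(** In the application X is a multiple of s t, B1 of s and B2 of t, so the bound is of order |s t|:
    constants and terms in one variable cancel in the alternating sum. *)
Lemma norm_altsum_exp_le (X B1 B2 : R) :
  `|expR (- X - B1 - B2) - expR (X + B1 - B2) - expR (X - B1 + B2)
    + expR (- X + B1 + B2)| <=
  4 * (`|X| + `|B1| * `|B2|) * expR (`|X| + `|B1| + `|B2|).
Proof.
have e (y z : R) : `|y| = `|z| -> `|expR y| <= expR `|z|.
  by move=> yz; rewrite ger0_norm ?expR_ge0// ler_expR -yz ler_norm.
have d (y z : R) : `|y| = `|z| -> `|expR y - 1| <= `|z| * expR `|z|.
  by move=> <-; exact: norm_expR_sub1.
set E := expR (`|X| + `|B1| + `|B2|); rewrite !expRD.
set x := expR (- X); set x' := expR X; set p := expR (- B1); set p' := expR B1.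
set q := expR (- B2); set q' := expR B2.
have -> : x * p * q - x' * p' * q - x' * p * q' + x * p' * q' =
  ((x - 1) * (p * q) - (x' - 1) * (p' * q) - (x' - 1) * (p * q') + (x - 1) * (p' * q'))
  + ((p - 1) * (q - 1) - (p' - 1) * (q - 1) - (p - 1) * (q' - 1) + (p' - 1) * (q' - 1)).
  by ring.
have ex := e _ X (normrN X); have ex' := e X X erefl.
have ep := e _ B1 (normrN B1); have ep' := e B1 B1 erefl.
have eq := e _ B2 (normrN B2); have eq' := e B2 B2 erefl.
have dx := d _ X (normrN X); have dx' := d X X erefl.
have dp := d _ B1 (normrN B1); have dp' := d B1 B1 erefl.
have dq := d _ B2 (normrN B2); have dq' := d B2 B2 erefl.
have t1 y z w : `|y| <= `|X| * expR `|X| -> `|z| <= expR `|B1| -> `|w| <= expR `|B2| ->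
    `|y * (z * w)| <= `|X| * E.
  by move=> *; rewrite /E !normrM !expRD -!mulrA [leRHS]mulrA ler_pM// ?mulr_ge0// ler_pM.
have t2 z w : `|z| <= `|B1| * expR `|B1| -> `|w| <= `|B2| * expR `|B2| ->
    `|z * w| <= `|B1| * `|B2| * E.
  move=> hz hw; rewrite normrM (le_trans (ler_pM _ _ hz hw))//.
  rewrite mulrACA ler_wpM2l ?mulr_ge0// -expRD /E ler_expR -addrA lerDr//.
have tri (y1 y2 y3 y4 : R) (M : R) : `|y1| <= M -> `|y2| <= M -> `|y3| <= M -> `|y4| <= M ->
    `|y1 - y2 - y3 + y4| <= 4 * M.
  rewrite !ler_norml => /andP[? ?] /andP[? ?] /andP[? ?] /andP[? ?].
  by apply/andP; split; lra.
rewrite (le_trans (ler_normD _ _))// [4 * _]mulrDr [leRHS]mulrDl lerD//.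
  by rewrite -mulrA; apply: tri; apply: t1.
by rewrite -!mulrA [`|B1| * _]mulrA; apply: tri; apply: t2.
Qed.

Lemma norm_altsum_exp_quad (eta A a11 a12 a22 b1 b2 s t : R) :
  coercive eta a11 a12 a22 -> `|a12| <= A -> `|b1| <= 1 -> `|b2| <= 1 ->
  `|altsum (exp_quad a11 a12 a22 b1 b2) s t| <=
  `|s * t| * (4 * (2 * pi * A + 4 * pi ^+ 2) *
    (expR (2 * pi * `|s| - pi * eta * s ^+ 2) *
     expR (2 * pi * `|t| - pi * eta * t ^+ 2))).
Proof.
move=> [eta0 co] a12A b11 b21.
have p0 := pi_ge0 R.
have -> : altsum (exp_quad a11 a12 a22 b1 b2) s t =
  expR (- pi * (a11 * s ^+ 2 + a22 * t ^+ 2)) *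
  (expR (- (2 * pi * a12 * s * t) - 2 * pi * b1 * s - 2 * pi * b2 * t) -
   expR (2 * pi * a12 * s * t + 2 * pi * b1 * s - 2 * pi * b2 * t) -
   expR (2 * pi * a12 * s * t - 2 * pi * b1 * s + 2 * pi * b2 * t) +
   expR (- (2 * pi * a12 * s * t) + 2 * pi * b1 * s + 2 * pi * b2 * t)).
  rewrite mulrDr !mulrBr -!expRD /altsum /exp_quad /quad.
  by congr (expR _ - expR _ - expR _ + expR _); ring.
rewrite normrM (ger0_norm (expR_ge0 _)).
have := norm_altsum_exp_le (2 * pi * a12 * s * t) (2 * pi * b1 * s) (2 * pi * b2 * t).
move=> /(ler_wpM2l (expR_ge0 (- pi * (a11 * s ^+ 2 + a22 * t ^+ 2)))) /le_trans; apply.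
have nX : `|2 * pi * a12 * s * t| = 2 * pi * `|a12| * (`|s| * `|t|).
  by rewrite !normrM (ger0_norm p0) ger0_norm// !mulrA.
have nB (b y : R) : `|2 * pi * b * y| = 2 * pi * `|b| * `|y|.
  by rewrite !normrM (ger0_norm p0) ger0_norm.
rewrite nX !nB mulrCA.
rewrite [leRHS]mulrA; apply: ler_pM.
- by rewrite !mulr_ge0// addr_ge0// !mulr_ge0.
- by rewrite mulr_ge0// expR_ge0.
- rewrite normrM.
  have -> : 4 * (2 * pi * `|a12| * (`|s| * `|t|) + 2 * pi * `|b1| * `|s| * (2 * pi * `|b2| * `|t|))
    = `|s| * `|t| * (4 * (2 * pi * `|a12| + 4 * pi ^+ 2 * (`|b1| * `|b2|))) by ring.
  rewrite ler_wpM2l ?mulr_ge0// ler_pM2l// lerD//.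
    by rewrite ler_wpM2l ?mulr_ge0.
  rewrite ler_piMr ?mulr_ge0 ?sqr_ge0//.
  by rewrite mulr_ile1.
- rewrite -!expRD ler_expR.
  (* Coercivity at (|s|, |t|) or (|s|, - |t|), whichever makes the cross term nonpositive. *)
  have k : eta * (s ^+ 2 + t ^+ 2) <= a11 * s ^+ 2 - 2 * `|a12| * (`|s| * `|t|) + a22 * t ^+ 2.
    rewrite -[s ^+ 2](real_normK (num_real s)) -[t ^+ 2](real_normK (num_real t)).
    have [a0|a0] := leP 0 a12.
      have := co `|s| (- `|t|); rewrite /quad sqrrN (ger0_norm a0); lra.
    have := co `|s| `|t|; rewrite /quad (ltr0_norm a0); lra.
  have h1 : pi * (`|b1| * `|s|) <= pi * `|s| by rewrite ler_wpM2l// ler_piMl.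
  have h2 : pi * (`|b2| * `|t|) <= pi * `|t| by rewrite ler_wpM2l// ler_piMl.
  have := ler_wpM2l p0 k; lra.
Qed.

End alternating_sum.

(** * The singular integral and its derivative in th *)

Section logarithmic_growth.
Context {R : realType}.
Local Notation mu := (@lebesgue_measure R).
Local Notation mu2 := (sf_product mu mu).
Local Notation RR := (measurableTypeR R * measurableTypeR R)%type.

Lemma sf_product_axes : mu2 [set z : RR | z.1 = 0 \/ z.2 = 0] = 0%E.
Proof.
have -> : [set z : RR | z.1 = 0 \/ z.2 = 0] =
    ([set 0 : measurableTypeR R] `*` setT) `|` (setT `*` [set 0 : measurableTypeR R]).
  by apply/seteqP; split => -[x y] /=; tauto.
have m1 : measurable ([set 0 : measurableTypeR R] `*` [set: measurableTypeR R]).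
  by apply: measurableX => //; exact: measurable_set1.
have m2 : measurable ([set: measurableTypeR R] `*` [set 0 : measurableTypeR R]).
  by apply: measurableX => //; exact: measurable_set1.
have s0 : mu [set (0 : R)] = 0%E by exact: lebesgue_measure_set1.
rewrite measureU0//; first by
  rewrite [LHS](@product_measure1E _ _ _ _ _ mu mu)//= s0 mul0e.
by rewrite [LHS](@product_measure1E _ _ _ _ _ mu mu)//= s0 mule0.
Qed.

(** Identities with a factor 1 / (s t) fail on the axes, where the inverse is 0 and [sin_kernel] has
    a filled-in value. *)
Lemma eq_Cintegral_off_axes (F G : RR -> R[i]) :
  Cmeasurable F -> Cmeasurable G ->
  (forall z, z.1 != 0 -> z.2 != 0 -> F z = G z) ->
  Cintegral mu2 F = Cintegral mu2 G.
Proof.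
move=> [F1 F2] [G1 G2] FG.
have neg : mu2.-negligible [set z : RR | z.1 = 0 \/ z.2 = 0].
  apply/negligibleP; last exact: sf_product_axes.
  have -> : [set z : RR | z.1 = 0 \/ z.2 = 0] =
    ([set 0 : measurableTypeR R] `*` setT) `|` (setT `*` [set 0 : measurableTypeR R]).
    by apply/seteqP; split => -[x y] /=; tauto.
  by apply: measurableU; apply: measurableX => //; exact: measurable_set1.
have ae (f g : RR -> R) : (forall z, z.1 != 0 -> z.2 != 0 -> f z = g z) ->
    ae_eq mu2 setT (EFin \o f) (EFin \o g).
  move=> fg; apply: negligibleS neg => z /= h.
  apply: contrapT => /not_orP[/eqP z1 /eqP z2]; apply: h => _.
  by rewrite fg.
apply: ReIm_eq; congr fine; apply: ae_eq_integral => //.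
- exact/measurable_EFinP.
- exact/measurable_EFinP.
- by apply: (ae (fun z => Re (F z)) (fun z => Re (G z))) => z z1 z2; rewrite FG.
- exact/measurable_EFinP.
- exact/measurable_EFinP.
- by apply: (ae (fun z => Im (F z)) (fun z => Im (G z))) => z z1 z2; rewrite FG.
Qed.

Variables (eta A a11 a12 a22 b1 b2 al : R).
Hypotheses (co : coercive eta a11 a12 a22) (a12A : `|a12| <= A)
  (b11 : `|b1| <= 1) (b21 : `|b2| <= 1).

Let g (th s t : R) : R[i] := gauss2 a11 a12 a22 b1 b2 al th s t.

(** The singular integrand G(s, t) / (s t), symmetrised over the signs of s and t; the cancellation
    in [altsum] makes it absolutely integrable. *)
Definition alt_kernel (th : R) (z : R * R) : R[i] :=
  ((z.1 * z.2)^-1)%:C * altsum (gauss2 a11 a12 a22 b1 b2 al th) z.1 z.2.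

Let dom (z : R * R) : R := expR (2 * pi * `|z.1| - pi * eta * z.1 ^+ 2) *
  expR (2 * pi * `|z.2| - pi * eta * z.2 ^+ 2).

Let dom_ge0 z : 0 <= dom z. Proof. by rewrite mulr_ge0// expR_ge0. Qed.

Let g_le th s t : normc (g th s t) <= dom (s, t).
Proof. by have := normc_gauss2_le al th s t co b11 b21; rewrite mulr1. Qed.

Let g_le_sign th s t : [/\ normc (g th s t) <= dom (s, t),
  normc (g th (- s) t) <= dom (s, t), normc (g th s (- t)) <= dom (s, t) &
  normc (g th (- s) (- t)) <= dom (s, t)].
Proof.
have E s' t' : `|s'| = `|s| -> `|t'| = `|t| -> dom (s', t') = dom (s, t).
  move=> hs ht; rewrite /dom /= hs ht.
  by rewrite -(real_normK (num_real s')) -(real_normK (num_real t')) hs ht !real_normK ?num_real.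
split; rewrite -?(E s t)//.
- by rewrite -(E (- s) t) ?normrN//; exact: g_le.
- by rewrite -(E s (- t)) ?normrN//; exact: g_le.
- by rewrite -(E (- s) (- t)) ?normrN//; exact: g_le.
Qed.

Let g_split th s t : g th s t = g 0 s t * cexp (0 +i* (- (2 * pi * th * s * t))).
Proof.
rewrite /g /gauss2 -cexpD; congr cexp; apply: ReIm_eq; rewrite ?(cReD, cImD) /=; ring.
Qed.

(** At th = 0 the remaining phase exp(- pi i al s^2) is even in s and of modulus 1, so it factors
    out of the alternating sum and al disappears from the bound. *)
Let altsum0_le s t : normc (altsum (g 0) s t) <=
  `|s * t| * (4 * (2 * pi * A + 4 * pi ^+ 2) * dom (s, t)).
Proof.
have E s' t' : s' ^+ 2 = s ^+ 2 -> g 0 s' t' = cexp (0 +i* (- pi * (al * s ^+ 2))) *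
    (expR (- pi * (quad a11 a12 a22 s' t' + 2 * (b1 * s' + b2 * t'))))%:C.
  move=> hs; rewrite /g /gauss2.
  have -> (x : R) : (expR x)%:C = cexp (x +i* 0).
    by apply: ReIm_eq; rewrite ?Re_cexp ?Im_cexp /= ?cos0 ?sin0 ?mulr1 ?mulr0.
  rewrite -cexpD; congr cexp; apply: ReIm_eq; rewrite ?(cReD, cImD) /= ?hs; ring.
rewrite /altsum !E ?sqrrN// -!mulrBr -mulrDr ncM nc_cexp expR0 mul1r.
rewrite -!rmorphB -rmorphD ncR.
exact: norm_altsum_exp_quad co a12A b11 b21.
Qed.

Let cexp_imag_sub1 (y : R) : normc (cexp (0 +i* y) - 1) <= 2 * `|y|.
Proof.
rewrite (le_trans (nc_le_ReIm _))// cReD cImD Re_cexp Im_cexp cReN cImN /= expR0 !mul1r.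
rewrite oppr0 addr0 -[leLHS]/(`|cos y - 1| + `|sin y|) mulr2n mulrDl mul1r lerD//.
  by rewrite distrC ger0_norm ?sub1_cos_le// subr_ge0 cos_le1.
exact: norm_sin_le.
Qed.

(** The first summand is the bound at th = 0; the second collects four differences between th and 0,
    each at most 4 pi |th s t| times [dom]. *)
Let M (th : R) : R := 4 * (2 * pi * A + 4 * pi ^+ 2) + 16 * pi * `|th|.

Let alt_kernel_le th z : normc (alt_kernel th z) <= M th * dom z.
Proof.
have A0 : 0 <= A by exact: le_trans a12A.
have p0 := pi_ge0 R.
case: z => s t; rewrite /alt_kernel /= ncM ncR.
have h : normc (altsum (g th) s t) <= `|s * t| * (M th * dom (s, t)).
  have d s' t' : `|s'| = `|s| -> `|t'| = `|t| -> normc (g 0 s' t') <= dom (s, t) ->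
     normc (g th s' t' - g 0 s' t') <= `|s * t| * (4 * pi * `|th| * dom (s, t)).
    move=> hs ht hd; rewrite g_split -[X in _ - X]mulr1 -mulrBr ncM.
    apply: (le_trans (ler_pM (nc_ge0 _) (nc_ge0 _) hd (cexp_imag_sub1 _))).
    rewrite normrN !normrM hs ht (ger0_norm p0) ger0_norm//.
    by rewrite le_eqVlt; apply/orP; left; apply/eqP; ring.
  have [g1 g2 g3 g4] := g_le_sign 0 s t.
  have d1 := d _ _ erefl erefl g1; have d2 := d _ _ (normrN s) erefl g2.
  have d3 := d _ _ erefl (normrN t) g3; have d4 := d _ _ (normrN s) (normrN t) g4.
  have -> : altsum (g th) s t = altsum (g 0) s t + ((g th s t - g 0 s t) -
     (g th (- s) t - g 0 (- s) t) - (g th s (- t) - g 0 s (- t)) +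
     (g th (- s) (- t) - g 0 (- s) (- t))) by rewrite /altsum; ring.
  rewrite (le_trans (ncD _ _))// /M mulrDl mulrDr lerD ?altsum0_le//.
  rewrite (_ : `|s * t| * (16 * pi * `|th| * dom (s, t)) =
    `|s * t| * (4 * pi * `|th| * dom (s, t)) + `|s * t| * (4 * pi * `|th| * dom (s, t)) +
    `|s * t| * (4 * pi * `|th| * dom (s, t)) + `|s * t| * (4 * pi * `|th| * dom (s, t))); last by ring.
  rewrite (le_trans (ncD _ _))// lerD// (le_trans (ncD _ _))// lerD ?ncN//.
  by rewrite (le_trans (ncD _ _))// lerD// ncN.
have M0 : 0 <= M th.
  rewrite addr_ge0// mulr_ge0//; first by rewrite addr_ge0// mulr_ge0// ?sqr_ge0// mulr_ge0.
  by rewrite mulr_ge0.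
apply: (le_trans (ler_wpM2l (normr_ge0 _) h)).
rewrite mulrA -normrM; have [st0|st0] := eqVneq (s * t) 0.
  by rewrite st0 mulr0 normr0 mul0r mulr_ge0.
by rewrite mulVf// normr1 mul1r.
Qed.

Let r0 : 0 < pi * eta. Proof. by case: co => eta0 _; rewrite mulr_gt0// pi_gt0. Qed.

Let idom (c : R) : mu2.-integrable setT (EFin \o (fun z : RR => c * dom z)).
Proof. exact: integrable_gauss_dom2. Qed.

Let mgs (e1 e2 : bool) th :
  Cmeasurable (fun z : RR => g th ((-1) ^+ e1 * z.1) ((-1) ^+ e2 * z.2)).
Proof.
rewrite /g; under eq_fun do rewrite gauss2_sign.
exact: Cmeasurable_gauss2.
Qed.

Let evenE th (z : RR) : evensum (g th) z.1 z.2 =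
  g th ((-1) ^+ false * z.1) ((-1) ^+ false * z.2) +
  g th ((-1) ^+ true * z.1) ((-1) ^+ false * z.2) +
  g th ((-1) ^+ false * z.1) ((-1) ^+ true * z.2) +
  g th ((-1) ^+ true * z.1) ((-1) ^+ true * z.2).
Proof. by rewrite !expr0 !expr1 !mul1r !mulN1r. Qed.

Let altE th (z : RR) : altsum (g th) z.1 z.2 =
  g th ((-1) ^+ false * z.1) ((-1) ^+ false * z.2) +
  - g th ((-1) ^+ true * z.1) ((-1) ^+ false * z.2) +
  - g th ((-1) ^+ false * z.1) ((-1) ^+ true * z.2) +
  g th ((-1) ^+ true * z.1) ((-1) ^+ true * z.2).
Proof. by rewrite !expr0 !expr1 !mul1r !mulN1r. Qed.

Let meven th : Cmeasurable (fun z : RR => evensum (g th) z.1 z.2).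
Proof.
under eq_fun do rewrite evenE.
by apply: CmeasurableD; [apply: CmeasurableD; [apply: CmeasurableD|]|]; exact: mgs.
Qed.

Lemma Cmeasurable_alt_kernel th : Cmeasurable (alt_kernel th : RR -> R[i]).
Proof.
apply: CmeasurableM.
  apply: CmeasurableR; apply: measurable_inv; apply: measurable_funM.
    exact: measurable_fst.
  exact: measurable_snd.
under eq_fun do rewrite altE.
apply: CmeasurableD; [apply: CmeasurableD; [apply: CmeasurableD|]|];
  try apply: CmeasurableN; exact: mgs.
Qed.

Lemma Cintegrable_alt_kernel th : Cintegrable mu2 (alt_kernel th).
Proof.
exact: (le_Cintegrable (Cmeasurable_alt_kernel th) (idom (M th)) (alt_kernel_le th)).
Qed.

Lemma is_Cderive_alt_kernel th :
  is_Cderive th (fun th => Cintegral mu2 (alt_kernel th))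
    ((0 -i* (2 * pi)) * Cintegral mu2 (fun z => evensum (g th) z.1 z.2)).
Proof.
have tt1 : th - 1 < th < th + 1 by apply/andP; split; lra.
(* The factor (s t)^-1 (s t) is 1 off the axes but 0 on them; it is kept so that the pointwise
   derivative is right everywhere, and removed under the integral. *)
pose D (u : R) (z : R * R) : R[i] := ((z.1 * z.2)^-1 * (z.1 * z.2))%:C *
  ((0 -i* (2 * pi)) * evensum (g u) z.1 z.2).
have dg (u s t : R) : is_Cderive u (fun u => g u s t) ((0 -i* (2 * pi)) * (s * t)%:C * g u s t).
  have E v : g v s t = cexp ((- pi * (quad a11 a12 a22 s t + 2 * (b1 * s + b2 * t))) +i*
     (- pi * (al * s ^+ 2)) + v%:C * ((0 -i* (2 * pi)) * (s * t)%:C)).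
    rewrite /g /gauss2; congr cexp; apply: ReIm_eq;
    rewrite !(cReD, cImD, cReM, cImM) /=; ring.
  under eq_fun do rewrite E.
  apply: (is_Cderive_eq (is_Cderive_cexp (is_CderiveD (is_Cderive_cst u _)
    (is_CderiveM (is_Cderive_id u) (is_Cderive_cst u _))))).
  by rewrite -E mulr0 addr0 add0r mul1r.
have dD u z : is_Cderive u (alt_kernel ^~ z) (D u z).
  case: z => s t; rewrite /alt_kernel /altsum /=.
  have h := is_CderiveD (is_CderiveD (is_CderiveD (dg u s t)
    (is_CderiveM (is_Cderive_cst u (-1)) (dg u (- s) t)))
    (is_CderiveM (is_Cderive_cst u (-1)) (dg u s (- t)))) (dg u (- s) (- t)).
  have {}h := is_CderiveM (is_Cderive_cst u ((s * t)^-1)%:C) h.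
  under eq_fun do rewrite -![- g _ _ _]mulN1r.
  apply: (is_Cderive_eq h); rewrite /D /evensum /= !rmorphM !rmorphN /=; ring.
have D_le u z : normc (D u z) <= 8 * pi * dom z.
  case: z => s t; rewrite /D /= !ncM ncR.
  have h1 : `|(s * t)^-1 * (s * t)| <= 1.
    have [->|st0] := eqVneq (s * t) 0; first by rewrite mulr0 normr0.
    by rewrite mulVf// normr1.
  have h2 : normc (0 -i* (2 * pi) : R[i]) = 2 * pi.
    by rewrite ncE /= expr0n add0r sqrrN sqrtr_sqr ger0_norm// mulr_ge0// pi_ge0.
  have h3 : normc (evensum (g u) s t) <= 4 * dom (s, t).
    have [g1 g2 g3 g4] := g_le_sign u s t.
    have -> : 4 * dom (s, t) = dom (s, t) + dom (s, t) + dom (s, t) + dom (s, t) by ring.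
    do 3 (rewrite (le_trans (ncD _ _))// lerD//).
  have h4 : normc (0 -i* (2 * pi) : R[i]) * normc (evensum (g u) s t) <= 2 * pi * (4 * dom (s, t)).
    by rewrite h2 ler_wpM2l// mulr_ge0// pi_ge0.
  have := ler_pM (normr_ge0 _) (mulr_ge0 (nc_ge0 _) (nc_ge0 _)) h1 h4.
  by move=> /le_trans; apply; rewrite le_eqVlt; apply/orP; left; apply/eqP; ring.
have h := is_Cderive_Cintegral tt1 (fun u _ => Cintegrable_alt_kernel u)
  (fun u z _ => dD u z) (idom (8 * pi)) (fun u z _ => D_le u z).
apply: (is_Cderive_eq h).
have i1 : Cintegrable mu2 (fun z => evensum (g th) z.1 z.2).
  apply: (le_Cintegrable (meven th) (idom 4)) => -[s t].
  have [g1 g2 g3 g4] := g_le_sign th s t.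
  have -> : 4 * dom (s, t) = dom (s, t) + dom (s, t) + dom (s, t) + dom (s, t) by ring.
  do 3 (rewrite (le_trans (ncD _ _))// lerD//).
rewrite -CintegralZ//; apply: eq_Cintegral_off_axes.
- apply: CmeasurableM; last by apply: CmeasurableM => //; exact: Cmeasurable_cst.
  apply: CmeasurableR; apply: measurable_funM; last first.
    by apply: measurable_funM; [exact: measurable_fst|exact: measurable_snd].
  by apply: measurable_inv; apply: measurable_funM; [exact: measurable_fst|exact: measurable_snd].
- by apply: CmeasurableM => //; exact: Cmeasurable_cst.
- move=> [s t] /= s0 t0; rewrite /D /= mulVf ?mulf_neq0//.
  by rewrite (rmorph1 (real_complex R)) mul1r.
Qed.

Lemma normc_alt_kernel0 : normc (Cintegral mu2 (alt_kernel 0)) <=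
  4 * (2 * pi * A + 4 * pi ^+ 2) * \int[mu2]_z dom z.
Proof.
have h := normc_Cintegral_le (Cmeasurable_alt_kernel 0) (idom (M 0)) (alt_kernel_le 0).
apply: (le_trans h); rewrite RintegralZl//.
  by rewrite /M normr0 mulr0 addr0.
by have := idom 1; under eq_fun do rewrite /= mul1r.
Qed.

(** Reflections of (s, t) become sign changes of the parameters, so that [gauss2_lower] applies to
    each of the four summands. *)
Lemma Cintegral_evensum th : Cintegral mu2 (fun z => evensum (g th) z.1 z.2) =
  \sum_(e : bool * bool) Cintegral mu2 (fun z =>
    gauss2 a11 ((-1) ^+ (e.1 (+) e.2) * a12) a22 ((-1) ^+ e.1 * b1)
      ((-1) ^+ e.2 * b2) al ((-1) ^+ (e.1 (+) e.2) * th) z.1 z.2).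
Proof.
have ig (e1 e2 : bool) : Cintegrable mu2 (fun z : RR => g th ((-1) ^+ e1 * z.1) ((-1) ^+ e2 * z.2)).
  rewrite (funext (fun z : RR => gauss2_sign e1 e2 a11 a12 a22 b1 b2 al th z.1 z.2)).
  exact: (Cintegrable_gauss2 _ _ _ _ (coercive_sign _ co)).
have E (e1 e2 : bool) : Cintegral mu2 (fun z : RR => g th ((-1) ^+ e1 * z.1) ((-1) ^+ e2 * z.2)) =
   Cintegral mu2 (fun z =>
    gauss2 a11 ((-1) ^+ (e1 (+) e2) * a12) a22 ((-1) ^+ e1 * b1)
      ((-1) ^+ e2 * b2) al ((-1) ^+ (e1 (+) e2) * th) z.1 z.2).
  by apply: eq_Cintegral => z; exact: gauss2_sign.
rewrite (eq_Cintegral _ (evenE th)).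
rewrite !CintegralD//; do ?apply: CintegrableD => //.
rewrite !E (bigD1 (false, false))//= (bigD1 (true, false))//= (bigD1 (false, true))//=.
rewrite (bigD1 (true, true))//= big1 ?addr0 ?addrA//.
by move=> [[] []].
Qed.

End logarithmic_growth.

Section logarithmic_lower_bound.
Context {R : realType}.
Local Notation mu := (@lebesgue_measure R).
Local Notation mu2 := (sf_product mu mu).
Local Notation RR := (measurableTypeR R * measurableTypeR R)%type.

(* The imaginary part of the integral has derivative at most
   - 8 pi c / (sqrt la + th) in th on [0, la]; this is where the logarithm
   comes from. *)
Lemma alt_kernel_growth (eta A : R) : 0 < eta -> 0 < A -> exists c C0 rho : R,
  [/\ 0 < c, 0 < rho & forall a11 a12 a22 b1 b2 al la,
    coercive eta a11 a12 a22 -> a11 <= A -> `|a12| <= A -> a22 <= A ->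
    `|b1| <= rho -> `|b2| <= rho -> 1 <= la -> `|al| <= A * la ->
    c * ln (1 + Num.sqrt la) - C0 <=
    normc (Cintegral mu2 (alt_kernel a11 a12 a22 b1 b2 al la))].
Proof.
move=> eta0 A0; have [c [rho [c0 rho0 rho1 low]]] := gauss2_lower eta0 A0.
have p0 := pi_gt0 R.
exists (8 * pi * c), (4 * (2 * pi * A + 4 * pi ^+ 2) * \int[mu2]_z
  (expR (2 * pi * `|z.1| - pi * eta * z.1 ^+ 2) *
   expR (2 * pi * `|z.2| - pi * eta * z.2 ^+ 2))), rho; split => //.
  by rewrite mulr_gt0// mulr_gt0.
move=> a11 a12 a22 b1 b2 al la co a11A a12A a22A hb1 hb2 la1 alA.
have b11 : `|b1| <= 1 by exact: le_trans rho1.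
have b21 : `|b2| <= 1 by exact: le_trans rho1.
have sla1 : 1 <= Num.sqrt la by rewrite -sqrtr1 ler_wsqrtr.
pose I th := Cintegral mu2 (alt_kernel a11 a12 a22 b1 b2 al th).
pose S th := Cintegral mu2 (fun z : RR => evensum (gauss2 a11 a12 a22 b1 b2 al th) z.1 z.2).
have dI (th : R) : is_derive th 1 (fun th => Im (I th)) (- (2 * pi * Re (S th))).
  have [_ h] := is_Cderive_alt_kernel al co a12A b11 b21 th.
  apply: (is_derive_eq h); rewrite cImM /= -/(S th); ring.
pose q := Num.sqrt la.
have dg (th : R) : 0 <= th <= la -> is_derive th 1 (fun th => - (8 * pi * c) * ln (q + th))
    (- (8 * pi * c) * (q + th)^-1).
  move=> /andP[th0 _].
  have qt0 : 0 < q + th by rewrite ltr_pwDl// (lt_le_trans ltr01).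
  have h1 := is_deriveD (is_derive_cst q th (1 : R)) (is_derive_id th (1 : R)).
  have h2 := is_deriveZ (- (8 * pi * c)) (is_derive1_comp (is_derive1_ln qt0) h1).
  apply: (is_derive_eq h2).
  by rewrite /GRing.scale /= add0r mulr1.
(* Four Gaussian integrals, each at least c / (q + th), times 2 pi from the derivative: this is the
   constant 8 pi c. *)
have S_le th : 0 < th < la -> - (2 * pi * Re (S th)) <= - (8 * pi * c) * (q + th)^-1.
  move=> /andP[th0 _].
  have hS : 4 * (c / (q + th)) <= Re (S th).
    rewrite /S (Cintegral_evensum _ _ _ co).
    rewrite (bigD1 (false, false))//= (bigD1 (true, false))//= (bigD1 (false, true))//=.
    rewrite (bigD1 (true, true))//= big1 ?addr0; last by move=> [[] []].
    have low' (e1 e2 e3 : bool) : c / (q + th) <= Re (Cintegral mu2 (fun z : RR =>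
       gauss2 a11 ((-1) ^+ e1 * a12) a22 ((-1) ^+ e2 * b1) ((-1) ^+ e3 * b2) al
        ((-1) ^+ e1 * th) z.1 z.2)).
      have sgn (e : bool) (y : R) : `|(-1) ^+ e * y| = `|y| 
        by rewrite normrM normrX normrN1 expr1n mul1r.
      have := low a11 ((-1) ^+ e1 * a12) a22 ((-1) ^+ e2 * b1) ((-1) ^+ e3 * b2) al la
        ((-1) ^+ e1 * th) (coercive_sign e1 co) a11A.
      by rewrite !sgn (gtr0_norm th0); apply.
    have h1 := low' false false false; have h2 := low' true true false.
    have h3 := low' true false true; have h4 := low' false true true.
    rewrite !cReD; move: h1 h2 h3 h4 => /=; lra.
  have : 2 * pi * (4 * (c / (q + th))) <= 2 * pi * Re (S th).
    by rewrite ler_wpM2l// mulr_ge0// ltW.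
  lra.
have := @le_derive_increment R (fun th => Im (I th)) (fun th => - (8 * pi * c) * ln (q + th))
  (fun th => - (2 * pi * Re (S th))) (fun th => - (8 * pi * c) * (q + th)^-1) 0 la
  (le_trans ler01 la1) (fun th _ => dI th) dg S_le.
(* As la = q^2, the increment ln (q + la) - ln q is ln (1 + q). *)
have -> : - (8 * pi * c) * ln (q + la) - - (8 * pi * c) * ln (q + 0) =
    - (8 * pi * c * ln (1 + q)).
  have q0 : 0 < q by exact: lt_le_trans sla1.
  have -> : q + la = q * (1 + q).
    by rewrite /q mulrDr mulr1 -expr2 sqr_sqrtr// (le_trans ler01).
  rewrite lnM ?posrE ?addr_gt0// addr0; ring.
move=> h; have h0 := normc_alt_kernel0 al co a12A b11 b21.
apply: (le_trans _ (ler_Im_nc _)); rewrite lerBlDr.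
apply: (le_trans _ (lerD (lexx _) h0)).
apply: (le_trans _ (lerD (lexx _) (ler_Im_nc _))).
rewrite -/(I la) -/(I 0) -/q; move: (Im (I 0)) (Im (I la)) h => y0 y1.
have := ler_norm (- y1); have := ler_norm y0; rewrite normrN; lra.
Qed.

End logarithmic_lower_bound.

(** * Chirps *)

Section chirps.
Context {R : realType}.
Local Notation mu := (@lebesgue_measure R).

Lemma integral_weighted_gauss (r m : R) : 0 < r ->
  mu.-integrable setT (EFin \o (fun y =>
    (1 + `|y - m|) ^+ 2 * expR (- r * (y - m) ^+ 2))) /\
  \int[mu]_y ((1 + `|y - m|) ^+ 2 * expR (- r * (y - m) ^+ 2)) <=
  expR (2 / r) * Num.sqrt (pi / (r / 2)).
Proof.
move=> r0; have r20 : 0 < r / 2 by rewrite divr_gt0.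
have [ig eg] := integral_gauss m r20.
have ig' : mu.-integrable setT (EFin \o (fun y =>
    expR (2 / r) * expR (- (r / 2) * (y - m) ^+ 2))).
  have := ig => /(@integrableZl _ _ _ mu _ measurableT (expR (2 / r))).
  by under eq_fun do rewrite -EFinM.
have le y : (1 + `|y - m|) ^+ 2 * expR (- r * (y - m) ^+ 2) <=
    expR (2 / r) * expR (- (r / 2) * (y - m) ^+ 2).
  apply: (@le_trans _ _ (expR (2 * `|y - m|) * expR (- r * (y - m) ^+ 2))).
    rewrite ler_wpM2r ?expR_ge0// expRM_natl ler_pXn2r// ?nnegrE ?expR_ge0 ?addr_ge0//.
    exact: expR_ge1Dx.
  rewrite -!expRD ler_expR.
  have := le_quadratic 2 (y - m) r0.
  have -> : 2 ^+ 2 / (2 * r) = 2 / r by field; lra.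
  lra.
have i1 : mu.-integrable setT (EFin \o (fun y =>
    (1 + `|y - m|) ^+ 2 * expR (- r * (y - m) ^+ 2))).
  apply: le_integrable ig' => //.
    apply/measurable_EFinP; apply: measurable_funM.
      apply: measurable_funX; apply: measurable_funD => //.
      by apply: measurableT_comp => //; exact: measurable_funB.
    apply: measurableT_comp => //; apply: measurable_funM => //.
    by apply: measurable_funX; exact: measurable_funB.
  move=> y _; rewrite lee_fin ger0_norm ?mulr_ge0 ?expR_ge0 ?sqr_ge0//.
  by rewrite (le_trans (le y))// ler_norm.
split => //; rewrite -eg -RintegralZl//.
by apply: le_Rintegral => // y _; exact: le.
Qed.

Definition chirp (w : R[i]) (nu : R) : R -> R[i] := qexp w (0 -i* nu).

Lemma fourier_chirp (w : R[i]) nu xi : 0 < Re w ->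
  fourier (chirp w nu) xi = kappa w * cexp (pi%:C * (0 +i* (xi - nu)) ^+ 2 / w).
Proof.
move=> w0; have -> : 0 +i* (xi - nu) = (0 -i* nu) + (0 +i* xi) by apply: ReIm_eq => /=; ring.
rewrite -Cintegral_qexp// /fourier; apply: eq_Cintegral => x.
rewrite expiE -cexpD; congr cexp.
have -> : (0 +i* (- (2 * pi * x * xi)) : R[i]) = - pi%:C * (2 * (0 +i* xi) * x%:C).
  have -> : (2 : R[i]) = (2 : R)%:C by rewrite (rmorph_nat (real_complex R)).
  by apply: ReIm_eq; rewrite !(cReM, cImM, cReN, cImN) /=; ring.
ring.
Qed.

Lemma Re_inv (w : R[i]) : Re w^-1 = Re w / normc w ^+ 2.
Proof. by rewrite sqr_nc; case: w. Qed.

(** Fourier inversion by direct computation: the transform is again a Gaussian, with parameter w^-1.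
    The scalar in front equals 1, but only its modulus, [normc_kappa_inv], enters later. *)
Lemma fourier_chirp_inv (w : R[i]) nu y : 0 < Re w ->
  Cintegrable mu (fun xi => fourier (chirp w nu) xi * expi (2 * pi * y * xi)) /\
  Cintegral mu (fun xi => fourier (chirp w nu) xi * expi (2 * pi * y * xi)) =
  (kappa w * kappa w^-1) * chirp w nu y.
Proof.
move=> w0; have wn0 := Re_gt0_neq0 w0.
have iw0 : 0 < Re w^-1.
  rewrite Re_inv divr_gt0// exprn_gt0// (lt_le_trans w0)//.
  by rewrite (le_trans (ler_norm _))// ler_Re_nc.
pose b : R[i] := - (nu%:C / w) - (0 +i* y).
pose k : R[i] := kappa w * cexp (- pi%:C * nu%:C ^+ 2 / w).
have I2 (z : R) : (0 +i* z) ^+ 2 = - z%:C ^+ 2 :> R[i].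
  by rewrite !expr2; apply: ReIm_eq; rewrite !(cReM, cImM, cReN, cImN) /=; ring.
have E xi : fourier (chirp w nu) xi * expi (2 * pi * y * xi) = k * qexp w^-1 b xi.
  rewrite fourier_chirp// expiE /k /qexp -[LHS]mulrA -[RHS]mulrA -!cexpD; congr (_ * cexp _).
  have -> : (0 +i* (2 * pi * y * xi) : R[i]) = pi%:C * (2 * (0 +i* y) * xi%:C).
    have -> : (2 : R[i]) = (2 : R)%:C by rewrite (rmorph_nat (real_complex R)).
    by apply: ReIm_eq; rewrite !(cReM, cImM) /=; ring.
  rewrite I2 /b rmorphB /=.
  have gen (p n x z v : R[i]) : v != 0 -> p * - (x - n) ^+ 2 / v + p * (2 * z * x) =
     - p * n ^+ 2 / v + - p * (v^-1 * x ^+ 2 + 2 * (- (n / v) - z) * x).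
    by move=> v0; field.
  exact: gen.
have iq := Cintegrable_qexp b iw0.
split; first by rewrite (funext E); exact: CintegrableZ.
rewrite (funext E) CintegralZ// Cintegral_qexp//.
rewrite /k mulrACA -cexpD; congr (_ * cexp _).
have gen (p n z x v j : R[i]) : v != 0 -> j ^+ 2 = -1 -> 
   - p * n ^+ 2 / v + p * (- (n / v) - j * x) ^+ 2 / v^-1 =
   - p * (v * x ^+ 2 + 2 * (- j * n) * x).
  move=> v0 j2; have -> : p * (- (n / v) - j * x) ^+ 2 / v^-1 =
    p * n ^+ 2 / v + 2 * p * n * j * x + p * v * j ^+ 2 * x ^+ 2 by field.
  rewrite j2; ring.
have i2 : (0 +i* 1 : R[i]) ^+ 2 = -1 by rewrite I2 expr1n.
have := gen pi%:C nu%:C 0 y%:C w (0 +i* 1) wn0 i2.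
have -> : (0 +i* 1) * y%:C = 0 +i* y :> R[i] by apply: ReIm_eq; rewrite !(cReM, cImM) /=; ring.
have -> : - (0 +i* 1) * nu%:C = 0 -i* nu :> R[i].
  by apply: ReIm_eq; rewrite !(cReM, cImM, cReN, cImN) /=; ring.
by rewrite -/b.
Qed.

Lemma normc_kappa_inv (w : R[i]) : 0 < Re w -> normc (kappa w * kappa w^-1) = 1.
Proof.
move=> w0; have wn0 := Re_gt0_neq0 w0.
have iw0 : 0 < Re w^-1.
  rewrite Re_inv divr_gt0// exprn_gt0// (lt_le_trans w0)//.
  by rewrite (le_trans (ler_norm _))// ler_Re_nc.
have h1 := normc_kappa w0; have h2 := normc_kappa iw0.
have h3 : normc w * normc w^-1 = 1.
  by rewrite -ncM divff// -(rmorph1 (real_complex R)) ncR normr1.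
have h : normc (kappa w * kappa w^-1) ^+ 2 = 1.
  rewrite ncM exprMn -[LHS]mulr1 -h3 mulrACA h1 h2 mulr1//.
apply/eqP; rewrite -sqrp_eq1 ?nc_ge0//; exact/eqP.
Qed.

Lemma normc_chirp (w : R[i]) nu y : normc (chirp w nu y) = expR (- pi * Re w * y ^+ 2).
Proof. by rewrite normc_qexp /= mulr0 mul0r addr0 mulrA. Qed.

Lemma normc_fourier_chirp (w : R[i]) nu xi : Re w = 1 ->
  normc (fourier (chirp w nu) xi) =
  normc (kappa w) * expR (- (pi / normc w ^+ 2) * (xi - nu) ^+ 2).
Proof.
move=> w1; rewrite fourier_chirp ?w1// ncM nc_cexp; congr (_ * expR _).
have -> : (0 +i* (xi - nu)) ^+ 2 = (- (xi - nu) ^+ 2)%:C :> R[i].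
  by rewrite !expr2; apply: ReIm_eq; rewrite !(cReM, cImM, cReN, cImN) /=; ring.
by rewrite -rmorphM cReM /= mul0r subr0 Re_inv w1; ring.
Qed.

(** The bound h does not depend on nu, since weight and transform are both centred at nu. This makes
    later constants independent of N. *)
Lemma fourier_chirp_weight (w : R[i]) : Re w = 1 -> exists h : R, forall nu,
  Cintegrable mu (fun xi => ((1 + `|xi - nu|) ^+ 2 *
    normc (fourier (chirp w nu) xi))%:C) /\
  \int[mu]_xi ((1 + `|xi - nu|) ^+ 2 * normc (fourier (chirp w nu) xi)) <= h.
Proof.
move=> w1; have w0 : 0 < Re w by rewrite w1.
have r0 : 0 < pi / normc w ^+ 2.
  rewrite divr_gt0 ?pi_gt0// exprn_gt0// (lt_le_trans w0)//.
  by rewrite (le_trans (ler_norm _))// ler_Re_nc.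
eexists => nu; have [i1 l1] := integral_weighted_gauss nu r0.
have E xi : (1 + `|xi - nu|) ^+ 2 * normc (fourier (chirp w nu) xi) =
  normc (kappa w) * ((1 + `|xi - nu|) ^+ 2 * expR (- (pi / normc w ^+ 2) * (xi - nu) ^+ 2)).
  by rewrite normc_fourier_chirp//; ring.
split.
  under eq_fun do rewrite E.
  apply: CintegrableR; have := i1 => /(@integrableZl _ _ _ mu _ measurableT (normc (kappa w))).
  by under eq_fun do rewrite -EFinM.
rewrite (funext E) RintegralZl//.
exact: (ler_wpM2l (nc_ge0 _) l1).
Qed.

End chirps.

(** * Coercivity of Gram matrices *)

Section coercive_forms.
Context {R : realType}.

(** By Cayley-Hamilton a 2 by 2 matrix Q satisfies (tr Q) Q - det Q = Q^2, so the difference of the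
    two sides, times the trace, is |Q v|^2. *)
Lemma coercive_of_det (a11 a12 a22 : R) : 0 < a11 * a22 - a12 ^+ 2 ->
  0 < a11 + a22 -> coercive ((a11 * a22 - a12 ^+ 2) / (a11 + a22)) a11 a12 a22.
Proof.
move=> d0 t0; split; first by rewrite divr_gt0.
move=> s t; rewrite mulrAC ler_pdivrMr// -subr_ge0.
have -> : quad a11 a12 a22 s t * (a11 + a22) - (a11 * a22 - a12 ^+ 2) * (s ^+ 2 + t ^+ 2) =
  (a11 * s + a12 * t) ^+ 2 + (a12 * s + a22 * t) ^+ 2 by rewrite /quad; ring.
by rewrite addr_ge0// sqr_ge0.
Qed.

Lemma coerciveD (eta a11 a12 a22 k : R) : 0 <= k ->
  coercive eta a11 a12 a22 -> coercive eta (a11 + k) a12 (a22 + k).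
Proof.
move=> k0 [e0 h]; split => // s t; have := h s t; rewrite /quad.
have := mulr_ge0 k0 (sqr_ge0 s); have := mulr_ge0 k0 (sqr_ge0 t); lra.
Qed.

(** If p were a multiple r q, then sum c p q = r sum c q^2 = 0. So p and q are independent and their
    Gram determinant is positive. *)
Lemma gram_coercive n (p q c : 'I_n -> R) :
  \sum_l c l * q l ^+ 2 = 0 -> \sum_l c l * p l * q l != 0 ->
  exists eta, coercive eta (\sum_l p l ^+ 2) (\sum_l p l * q l) (\sum_l q l ^+ 2).
Proof.
move=> cqq cpq; eexists; apply: coercive_of_det; last first.
  rewrite ltr_wpDl ?sumr_ge0// => [l _|]; first exact: sqr_ge0.
  rewrite lt_neqAle sumr_ge0 ?andbT => [|l _]; last exact: sqr_ge0.
  rewrite eq_sym psumr_eq0 => [|l _]; last exact: sqr_ge0.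
  apply: contra cpq => /allP q0; rewrite big1// => l _.
  by have := q0 l (mem_index_enum _); rewrite /= sqrf_eq0 => /eqP ->; rewrite mulr0.
have q22 : 0 < \sum_l q l ^+ 2.
  rewrite lt_neqAle sumr_ge0 ?andbT => [|l _]; last exact: sqr_ge0.
  rewrite eq_sym psumr_eq0 => [|l _]; last exact: sqr_ge0.
  apply: contra cpq => /allP q0; rewrite big1// => l _.
  by have := q0 l (mem_index_enum _); rewrite /= sqrf_eq0 => /eqP ->; rewrite mulr0.
set q11 := \sum_l p l ^+ 2; set q12 := \sum_l p l * q l.
pose r := q12 / \sum_l q l ^+ 2.
have -> : q11 * (\sum_l q l ^+ 2) - q12 ^+ 2 =
    (\sum_l q l ^+ 2) * \sum_l (p l - r * q l) ^+ 2.
  have -> : \sum_l (p l - r * q l) ^+ 2 = q11 - 2 * r * q12 + r ^+ 2 * \sum_l q l ^+ 2.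
    rewrite /q11 /q12 !mulr_sumr -sumrB -big_split /=; apply: eq_bigr => l _; ring.
  by rewrite /r; field; rewrite gt_eqF.
rewrite pmulr_rgt0// lt_neqAle sumr_ge0 ?andbT => [|l _]; last exact: sqr_ge0.
rewrite eq_sym psumr_eq0 => [|l _]; last exact: sqr_ge0.
apply: contra cpq => /allP pr.
rewrite (eq_bigr (fun l => r * (c l * q l ^+ 2))) => [|l _].
  by rewrite -mulr_sumr cqq mulr0.
have := pr l (mem_index_enum _); rewrite /= sqrf_eq0 subr_eq0 => /eqP ->; ring.
Qed.

End coercive_forms.

Section tuple_weights.
Context {R : realType}.
Local Notation mu := (@lebesgue_measure R).

Lemma Rintegral_tuple n (V : 'I_n -> R -> R) :
  (forall l, Cintegrable mu (fun y => (V l y)%:C)) ->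
  (lebesgue_tuple R n).-integrable setT (EFin \o (fun t => \prod_l V l (tnth t l))) /\
  \int[lebesgue_tuple R n]_t (\prod_l V l (tnth t l)) = \prod_l \int[mu]_y V l y.
Proof.
move=> iV; have [i1 e1] := Cintegral_tuple iV.
have E t : \prod_l (V l (tnth t l))%:C = (\prod_l V l (tnth t l))%:C :> R[i].
  by rewrite rmorph_prod.
move: i1 e1; rewrite (funext E) => -[i1 _].
rewrite CintegralR (eq_bigr (fun l => (\int[mu]_y V l y)%:C)) => [|l _]; last exact: CintegralR.
by rewrite -rmorph_prod => -[e1]; split.
Qed.

Lemma prod_weight_ge1 n (P : pred 'I_n) (eta : 'I_n -> R) :
  1 <= \prod_(l | P l) (1 + `|eta l|).
Proof.
apply: (big_ind (fun x => 1 <= x)) => //= [x y x1 y1|l _].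
  by rewrite mulr_ege1.
by rewrite lerDl.
Qed.

Lemma norm_linear_form_le n (a eta : 'I_n -> R) :
  `|\sum_l a l * eta l| <= (\sum_l `|a l|) * \prod_l (1 + `|eta l|).
Proof.
rewrite (le_trans (ler_norm_sum _ _ _))// mulr_suml ler_sum// => l _.
rewrite normrM ler_wpM2l// (bigD1 l)//= (@le_trans _ _ (1 + `|eta l|))// ?lerDr//.
by rewrite ler_peMr ?prod_weight_ge1// addr_ge0.
Qed.

End tuple_weights.

Section chirp_tuples.
Context {R : realType}.
Local Notation mu := (@lebesgue_measure R).
Local Notation mu2 := (sf_product mu mu).
Local Notation RR := (measurableTypeR R * measurableTypeR R)%type.
Variable m : nat.
Local Notation X := (m.+1.-tuple (measurableTypeR R)).
Local Notation lam := (lebesgue_tuple R m.+1).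
Variables (c om : 'I_m.+1 -> R).

Definition linform (a : 'I_m.+1 -> R) (t : X) : R := \sum_l a l * (tnth t l : R).

Definition chirp_family (la N : R) (l : 'I_m.+1) : R -> R[i] :=
  chirp (1 +i* (la * c l)) (N * om l).

Local Notation F := chirp_family.

(* The integrand of nHT at the chirps, without the signs, see nHT_chirp. *)
Definition spectral (la N x : R) (t : X) : R[i] :=
  \prod_l (fourier (F la N l) (tnth t l) * expi (2 * pi * x * (tnth t l : R))).

Let Re1 (y : R) : Re (1 +i* y : R[i]) = 1. Proof. by []. Qed.
Let Re1_gt0 (y : R) : 0 < Re (1 +i* y : R[i]). Proof. by rewrite Re1. Qed.

(** The square allows the product of the weights to dominate two linear forms at once, as in |u v g|
    <= W. *)
Let weight (la N : R) (l : 'I_m.+1) (y : R) : R :=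
  (1 + `|y - N * om l|) ^+ 2 * normc (fourier (F la N l) y).

Definition spectral_weight (la N : R) (t : X) : R := \prod_l weight la N l (tnth t l).

Lemma spectral_weight_bound (la : R) : exists h : R, forall N,
  lam.-integrable setT (EFin \o spectral_weight la N) /\
  \int[lam]_t spectral_weight la N t <= h.
Proof.
have hw l : {h : R | forall N,
   Cintegrable mu (fun y => (weight la N l y)%:C) /\ \int[mu]_y weight la N l y <= h}.
  have [h hh] := cid (fourier_chirp_weight (Re1 (la * c l))).
  by exists h => N; exact: hh.
exists (\prod_l sval (hw l)) => N.
have [i1 e1] := Rintegral_tuple (fun l => (svalP (hw l) N).1).
split=> //; rewrite e1; apply: ler_prod => l _.
rewrite (svalP (hw l) N).2 andbT; apply: Rintegral_ge0 => y _.
by rewrite mulr_ge0 ?sqr_ge0 ?nc_ge0.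
Qed.

Lemma spectral_weightE la N t : spectral_weight la N t =
  (\prod_l (1 + `|tnth t l - N * om l|)) ^+ 2 * normc (\prod_l fourier (F la N l) (tnth t l)).
Proof. by rewrite /spectral_weight /weight big_split /= nc_prod prodrXl. Qed.

Lemma normc_spectral la N x t : normc (spectral la N x t) =
  normc (\prod_l fourier (F la N l) (tnth t l)).
Proof.
by rewrite !nc_prod; apply: eq_bigr => l _; rewrite ncM nc_expi mulr1.
Qed.

Lemma normc_spectral_le la N x t : normc (spectral la N x t) <= spectral_weight la N t.
Proof.
rewrite normc_spectral spectral_weightE ler_peMl ?nc_ge0//.
by rewrite expr2 mulr_ege1// prod_weight_ge1.
Qed.

Lemma Cmeasurable_spectral la N x : Cmeasurable (spectral la N x).
Proof.
apply: Cmeasurable_prod => l.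
apply: (@Cmeasurable_comp R _ _ _ _ (fun y => fourier (F la N l) y * expi (2 * pi * x * y))).
  exact: Cintegrable_measurable (fourier_chirp_inv (N * om l) x (Re1_gt0 (la * c l))).1.
exact: measurable_tnth.
Qed.

Lemma measurable_linform a : measurable_fun setT (linform a).
Proof.
apply: measurable_sum => l; apply: measurable_funM => //.
exact: measurable_tnth.
Qed.

(** Since om lies in the kernel of the form, its size depends only on the displacement from N om,
    and the weights control it uniformly in N. *)
Lemma linform_shift a (N : R) t : \sum_l om l * a l = 0 ->
  linform a t = \sum_l a l * (tnth t l - N * om l).
Proof.
move=> oa; rewrite /linform; under [RHS]eq_bigr do rewrite mulrBr.
rewrite sumrB (_ : \sum_l a l * (N * om l) = 0) ?subr0//.
rewrite (eq_bigr (fun l => N * (om l * a l))) => [|l _]; last by ring.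
by rewrite -mulr_sumr oa mulr0.
Qed.

Variables (p q : 'I_m.+1 -> R).
Hypotheses (cp : \sum_l c l * p l = 0) (cq : \sum_l c l * q l = 0)
  (cqq : \sum_l c l * q l ^+ 2 = 0) (cpq : \sum_l c l * p l * q l = 1)
  (op : \sum_l om l * p l = 0) (oq : \sum_l om l * q l = 0).

Let q11 := \sum_l p l ^+ 2.
Let q12 := \sum_l p l * q l.
Let q22 := \sum_l q l ^+ 2.
Let p1 := \sum_l p l.
Let q1 := \sum_l q l.
Let a := \sum_l c l * p l ^+ 2.
Let c1 := \sum_l c l.
Let o1 := \sum_l om l.

Let unim (la : R) : R[i] :=
  \prod_l (kappa (1 +i* (la * c l)) * kappa (1 +i* (la * c l))^-1).

Let normc_unim la : normc (unim la) = 1.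
Proof. by rewrite nc_prod big1// => l _; rewrite normc_kappa_inv. Qed.

Let z0 (la N x : R) : R[i] := (- pi * m.+1%:R * x ^+ 2) +i*
  (- pi * (la * c1) * x ^+ 2 + 2 * pi * N * o1 * x).

(** The exponential moves the point of evaluation of factor l from x to x + p_l s + q_l t, and
    Fourier inversion returns chirps at these points. In the exponent, the conditions on c leave
    only a s^2 + 2 s t besides a constant in the phase of size la, and those on om remove N from the
    dependence on s and t. *)
Let Cintegral_spectral_unim la N x s t :
  Cintegrable lam (fun r => cexp (0 +i* (2 * pi * (s * linform p r + t * linform q r))) *
    spectral la N x r) /\
  Cintegral lam (fun r => cexp (0 +i* (2 * pi * (s * linform p r + t * linform q r))) *
    spectral la N x r) =
  unim la * cexp (z0 la N x) * gauss2 q11 q12 q22 (x * p1) (x * q1) (la * a) la s t.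
Proof.
have E r : cexp (0 +i* (2 * pi * (s * linform p r + t * linform q r))) * spectral la N x r =
   \prod_l (fun y => fourier (F la N l) y * expi (2 * pi * (x + p l * s + q l * t) * y)) (tnth r l).
  have -> : (0 +i* (2 * pi * (s * linform p r + t * linform q r)) : R[i]) =
     \sum_l (0 +i* (2 * pi * (p l * s + q l * t) * (tnth r l : R))).
    apply: ReIm_eq; first by rewrite raddf_sum /= big1.
    rewrite /linform [s * _]mulr_sumr [t * _]mulr_sumr -big_split mulr_sumr raddf_sum /=.
    by apply: eq_bigr => l _; ring.
  rewrite cexp_sum /spectral -big_split; apply: eq_bigr => l _ /=.
  rewrite mulrCA !expiE -cexpD; congr (_ * cexp _).
  by apply: ReIm_eq => /=; ring.
have inv l := fourier_chirp_inv (N * om l) (x + p l * s + q l * t) (Re1_gt0 (la * c l)).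
have [i1 e1] := Cintegral_tuple (fun l => (inv l).1).
rewrite (funext E); split=> //.
rewrite e1 (eq_bigr _ (fun l _ => (inv l).2)) big_split /= -/(unim la) -mulrA; congr (_ * _).
rewrite /gauss2 -cexpD /chirp /qexp -cexp_sum; congr cexp.
have E2 l : - pi%:C * ((1 +i* (la * c l)) * (x + p l * s + q l * t)%:C ^+ 2 +
     2 * (0 -i* (N * om l)) * (x + p l * s + q l * t)%:C) =
   (- pi * (x + p l * s + q l * t) ^+ 2) +i*
   (- pi * (la * c l) * (x + p l * s + q l * t) ^+ 2 +
      2 * pi * N * om l * (x + p l * s + q l * t)) :> R[i].
  have -> : (2 : R[i]) = (2 : R)%:C by rewrite (rmorph_nat (real_complex R)).
  by rewrite expr2; apply: ReIm_eq; rewrite !(cReD, cImD, cReM, cImM, cReN, cImN) /=; ring.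
rewrite (eq_bigr _ (fun l _ => E2 l)).
have S1 : \sum_l (x + p l * s + q l * t) ^+ 2 = m.+1%:R * x ^+ 2 + quad q11 q12 q22 s t +
   2 * (x * p1 * s + x * q1 * t).
  rewrite (eq_bigr (fun l => x ^+ 2 + (p l ^+ 2 * s ^+ 2 + (p l * q l) * (2 * s * t) +
     q l ^+ 2 * t ^+ 2) + (p l * (2 * x * s) + q l * (2 * x * t)))) => [|l _]; last by ring.
  rewrite !big_split /= -!mulr_suml sumr_const card_ord -mulr_natl.
  rewrite -/q11 -/q12 -/q22 -/p1 -/q1 /quad; ring.
have S2 : \sum_l c l * (x + p l * s + q l * t) ^+ 2 = c1 * x ^+ 2 + a * s ^+ 2 + 2 * s * t.
  rewrite (eq_bigr (fun l => c l * x ^+ 2 + ((c l * p l ^+ 2) * s ^+ 2 +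
     (c l * p l * q l) * (2 * s * t) + (c l * q l ^+ 2) * t ^+ 2) +
     ((c l * p l) * (2 * x * s) + (c l * q l) * (2 * x * t)))) => [|l _]; last by ring.
  rewrite !big_split /= -!mulr_suml cp cq cqq cpq -/c1 -/a; ring.
have S3 : \sum_l om l * (x + p l * s + q l * t) = o1 * x.
  rewrite (eq_bigr (fun l => om l * x + ((om l * p l) * s + (om l * q l) * t))) => [|l _]; last by ring.
  rewrite !big_split /= -!mulr_suml op oq -/o1; ring.
have S2' : \sum_l (- pi * (la * c l) * (x + p l * s + q l * t) ^+ 2) =
   - pi * la * (c1 * x ^+ 2 + a * s ^+ 2 + 2 * s * t).
  by rewrite -S2 mulr_sumr; apply: eq_bigr => l _; ring.
have S3' : \sum_l (2 * pi * N * om l * (x + p l * s + q l * t)) = 2 * pi * N * (o1 * x).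
  by rewrite -S3 mulr_sumr; apply: eq_bigr => l _; ring.
apply: ReIm_eq; rewrite raddf_sum /z0 ?cReD ?cImD /=.
  rewrite -mulr_sumr S1; ring.
rewrite big_split /= S2' S3'; ring.
Qed.

(** All factors free of s and t are gathered in g, of which only the modulus matters. *)
Lemma Cintegral_spectral la N x : exists2 g : R[i],
  normc g = expR (- pi * m.+1%:R * x ^+ 2) & forall s t,
  Cintegrable lam (fun r => cexp (0 +i* (2 * pi * (s * linform p r + t * linform q r))) *
    spectral la N x r) /\
  Cintegral lam (fun r => cexp (0 +i* (2 * pi * (s * linform p r + t * linform q r))) *
    spectral la N x r) =
  g * gauss2 (\sum_l p l ^+ 2) (\sum_l p l * q l) (\sum_l q l ^+ 2)
    (x * \sum_l p l) (x * \sum_l q l) (la * \sum_l c l * p l ^+ 2) la s t.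
Proof.
exists (unim la * cexp (z0 la N x)); first by rewrite ncM normc_unim mul1r nc_cexp.
exact: Cintegral_spectral_unim.
Qed.

End chirp_tuples.

(** * The two-sign integral *)

Section sign_integral.
Context {R : realType}.
Local Notation mu := (@lebesgue_measure R).
Local Notation mu2 := (sf_product mu mu).
Local Notation RR := (measurableTypeR R * measurableTypeR R)%type.

(** The alternating sum factors into two terms 2 i sin, whose product carries the factor - 4. *)
Lemma sin_kernel_mul s t (A B : R) : s != 0 -> t != 0 ->
  (sin_kernel s A * sin_kernel t B)%:C =
  (- (4 * pi ^+ 2)^-1 * (s * t)^-1)%:C *
  altsum (fun s t => cexp (0 +i* (2 * pi * (s * A + t * B)))) s t.
Proof.
move=> s0 t0; have p0 := lt0r_neq0 (pi_gt0 R).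
rewrite /sin_kernel (negPf s0) (negPf t0) /altsum.
have -> (a b : R) : 2 * pi * (a * A + b * B) = 2 * pi * a * A + 2 * pi * b * B by ring.
have -> (a b : R) : 2 * pi * (- a * A + b * B) = - (2 * pi * a * A) + 2 * pi * b * B by ring.
have -> (a b : R) : 2 * pi * (a * A + - b * B) = 2 * pi * a * A - 2 * pi * b * B by ring.
have -> (a b : R) : 2 * pi * (- a * A + - b * B) = - (2 * pi * a * A) - 2 * pi * b * B by ring.
move: p0; move: (2 * pi * s * A) (2 * pi * t * B) => u v; move: pi => P P0.
apply: ReIm_eq; rewrite ?cReM ?cImM !(cReD, cImD, cReN, cImN) !(Re_cexp, Im_cexp) /=
  expR0 !(cosD, cosN, sinD, sinN); field; exact/and3P.
Qed.

Variable m : nat.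
Local Notation lam := (lebesgue_tuple R m.+1).
Variables (c om p q : 'I_m.+1 -> R).
Hypotheses (cp : \sum_l c l * p l = 0) (cq : \sum_l c l * q l = 0)
  (cqq : \sum_l c l * q l ^+ 2 = 0) (cpq : \sum_l c l * p l * q l = 1)
  (op : \sum_l om l * p l = 0) (oq : \sum_l om l * q l = 0).
Local Notation g := (spectral c om).
Local Notation u := (linform p).
Local Notation v := (linform q).

Let q11 := \sum_l p l ^+ 2.
Let q12 := \sum_l p l * q l.
Let q22 := \sum_l q l ^+ 2.
Let p1 := \sum_l p l.
Let q1 := \sum_l q l.
Let a := \sum_l c l * p l ^+ 2.

Lemma sin_kernel_spectral la N x (G : R[i]) s t : s != 0 -> t != 0 ->
  (forall s t, Cintegrable lam (fun r =>
      cexp (0 +i* (2 * pi * (s * u r + t * v r))) * g la N x r) /\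
    Cintegral lam (fun r => cexp (0 +i* (2 * pi * (s * u r + t * v r))) * g la N x r) =
    G * gauss2 q11 q12 q22 (x * p1) (x * q1) (la * a) la s t) ->
  Cintegral lam (fun r => (sin_kernel s (u r) * sin_kernel t (v r))%:C * g la N x r) =
  (- (4 * pi ^+ 2)^-1 * (s * t)^-1)%:C * (G *
    altsum (gauss2 q11 q12 q22 (x * p1) (x * q1) (la * a) la) s t).
Proof.
move=> s0 t0 h.
under eq_Cintegral => r do rewrite (sin_kernel_mul _ _ s0 t0) -mulrA.
have iE s' t' := (h s' t').1; have eE s' t' := (h s' t').2.
set E := fun s t r => cexp (0 +i* (2 * pi * (s * u r + t * v r))) * g la N x r in iE eE.
have -> : (fun r => (- (4 * pi ^+ 2)^-1 * (s * t)^-1)%:C *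
    (altsum (fun s t => cexp (0 +i* (2 * pi * (s * u r + t * v r)))) s t * g la N x r)) =
  (fun r => (- (4 * pi ^+ 2)^-1 * (s * t)^-1)%:C *
    (E s t r + (-1) * E (- s) t r + (-1) * E s (- t) r + E (- s) (- t) r)).
  by apply/funext => r; rewrite /altsum /E; congr (_ * _); ring.
have i2 := CintegrableZ (-1) (iE (- s) t); have i3 := CintegrableZ (-1) (iE s (- t)).
have i12 := CintegrableD (iE s t) i2; have i123 := CintegrableD i12 i3.
rewrite CintegralZ; last exact: CintegrableD i123 (iE (- s) (- t)).
rewrite (CintegralD i123 (iE (- s) (- t))) (CintegralD i12 i3) (CintegralD (iE s t) i2).
rewrite (CintegralZ (-1) (iE (- s) t)) (CintegralZ (-1) (iE s (- t))) !eE /altsum.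
congr (_ * _); ring.
Qed.

(** The cut-offs keep the integrand in the family [gauss2], and raising the diagonal preserves
    coercivity with the same constant. *)
Lemma gauss2_mollify K s t (b1 b2 al th : R) :
  (gaussK K s * gaussK K t)%:C * gauss2 q11 q12 q22 b1 b2 al th s t =
  gauss2 (q11 + K^-1 ^+ 2) q12 (q22 + K^-1 ^+ 2) b1 b2 al th s t.
Proof.
rewrite /gaussK -expRD.
have -> (y : R) : (expR y)%:C = cexp y%:C.
  by apply: ReIm_eq; rewrite ?Re_cexp ?Im_cexp /= ?cos0 ?sin0 ?mulr1 ?mulr0.
rewrite /gauss2 -cexpD; congr cexp; apply: ReIm_eq; rewrite ?(cReD, cImD) /= /quad; ring.
Qed.

(** The cut-offs are even and therefore pass inside the alternating sum. *)
Lemma Cintegral_mollified la N x (G : R[i]) K eta : 0 < K ->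
  coercive eta q11 q12 q22 -> `|x * p1| <= 1 -> `|x * q1| <= 1 ->
  (forall s t, Cintegrable lam (fun r =>
      cexp (0 +i* (2 * pi * (s * u r + t * v r))) * g la N x r) /\
    Cintegral lam (fun r => cexp (0 +i* (2 * pi * (s * u r + t * v r))) * g la N x r) =
    G * gauss2 q11 q12 q22 (x * p1) (x * q1) (la * a) la s t) ->
  Cmeasurable (fun z : RR => (gaussK K z.1 * gaussK K z.2)%:C *
    Cintegral lam (fun r => (sin_kernel z.1 (u r) * sin_kernel z.2 (v r))%:C * g la N x r)) ->
  Cintegral mu2 (fun z => (gaussK K z.1 * gaussK K z.2)%:C *
    Cintegral lam (fun r => (sin_kernel z.1 (u r) * sin_kernel z.2 (v r))%:C * g la N x r)) =
  ((- (4 * pi ^+ 2)^-1)%:C * G) * Cintegral mu2 (alt_kernel (q11 + K^-1 ^+ 2) q12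
    (q22 + K^-1 ^+ 2) (x * p1) (x * q1) (la * a) la).
Proof.
move=> K0 co xp xq h mz.
have co' := coerciveD (sqr_ge0 K^-1) co.
rewrite -CintegralZ; last exact: (Cintegrable_alt_kernel _ co' (lexx _)).
apply: eq_Cintegral_off_axes => //.
  apply: CmeasurableM; first exact: Cmeasurable_cst.
  exact: Cmeasurable_alt_kernel.
move=> [s t] /= s0 t0; rewrite (sin_kernel_spectral s0 t0 h) /alt_kernel /=.
have gN (y : R) : gaussK K (- y) = gaussK K y by rewrite /gaussK sqrrN.
have <- : altsum (fun s t => (gaussK K s * gaussK K t)%:C *
    gauss2 q11 q12 q22 (x * p1) (x * q1) (la * a) la s t) s t =
  altsum (gauss2 (q11 + K^-1 ^+ 2) q12 (q22 + K^-1 ^+ 2) (x * p1) (x * q1) (la * a) la) s t.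
  by rewrite /altsum !gauss2_mollify.
by rewrite /altsum !gN -!mulrBr -mulrDr rmorphM /=; ring.
Qed.

Lemma sign_integral_growth : exists k0 C delta : R, [/\ 0 < k0, 0 < delta &
  forall la N x, 1 <= la -> `|x| <= delta ->
  k0 * ln (1 + Num.sqrt la) - C <=
  normc (Cintegral lam (fun r => (Num.sg (u r) * Num.sg (v r))%:C * g la N x r))].
Proof.
have cpq0 : \sum_l c l * p l * q l != 0 by rewrite cpq oner_neq0.
have [eta co] := gram_coercive cqq cpq0.
(* The summand 1 makes room for K^-2 <= 1 on the diagonal. *)
pose A := 1 + `|q11| + `|q12| + `|q22| + `|a|.
have A0 : 0 < A by rewrite /A -!addrA ltr_pwDl// !addr_ge0.
have [k [C0 [rho [k0 rho0 low]]]] := alt_kernel_growth co.1 A0.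
have p0 := pi_gt0 R.
pose B := 1 + `|p1| + `|q1|.
have B0 : 0 < B by rewrite /B -!addrA ltr_pwDl// !addr_ge0.
(* Keeps the linear coefficients x p1 and x q1 below both rho and 1, and |x| <= 1 for the lower
   bound on |G|. *)
pose delta := Num.min 1 (Num.min rho 1 / B).
(* The three factors come from the sine kernels, from |G| at |x| <= 1, and from the limit of [chi]
   in [sign_transfer]. *)
pose D := (4 * pi ^+ 2)^-1 * expR (- pi * m.+1%:R) / (chi_lim ^+ 2 + 1) : R.
have pp : 0 < 4 * pi ^+ 2 :> R by rewrite mulr_gt0// exprn_gt0.
have D0 : 0 < D.
  rewrite /D divr_gt0//; last by rewrite ltr_wpDl// sqr_ge0.
  by rewrite mulr_gt0 ?expR_gt0// invr_gt0.
have delta0 : 0 < delta.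
  by rewrite /delta lt_min ltr01 divr_gt0// lt_min rho0 ltr01.
exists (D * k), (D * C0), delta; split => // [|la N x la1]; first exact: mulr_gt0.
rewrite /delta le_min => /andP[x1 xB].
have xb (b : R) : `|b| <= B -> `|x * b| <= rho /\ `|x * b| <= 1.
  move=> bB; apply/andP; rewrite -le_min normrM.
  rewrite (le_trans (ler_pM _ _ xB bB))// mulfVK// gt_eqF//.
have [xp1 xp2] : `|x * p1| <= rho /\ `|x * p1| <= 1.
  by apply: xb; rewrite /B; have := normr_ge0 q1; lra.
have [xq1 xq2] : `|x * q1| <= rho /\ `|x * q1| <= 1.
  by apply: xb; rewrite /B; have := normr_ge0 p1; lra.
have [G nG hG] := Cintegral_spectral cp cq cqq cpq op oq la N x.
(* The summand 1 serves for |g| <= W, the product for |u v g| <= W. *)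
pose PQ := 1 + (\sum_l `|p l|) * (\sum_l `|q l|).
have PQ0 : 0 <= (\sum_l `|p l|) * (\sum_l `|q l|).
  by rewrite mulr_ge0// sumr_ge0.
pose W r := PQ * spectral_weight c om la N r.
have mg := Cmeasurable_spectral c om la N x.
have mu_ := @measurable_linform R m p.
have mv := @measurable_linform R m q.
have iW : lam.-integrable setT (EFin \o W).
  have [h hh] := spectral_weight_bound c om la.
  have := (hh N).1 => /(@integrableZl _ _ _ lam _ measurableT PQ).
  by under eq_fun do rewrite -EFinM.
have sw0 r : 0 <= spectral_weight c om la N r.
  exact: le_trans (nc_ge0 _) (normc_spectral_le c om la N x r).
have gW r : normc (g la N x r) <= W r.
  rewrite (le_trans (normc_spectral_le _ _ _ _ _ _))// /W ler_peMl//.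
  by rewrite /PQ lerDl.
have uvgW r : `|u r| * `|v r| * normc (g la N x r) <= W r.
  rewrite (linform_shift N r op) (linform_shift N r oq) normc_spectral /W spectral_weightE mulrA.
  rewrite ler_wpM2r ?nc_ge0//.
  have h1 := norm_linear_form_le p (fun l => tnth r l - N * om l).
  have h2 := norm_linear_form_le q (fun l => tnth r l - N * om l).
  apply: (le_trans (ler_pM (normr_ge0 _) (normr_ge0 _) h1 h2)).
  rewrite mulrACA -expr2 ler_wpM2r ?sqr_ge0// /PQ lerDr//.
pose J := normc (Cintegral lam (fun r => (Num.sg (u r) * Num.sg (v r))%:C * g la N x r)).
pose Lw := (4 * pi ^+ 2)^-1 * expR (- pi * m.+1%:R) * (k * ln (1 + Num.sqrt la) - C0).
have hL : Lw <= chi_lim ^+ 2 * J.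
  apply: (sign_transfer mg mu_ mv iW gW uvgW) => K K1.
  have K0 : 0 < K by exact: lt_le_trans K1.
  have [mz _] := Cintegral_chi_chi mg mu_ mv iW gW uvgW K0.
  rewrite (Cintegral_mollified K0 co xp2 xq2 hG mz) !ncM ncR normrN.
  rewrite ger0_norm ?invr_ge0 ?(ltW pp)// nG /Lw -!mulrA ler_wpM2l ?invr_ge0 ?(ltW pp)//.
  have iK0 : 0 <= K^-1 ^+ 2 by rewrite sqr_ge0.
  have iK1 : K^-1 ^+ 2 <= 1 by rewrite expr_le1// ?invr_ge0 ?(ltW K0)// invf_le1.
  have lw := low (q11 + K^-1 ^+ 2) q12 (q22 + K^-1 ^+ 2) _ _ (la * a) la (coerciveD iK0 co).
  have {}lw : k * ln (1 + Num.sqrt la) - C0 <= normc (Cintegral mu2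
      (alt_kernel (q11 + K^-1 ^+ 2) q12 (q22 + K^-1 ^+ 2) (x * p1) (x * q1) (la * a) la)).
    have n11 := ler_norm q11; have n22 := ler_norm q22.
    have [g11 g12 g22 ga] := And4 (normr_ge0 q11) (normr_ge0 q12) (normr_ge0 q22) (normr_ge0 a).
    apply: lw => //; try by rewrite /A; lra.
    rewrite normrM mulrC (ger0_norm (le_trans ler01 la1)) ler_wpM2r ?(le_trans ler01 la1)//.
    by rewrite /A; lra.
  apply: (@le_trans _ _ (expR (- pi * m.+1%:R) * normc (Cintegral mu2
      (alt_kernel (q11 + K^-1 ^+ 2) q12 (q22 + K^-1 ^+ 2) (x * p1) (x * q1) (la * a) la)))).
    by rewrite ler_wpM2l ?expR_ge0.
  rewrite ler_wpM2r ?nc_ge0// ler_expR !mulNr lerN2 ler_wpM2l ?(ltW p0)// ler_piMr//.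
  by rewrite -(real_normK (num_real x)) expr_le1.
rewrite -/J; have J0 : 0 <= J by exact: nc_ge0.
have -> : D * k * ln (1 + Num.sqrt la) - D * C0 = Lw / (chi_lim ^+ 2 + 1).
  by rewrite /D /Lw; ring.
rewrite ler_pdivrMr; last by rewrite ltr_wpDl// sqr_ge0.
by rewrite mulrDr mulr1 mulrC (le_trans hL)// lerDl.
Qed.

End sign_integral.

(** * The operator on chirps *)

Section perturbation.
Context {R : realType}.

Lemma prodr_bool_le1 k (P : pred 'I_k) (s : 'I_k -> R) :
  (forall j, `|s j| <= 1) -> `|\prod_(j | P j) s j| <= 1.
Proof.
move=> s1; apply: (big_ind (fun y => `|y| <= 1)) => //.
  by rewrite normr1.
by move=> y z y1 z1; rewrite normrM mulr_ile1.
Qed.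

Lemma norm_sg_le1 (y : R) : `|Num.sg y| <= 1.
Proof. by case: sgrP => _; rewrite ?normr0 ?normrN ?normr1. Qed.

Lemma sgD_small (e w : R) : `|e| < `|w| -> Num.sg (e + w) = Num.sg w.
Proof.
move=> ew; have w0 : w != 0 by rewrite -normr_gt0 (le_lt_trans _ ew).
case: (ltgtP w 0) w0 ew => // w0 _; rewrite ?(gtr0_norm w0) ?(ltr0_norm w0) ltr_norml => /andP[e1 e2].
  by rewrite (ltr0_sg w0) ltr0_sg//; lra.
by rewrite (gtr0_sg w0) gtr0_sg//; lra.
Qed.

(* If a sign changes between t and N om then the distance of t to N om is at
   least a multiple of N. *)
Lemma prod_sg_perturb k m (P : pred 'I_k) (a : 'I_k -> 'I_m -> R) (om : 'I_m -> R) :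
  (forall j, P j -> \sum_l om l * a j l != 0) ->
  exists B, 0 <= B /\ forall N (t : 'I_m -> R), 0 < N ->
  `|\prod_(j | P j) Num.sg (\sum_l a j l * t l) -
    \prod_(j | P j) Num.sg (\sum_l om l * a j l)| <=
  B / N * \prod_l (1 + `|t l - N * om l|).
Proof.
move=> w0; pose w j := \sum_l om l * a j l.
exists (2 * \sum_(j | P j) (\sum_l `|a j l|) / `|w j|); split.
  by rewrite mulr_ge0// sumr_ge0// => j _; rewrite divr_ge0// sumr_ge0.
move=> N t N0; pose e j := \sum_l a j l * (t l - N * om l).
pose Pi := \prod_l (1 + `|t l - N * om l|); rewrite -/Pi.
have Pi1 : 1 <= Pi by exact: prod_weight_ge1.
have et j : \sum_l a j l * t l = e j + N * w j.
  rewrite /e /w mulr_sumr -big_split /=; apply: eq_bigr => l _; ring.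
have [/forallP h|] := boolP [forall j, P j ==> (`|e j| < N * `|w j|)].
  rewrite (eq_bigr (fun j => Num.sg (w j))) => [|j Pj]; last first.
    rewrite et sgD_small; first by rewrite sgrM gtr0_sg// mul1r.
    by rewrite normrM (gtr0_norm N0) (implyP (h j) Pj).
  rewrite subrr normr0 mulr_ge0 ?(le_trans ler01 Pi1)// divr_ge0 ?(ltW N0)//.
  by rewrite mulr_ge0// sumr_ge0// => j _; rewrite divr_ge0// sumr_ge0.
rewrite negb_forall => /existsP[j]; rewrite negb_imply -leNgt => /andP[Pj ej].
have wj0 : 0 < `|w j| by rewrite normr_gt0 w0.
have s1 (f : 'I_k -> R) : `|\prod_(j | P j) Num.sg (f j)| <= 1.
  by apply: prodr_bool_le1 => i; exact: norm_sg_le1.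
apply: (@le_trans _ _ 2).
  by rewrite (le_trans (ler_normB _ _))// -[leRHS]/(1 + 1) lerD ?s1.
have : N * `|w j| <= (\sum_l `|a j l|) * Pi.
  exact: le_trans ej (norm_linear_form_le _ _).
rewrite -ler_pdivlMr// mulrAC => h.
have {}h : N <= (\sum_(j | P j) (\sum_l `|a j l|) / `|w j|) * Pi.
  rewrite (le_trans h)// ler_wpM2r ?(le_trans ler01 Pi1)// (bigD1 j)//= lerDl.
  by rewrite sumr_ge0// => i _; rewrite divr_ge0// sumr_ge0.
by rewrite mulrAC ler_pdivlMr// -mulrA ler_wpM2l.
Qed.

End perturbation.

Section nHT_lower_bound.
Context {R : realType}.
Variables (k m : nat) (alpha : 'M[R]_(k, m)).
Local Notation lam := (lebesgue_tuple R m.+1).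

Definition extended_row (j : 'I_k) (l : 'I_m.+1) : R :=
  if unlift ord0 l is Some l' then alpha j l' else 1.

Lemma extended_row0 j : extended_row j ord0 = 1.
Proof. by rewrite /extended_row unlift_none. Qed.

Lemma extended_rowS j l : extended_row j (lift ord0 l) = alpha j l.
Proof. by rewrite /extended_row liftK. Qed.

Lemma nHT_chirp (c om : 'I_m.+1 -> R) la N x :
  nHT alpha (chirp_family c om la N ord0)
    (fun l => chirp_family c om la N (lift ord0 l)) x =
  Cintegral lam (fun t => (\prod_j Num.sg (linform (extended_row j) t))%:C *
    spectral c om la N x t).
Proof.
apply: eq_Cintegral => t; rewrite /= -!mulrA; congr (_ * _).
  congr (_%:C); apply: eq_bigr => j _; rewrite /linform big_ord_recl extended_row0 mul1r.
  by congr (Num.sg (_ + _)); apply: eq_bigr => l _; rewrite extended_rowS.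
rewrite /spectral big_split /= big_ord_recl -!mulrA; congr (_ * (_ * _)).
rewrite expiE; under [RHS]eq_bigr do rewrite expiE.
rewrite -cexp_sum; congr cexp; apply: ReIm_eq; first by rewrite raddf_sum /= big1.
by rewrite raddf_sum /= -mulr_sumr big_ord_recl -!mulrA.
Qed.

(** The constants k0, C and delta are independent of la, and h is independent of N and x; so la can
    be chosen first and the error removed afterwards by a large N. *)
Lemma nHT_chirp_growth (c om : 'I_m.+1 -> R) (j0 j1 : 'I_k) :
  let p := extended_row j0 in let q := extended_row j1 in
  j0 != j1 ->
  \sum_l c l * p l = 0 -> \sum_l c l * q l = 0 ->
  \sum_l c l * q l ^+ 2 = 0 -> \sum_l c l * p l * q l = 1 ->
  \sum_l om l * p l = 0 -> \sum_l om l * q l = 0 ->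
  (forall j, j != j0 -> j != j1 -> \sum_l om l * extended_row j l != 0) ->
  exists k0 C delta : R, [/\ 0 < k0, 0 < delta & forall la, 1 <= la ->
  exists h, forall N x, 0 < N -> `|x| <= delta ->
  k0 * ln (1 + Num.sqrt la) - C - h / N <=
  normc (nHT alpha (chirp_family c om la N ord0)
    (fun l => chirp_family c om la N (lift ord0 l)) x)].
Proof.
move=> p q j01 cp cq cqq cpq op oq ow.
have [k0 [C [delta [k00 delta0 low]]]] := sign_integral_growth cp cq cqq cpq op oq.
exists k0, C, delta; split => // la la1.
have [h hh] := spectral_weight_bound c om la.
pose P j := (j != j0) && (j != j1).
have ow' j : P j -> \sum_l om l * extended_row j l != 0 by move=> /andP[]; exact: ow.
have [B [B0 hB]] := prod_sg_perturb ow'.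
exists (B * h) => N x N0 xd.
have {}low := low _ N _ la1 xd.
pose ep := \prod_(j | P j) Num.sg (\sum_l om l * extended_row j l).
have nep : `|ep| = 1.
  rewrite /ep normr_prod big1// => j /ow' w0.
  by rewrite normr_sg w0.
pose g := spectral c om la N x.
pose S t := Num.sg (linform p t) * Num.sg (linform q t).
pose Q t := \prod_(j | P j) Num.sg (linform (extended_row j) t).
have E t : \prod_j Num.sg (linform (extended_row j) t) = S t * Q t.
  rewrite (bigD1 j0)//= (bigD1 j1) ?[j1 == _]eq_sym//= mulrA; congr (_ * _).
have mS : measurable_fun setT S.
  by apply: measurable_funM; apply: measurable_sg; exact: measurable_linform.
have mQ : measurable_fun setT Q.
  rewrite /Q; under eq_fun do rewrite big_mkcond /=; apply: measurable_prod => j _.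
  case: (P j); last exact: measurable_cst.
  by apply: measurable_sg; exact: measurable_linform.
have mg := Cmeasurable_spectral c om la N x.
have s1 t : `|S t| <= 1 by rewrite normrM mulr_ile1 ?norm_sg_le1.
have [iw hw] := hh N.
have ig (f : _ -> R) : measurable_fun setT f -> (forall t, `|f t| <= 1) ->
    Cintegrable lam (fun t => (f t)%:C * g t).
  move=> mf f1; apply: (le_Cintegrable _ iw) => [|t].
    by apply: CmeasurableM => //; exact: CmeasurableR.
  rewrite ncM ncR (le_trans _ (normc_spectral_le c om la N x t))//.
  by rewrite ler_piMl ?nc_ge0.
have iS := ig _ mS s1.
have iSQ : Cintegrable lam (fun t => (S t * Q t)%:C * g t).
  apply: ig; first exact: measurable_funM.
  move=> t; rewrite normrM mulr_ile1//; apply: prodr_bool_le1 => j; exact: norm_sg_le1.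
rewrite nHT_chirp; under eq_Cintegral => t do rewrite E.
set I := Cintegral _ _.
set J := Cintegral lam (fun t => (S t)%:C * g t) in low *.
have IJ : normc (I - ep%:C * J) <= B * h / N.
  have -> : I - ep%:C * J = Cintegral lam (fun t => (S t * Q t)%:C * g t + (- ep%:C) * ((S t)%:C * g t)).
    rewrite CintegralD//; last exact: CintegrableZ.
    by rewrite CintegralZ// mulNr.
  have ES t : (S t * Q t)%:C * g t + (- ep%:C) * ((S t)%:C * g t) =
      (S t * (Q t - ep))%:C * g t.
    by rewrite mulrBr rmorphB !rmorphM /=; ring.
  have iW : lam.-integrable setT (EFin \o (fun t => B / N * spectral_weight c om la N t)).
    have := iw => /(@integrableZl _ _ _ lam _ measurableT (B / N)).
    by under eq_fun do rewrite -EFinM.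
  under eq_Cintegral => t do rewrite ES.
  apply: (le_trans (normc_Cintegral_le _ iW _)) => [|t|].
  - apply: CmeasurableM => //; apply: CmeasurableR; apply: measurable_funM => //.
    exact: measurable_funB.
  - rewrite ncM ncR normrM normc_spectral spectral_weightE [leRHS]mulrA ler_wpM2r ?nc_ge0//.
    rewrite -[leRHS]mul1r ler_pM// (le_trans (hB N (tnth t) N0))// ler_wpM2l ?divr_ge0 ?(ltW N0)//.
    by rewrite expr2 ler_peMr ?prod_weight_ge1// (le_trans ler01)// prod_weight_ge1.
  - by rewrite RintegralZl// mulrAC ler_wpM2r ?invr_ge0 ?(ltW N0)// ler_wpM2l.
have := ncD (ep%:C * J - I) I; rewrite subrK -opprB ncN ncM ncR nep mul1r.
lra.
Qed.

End nHT_lower_bound.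

(** * Chirps are Schwartz functions *)

Section schwartz_chirp.
Context {R : realType}.

(** For |x| > 1 the single term (r x^2)^j / j! of the exponential series suffices, as |x|^j <=
    x^(2j); for |x| <= 1 both factors are at most 1. The bound adds the two cases. *)
Lemma exprn_gauss_bound (r : R) j : 0 < r ->
  exists M, forall x, `|x| ^+ j * expR (- r * x ^+ 2) <= M.
Proof.
move=> r0; exists (1 + j`!%:R / r ^+ j) => x.
have e1 : expR (- r * x ^+ 2) <= 1.
  by rewrite -expR0 ler_expR mulNr oppr_le0 mulr_ge0 ?sqr_ge0 ?ltW.
have f0 : 0 <= j`!%:R / r ^+ j by rewrite divr_ge0// exprn_ge0// ltW.
have [x1|/ltW x1] := leP `|x| 1.
  rewrite (@le_trans _ _ 1)// ?lerDl// mulr_ile1 ?exprn_ge0 ?expR_ge0//.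
  by rewrite exprn_ile1.
rewrite (@le_trans _ _ (j`!%:R / r ^+ j))// ?lerDr//.
rewrite mulNr expRN ler_pdivrMr ?expR_gt0//.
have rx0 : 0 <= r * x ^+ 2 by rewrite mulr_ge0 ?sqr_ge0// ltW.
case: j {f0} => [|j].
  rewrite expr0 fact0 expr0 divr1 mul1r -expR0 ler_expR//.
have a0 : 0 < r ^+ j.+1 / j.+1`!%:R.
  by rewrite divr_gt0 ?exprn_gt0// ltr0n fact_gt0.
rewrite -invf_div mulrC ler_pdivlMr// mulrC.
apply: (@le_trans _ _ ((r * x ^+ 2) ^+ j.+1 / j.+1`!%:R)); last first.
  by apply: (le_trans _ (expR_ge1Dxn j rx0)); rewrite lerDr.
rewrite exprMn [leRHS]mulrAC ler_wpM2l ?(ltW a0)// -exprM mulnC exprM -(real_normK (num_real _)).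
by rewrite normrX expr2 ler_peMl ?exprn_ge0// exprn_ege1.
Qed.

Lemma poly_gauss_bound (p : {poly R}) (r : R) : 0 < r ->
  exists M, forall x, `|p.[x]| * expR (- r * x ^+ 2) <= M.
Proof.
move=> r0.
have h j : {M | forall x, `|x| ^+ j * expR (- r * x ^+ 2) <= M}.
  exact/cid/exprn_gauss_bound.
exists (\sum_(i < size p) `|p`_i| * sval (h i)) => x.
rewrite horner_coef (@le_trans _ _ ((\sum_(i < size p) `|p`_i * x ^+ i|) * expR (- r * x ^+ 2)))//.
  by rewrite ler_wpM2r ?expR_ge0// ler_norm_sum.
rewrite mulr_suml ler_sum// => i _; rewrite normrM -mulrA ler_wpM2l// normrX.
exact: (svalP (h i)).
Qed.

Variables (w : R[i]) (nu : R).
Hypothesis w0 : 0 < Re w.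

(** Polynomials times the chirp form a class closed under differentiation. A complex polynomial is
    kept as a pair of real ones because derivatives are taken componentwise. *)
Let D (A B : {poly R}) (x : R) : R[i] := (A.[x] +i* B.[x]) * chirp w nu x.

(** With P = A + i B, these are the real and imaginary parts of P' - 2 pi (w X - i nu) P. *)
Let dpoly (A B : {poly R}) : {poly R} * {poly R} :=
  let u := Re w *: 'X in let v := Im w *: 'X - nu%:P in
  (A^`() - (2 * pi) *: (u * A - v * B), B^`() - (2 * pi) *: (u * B + v * A)).

Let is_Cderive_D A B x :
  is_Cderive x (D A B) (D (dpoly A B).1 (dpoly A B).2 x).
Proof.
have h1 : is_Cderive x (fun x => A.[x] +i* B.[x]) (A^`().[x] +i* B^`().[x]).
  by split; exact: is_derive_poly.
have h2 := is_Cderive_qexp w (0 -i* nu) x.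
apply: (is_Cderive_eq (is_CderiveM h1 h2)).
rewrite /D /dpoly /chirp /= mulrA -mulrDl; congr (_ * _).
apply: ReIm_eq; rewrite !(cReD, cImD, cReM, cImM, cReN, cImN) /= !hornerE /=; ring.
Qed.

Let derive1n_D n A B : exists A' B' : {poly R},
  derive1n n (@complex.Re R \o D A B) = @complex.Re R \o D A' B' /\
  derive1n n (@complex.Im R \o D A B) = @complex.Im R \o D A' B'.
Proof.
elim: n => [|n [A' [B' [h1 h2]]]]; first by exists A, B.
exists (dpoly A' B').1, (dpoly A' B').2; rewrite !derive1nS h1 h2.
split; apply/funext => x; rewrite derive1E.
  by have [h _] := is_Cderive_D A' B' x; exact: (@derive_val _ _ _ _ _ _ _ h).
by have [_ h] := is_Cderive_D A' B' x; exact: (@derive_val _ _ _ _ _ _ _ h).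
Qed.

Lemma schwartz_chirp : schwartz (chirp w nu).
Proof.
have -> : chirp w nu = D 1 0.
  apply/funext => x; rewrite /D hornerC horner0.
  by rewrite (_ : 1 +i* 0 = 1) ?mul1r.
split=> [n x|j n].
  have [A [B [-> ->]]] := derive1n_D n 1 0.
  have [h1 h2] := is_Cderive_D A B x.
  by split; [exact: (@ex_derive _ _ _ _ _ _ _ h1)|exact: (@ex_derive _ _ _ _ _ _ _ h2)].
have [A [B [h1 h2]]] := derive1n_D n 1 0.
have r0 : 0 < pi * Re w by rewrite mulr_gt0// pi_gt0.
have [MA hA] := poly_gauss_bound ('X^j * A) r0.
have [MB hB] := poly_gauss_bound ('X^j * B) r0.
exists (MA + MB) => x.
rewrite /Cderive_n h1 h2 (_ : _ +i* _ = D A B x); last exact: ReIm_eq.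
rewrite ncM normc_chirp.
have -> : - pi * Re w = - (pi * Re w) by rewrite mulNr.
apply: le_trans (lerD (hA x) (hB x)).
rewrite mulrA -mulrDl ler_wpM2r ?expR_ge0//.
rewrite !hornerE /= !normrM normrX -mulrDr ler_wpM2l ?exprn_ge0//.
exact: (nc_le_ReIm (A.[x] +i* B.[x])).
Qed.

End schwartz_chirp.

(** * Norms *)

Section norm_bounds.
Context {R : realType}.
Local Notation mu := (@lebesgue_measure R).
Local Open Scope ereal_scope.
Import HBNNSimple.

(* No measurability of f is needed: the integral of a nonnegative function is
   a supremum over the simple functions below it. *)
Lemma ge0_integral_ge d (T : measurableType d) (m : {measure set T -> \bar R})
    (f : T -> \bar R) (A : set T) (M : R) : measurable A -> (0 <= M)%R ->
  (forall x, 0 <= f x) -> (forall x, A x -> M%:E <= f x) ->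
  M%:E * m A <= \int[m]_x f x.
Proof.
move=> mA M0 f0 fM; rewrite ge0_integralTE//.
have hE x : scale_nnsfun (indic_nnsfun R mA) M0 x = (M * \1_A x)%R by [].
have -> : M%:E * m A = sintegral m (scale_nnsfun (indic_nnsfun R mA) M0).
  rewrite -[X in sintegral _ X](patch_setT (fun=> 0%R)) -integral_nnsfun// -(integral_cst m mA).
  rewrite integral_mkcond; apply: eq_integral => x _; rewrite hE /patch indicE.
  by case: ifP => _; rewrite ?mulr1 ?mulr0.
apply: ereal_sup_ubound; exists (scale_nnsfun (indic_nnsfun R mA) M0) => // x.
rewrite /mkset hE indicE; case: (boolP (x \in A)) => [|_]; last by rewrite mulr0.
by rewrite inE mulr1; exact: fM.
Qed.

Lemma CLnorm_ge (f : R -> R[i]) (r M delta : R) : (0 < r)%R -> (0 <= M)%R ->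
  (0 <= delta)%R -> (forall x, `|x| <= delta -> M <= normc (f x))%R ->
  (M * (2 * delta) `^ r^-1)%:E <= CLnorm r%:E f.
Proof.
move=> r0 M0 d0 fM; rewrite /CLnorm unlock.
have md : mu `[(- delta)%R, delta] = (2 * delta)%:E.
  rewrite lebesgue_measure_itv/= lte_fin; case: ifPn => [_|]; first by congr _%:E; ring.
  by rewrite -leNgt => h; congr _%:E; lra.
have h : (M `^ r)%:E * mu `[(- delta)%R, delta] <=
    \int[mu]_x (`|(normc (f x))%:E| `^ r).
  apply: ge0_integral_ge => [||x|x].
  - exact: measurable_itv.
  - exact: powR_ge0.
  - exact: poweR_ge0.
  - rewrite /= in_itv/= -ler_norml => xd.
    rewrite lee_fin ge0_ler_powR ?nnegrE ?(ltW r0)//.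
    by rewrite (le_trans (fM _ xd))// ler_norm.
rewrite md -EFinM in h.
have M1 : (0 <= M `^ r * (2 * delta))%R by rewrite mulr_ge0 ?powR_ge0// mulr_ge0.
have -> : (M * (2 * delta) `^ r^-1)%:E = (M `^ r * (2 * delta))%:E `^ r^-1.
  rewrite poweR_EFin [in RHS]powRM ?powR_ge0 ?mulr_ge0//.
  by rewrite -powRrM mulfV ?gt_eqF// powRr1.
apply: gt0_ler_poweR => //.
- by rewrite invr_ge0 ltW.
- by rewrite in_itv/= lee_fin leey M1.
- by rewrite in_itv/= leey andbT integral_ge0// => x _; exact: poweR_ge0.
Qed.

Lemma CLnorm_chirp (w : R[i]) nu p : Re w = 1%R ->
  CLnorm p (chirp w nu) = 'N[mu]_p[(fun x : measurableTypeR R => (expR (- pi * x ^+ 2))%:E)].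
Proof. by move=> w1; apply: eq_Lnorm => x; rewrite normc_chirp w1 mulr1. Qed.

Lemma Lnorm_gauss_fin_num (p : \bar R) : 0 < p ->
  'N[mu]_p[(fun x : measurableTypeR R => (expR (- pi * x ^+ 2))%:E)] \is a fin_num.
Proof.
move=> p0; rewrite ge0_fin_numE; last exact: Lnorm_ge0.
rewrite unlock; case: p p0 => [r r0| _|//].
  apply: poweR_lty; rewrite lte_fin in r0.
  have r1 : (0 < pi * r)%R by rewrite mulr_gt0// pi_gt0.
  have /integrableP[_] := integrable_gauss_dom 0 1 r1.
  apply: le_lt_trans; rewrite le_eqVlt; apply/orP; left; apply/eqP.
  apply: eq_integral => x _; rewrite /= mul0r add0r mul1r !ger0_norm ?expR_ge0//.
  rewrite -expRM; congr (expR _)%:E; ring.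
case: ifPn => // _; apply: (@le_lt_trans _ _ 1); last exact: ltry.
apply/ess_supP; apply: nearW => x /=; rewrite lee_fin ger0_norm ?expR_ge0//.
by rewrite -expR0 ler_expR mulNr oppr_le0 mulr_ge0 ?sqr_ge0// pi_ge0.
Qed.

End norm_bounds.

(** * Genericity *)

Section chirp_det.
Variables (k m : nat).
Implicit Types (S : comNzRingType).

(** The first four coordinates, distinct once m >= 3; c and om are supported there. *)
Let wd (i : 'I_4) : 'I_m.+1 := inord i.

(* The cross product of the restrictions of p and q to the indices 0, 1, 2. *)
Definition cross_row S (p q : 'I_m.+1 -> S) (i : 'I_4) : S :=
  let d i j := p (inord i) * q (inord j) - p (inord j) * q (inord i) in
  nth 0 [:: d 1 2; d 2 0; d 0 1] i.

(** The rows are the coefficients of the four linear conditions on c. *)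
Definition product_rows S (p q : 'I_m.+1 -> S) : 'M[S]_4 :=
  \matrix_(i, l) nth 0 [:: p (wd l); q (wd l); q (wd l) ^+ 2; p (wd l) * q (wd l)] i.

(** Nonvanishing of the first factor makes the system for c solvable; nonvanishing of the second
    keeps om out of the kernels of the other forms. Any commutative ring is allowed, so that the
    same expression is a polynomial at indeterminates and a number at a matrix. *)
Definition chirp_det S (j0 j1 : 'I_k) (e : 'I_k -> 'I_m.+1 -> S) : S :=
  \det (product_rows (e j0) (e j1)) *
  \prod_(j | (j != j0) && (j != j1)) \sum_i cross_row (e j0) (e j1) i * e j (wd i).

Lemma rmorph_chirp_det (S S' : comNzRingType) (f : {rmorphism S -> S'}) j0 j1 e :
  f (chirp_det j0 j1 e) = chirp_det j0 j1 (fun j l => f (e j l)).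
Proof.
rewrite /chirp_det rmorphM rmorph_prod -det_map_mx; congr (\det _ * _).
  apply/matrixP => i l; rewrite !mxE.
  by case: i => -[|[|[|[|]]]] //= _; rewrite ?rmorphXn ?rmorphM.
apply: eq_bigr => j _; rewrite rmorph_sum; apply: eq_bigr => i _.
rewrite rmorphM; congr (_ * _).
by rewrite /cross_row; case: i => -[|[|[|[|]]]] //= _; rewrite ?rmorphB ?rmorphM ?rmorph0.
Qed.

(** Extension by zero, written as a sum so that [sum_spread] holds even where [wd] is not
    injective. *)
Definition spread S (c : 'I_4 -> S) (l : 'I_m.+1) : S := \sum_i c i * (l == wd i)%:R.

Lemma sum_spread S (c : 'I_4 -> S) (f : 'I_m.+1 -> S) :
  \sum_l spread c l * f l = \sum_i c i * f (wd i).
Proof.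
under eq_bigr do rewrite mulr_suml.
rewrite exchange_big /=; apply: eq_bigr => i _.
rewrite (bigD1 (wd i))//= eqxx mulr1 big1 ?addr0// => l /negPf ->.
by rewrite mulr0 mul0r.
Qed.

Lemma cross_rowl S (p q : 'I_m.+1 -> S) : \sum_i cross_row p q i * p (wd i) = 0.
Proof. by rewrite !big_ord_recl big_ord0 /cross_row /wd /=; ring. Qed.

Lemma cross_rowr S (p q : 'I_m.+1 -> S) : \sum_i cross_row p q i * q (wd i) = 0.
Proof. by rewrite !big_ord_recl big_ord0 /cross_row /wd /=; ring. Qed.

Lemma product_rows_solve (F : fieldType) (p q : 'I_m.+1 -> F) :
  \det (product_rows p q) != 0 -> exists c : 'I_4 -> F,
  [/\ \sum_i c i * p (wd i) = 0, \sum_i c i * q (wd i) = 0,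
      \sum_i c i * q (wd i) ^+ 2 = 0 & \sum_i c i * p (wd i) * q (wd i) = 1].
Proof.
move=> d0; pose M := product_rows p q.
have uM : M \in unitmx by rewrite unitmxE unitfE.
pose v : 'cV[F]_4 := delta_mx (inord 3) 0.
pose c := invmx M *m v.
have Mc : M *m c = v by rewrite mulmxA mulmxV// mul1mx.
have h (i : 'I_4) : \sum_l c l 0 * M i l = ((i : nat) == 3)%N%:R.
  have : (M *m c) i 0 = v i 0 by rewrite Mc.
  rewrite !mxE andbT -val_eqE /= inordK// => <-; apply: eq_bigr => l _; exact: mulrC.
exists (fun l => c l 0); split.
- transitivity (\sum_l c l 0 * M 0 l); last by rewrite h.
  by apply: eq_bigr => l _; congr (_ * _); rewrite mxE.
- transitivity (\sum_l c l 0 * M 1 l); last by rewrite h.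
  by apply: eq_bigr => l _; congr (_ * _); rewrite mxE.
- transitivity (\sum_l c l 0 * M (inord 2) l); last by rewrite h inordK.
  by apply: eq_bigr => l _; congr (_ * _); rewrite mxE inordK.
- transitivity (\sum_l c l 0 * M (inord 3) l); last by rewrite h inordK.
  by apply: eq_bigr => l _; rewrite -mulrA; congr (_ * _); rewrite mxE inordK.
Qed.

(* With rows 2^l and 3^l, product_rows is the transposed Vandermonde matrix of
   the nodes 2, 3, 9 = 3^2 and 6 = 2 * 3. *)
Lemma chirp_det_power (F : numFieldType) (j0 j1 : 'I_k) : (3 <= m)%N ->
  j0 = 0 :> nat -> j1 = 1 :> nat ->
  chirp_det j0 j1 (fun j l => (j.+2)%:R ^+ l : F) != 0.
Proof.
move=> m3 j00 j11.
have wdE (i : 'I_4) : wd i = i :> nat.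
  by rewrite /wd inordK// (leq_trans (ltn_ord i)).
rewrite mulf_neq0//.
  pose a : 'rV[F]_4 := \row_i (nth 0%N [:: 2; 3; 9; 6] i)%:R.
  have -> : product_rows (fun l => j0.+2%:R ^+ l) (fun l => j1.+2%:R ^+ l) = (Vandermonde 4 a)^T.
    apply/matrixP => i l; rewrite !mxE wdE j00 j11 -!natrX -natrM.
    case: i => -[|[|[|[|]]]] //= _.
    - by rewrite -expnM mulnC expnM.
    - by rewrite -expnMn.
  rewrite det_tr det_Vandermonde; apply/prodf_neq0 => i _; apply/prodf_neq0 => l il.
  rewrite subr_eq0 !mxE eqr_nat.
  by case: i l il => -[|[|[|[|]]]] // ? [[|[|[|[|]]]]].
apply/prodf_neq0 => j /andP[jj0 jj1].
(* The cross product of (1, 2, 4) and (1, 3, 9) is (6, -5, 1), so the sum is (y - 2)(y - 3) at y = j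
   + 2. *)
have -> : \sum_i cross_row (fun l => j0.+2%:R ^+ l) (fun l => j1.+2%:R ^+ l) i *
    j.+2%:R ^+ wd i = (j%:R : F) * (j%:R - 1).
  rewrite !big_ord_recl big_ord0 /cross_row !wdE j00 j11 /=. rewrite /bump /= !(add0n, addn0).
  rewrite -[j.+2]addn2 natrD; ring.
rewrite mulf_neq0//.
  by rewrite pnatr_eq0; apply: contra jj0 => /eqP j0'; rewrite -val_eqE /= j0' j00.
rewrite subr_eq0 pnatr_eq1; apply: contra jj1 => /eqP j1'; rewrite -val_eqE /= j1' j11//.
Qed.

End chirp_det.

(** * Failure of the estimates *)

Section unboundedness.
Context {R : realType}.
Variables (k m : nat).
Implicit Types alpha : 'M[R]_(k, m).

(** The right-hand side at the test functions is one number K. It determines the height M to be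
    exceeded near 0, M determines la, and la determines N. *)
Lemma nHT_unbounded alpha (j0 j1 : 'I_k) (ps : 'I_m.+1 -> \bar R) (p : \bar R) :
  j0 != j1 -> chirp_det j0 j1 (extended_row alpha) != 0 ->
  (forall i, 0 < ps i)%E -> (0 < p < +oo)%E -> ~ nHT_bounded alpha ps p.
Proof.
rewrite /chirp_det mulf_eq0 => j01 /norP[dM dw] ps0 p0 [C hC].
have [c4 [cp cq cqq cpq]] := product_rows_solve dM.
pose w4 := cross_row (extended_row alpha j0) (extended_row alpha j1).
have cpq' : \sum_l spread c4 l * extended_row alpha j0 l * extended_row alpha j1 l = 1.
  under eq_bigr do rewrite -mulrA.
  by rewrite (sum_spread c4) -cpq; apply: eq_bigr => i _; rewrite mulrA.
have cqq' : \sum_l spread c4 l * extended_row alpha j1 l ^+ 2 = 0 by rewrite (sum_spread c4).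
have [k0 [C0 [delta [k00 d0 low]]]] := @nHT_chirp_growth R k m alpha (spread c4) (spread w4)
  j0 j1 j01 (etrans (sum_spread _ _) cp) (etrans (sum_spread _ _) cq) cqq' cpq'
  (etrans (sum_spread _ _) (cross_rowl _ _)) (etrans (sum_spread _ _) (cross_rowr _ _))
  (fun j j0j j1j => ltac:(
    rewrite sum_spread; move/prodf_neq0 : dw => /(_ j); rewrite j0j j1j; exact)).
have [r r0 pr] : exists2 r, 0 < r & p = r%:E.
  case: p p0 {hC} => [r| |] /andP[r0 roo]; [|by rewrite ltxx in roo|by []].
  by exists r; rewrite -?lte_fin.
pose G i := CLnorm (ps i) (chirp 1 0 : R -> R[i]).
have Gfin i : G i \is a fin_num.
  by rewrite /G CLnorm_chirp// Lnorm_gauss_fin_num.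
pose K := fine (C%:E * (G ord0 * \prod_(l < m) G (lift ord0 l)))%E.
pose D := (2 * delta) `^ r^-1.
have D0 : 0 < D by rewrite powR_gt0// mulr_gt0.
(* A lower bound M on |x| <= delta gives norm at least M D = |K| + 1 > K. *)
pose M := (`|K| + 1) / D.
have M0 : 0 <= M by rewrite divr_ge0 ?addr_ge0// ltW.
(* With sqrt la = exp y the logarithm is at least y, so the growth term reaches M + 1 + C0; the 1
   absorbs h / N. *)
pose y := `|(M + 1 + C0) / k0|.
pose la := expR y ^+ 2.
have y1 : 1 <= expR y by rewrite -expR0 ler_expR normr_ge0.
have la1 : 1 <= la by rewrite /la exprn_ege1.
have [h hh] := low la la1.
pose N := `|h| + 1.
have N0 : 0 < N by rewrite ltr_wpDl.
pose F : 'I_m.+1 -> R -> R[i] := chirp_family (spread c4) (spread w4) la N.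
have FM x : `|x| <= delta -> M <= normc (nHT alpha (F ord0) (fun l => F (lift ord0 l)) x).
  move=> xd; apply: le_trans (hh N x N0 xd).
  have h1 : h / N <= 1 by rewrite ler_pdivrMr// mul1r (le_trans (ler_norm _))// lerDl.
  have h2 : M + 1 + C0 <= k0 * ln (1 + Num.sqrt la).
    rewrite mulrC -ler_pdivrMr// (le_trans (ler_norm _))// -/y.
    rewrite /la sqrtr_sqr ger0_norm ?expR_ge0// -{1}(expRK y).
    by rewrite ler_ln ?posrE ?addr_gt0 ?expR_gt0// lerDr.
  lra.
have sF l : schwartz (F l) by exact: schwartz_chirp.
have := hC (F ord0) (fun l => F (lift ord0 l)) (sF ord0) (fun l => sF (lift ord0 l)).
have NF l : CLnorm (ps l) (F l) = G l by rewrite /F /chirp_family /G !CLnorm_chirp.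
under eq_bigr do rewrite NF.
rewrite NF -[leRHS]fineK; last first.
  by rewrite !fin_numM// prode_fin_num.
rewrite -/K => hK; have := le_trans _ hK; rewrite pr => /(_ _ (CLnorm_ge r0 M0 (ltW d0) FM)).
rewrite lee_fin -/D /M mulfVK ?gt_eqF//.
have := ler_norm K; lra.
Qed.

(** The extended rows of the matrix of indeterminates, so that [chirp_det] at them is the polynomial
    defining the exceptional set. *)
Definition mpoly_row (j : 'I_k) (l : 'I_m.+1) : mpoly.mpoly (k * m) R :=
  if unlift ord0 l is Some l' then mpoly.mpolyX R (mpoly.mnm1 (mxvec_index j l')) else 1.

Lemma meval_mpoly_row alpha j l :
  mpoly.meval (mxvec alpha 0) (mpoly_row j l) = extended_row alpha j l.
Proof.
rewrite /mpoly_row /extended_row; case: unliftP => [l' _|_]; last exact: mpoly.meval1.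
by rewrite mpoly.mevalXU mxvecE.
Qed.

End unboundedness.

Theorem theorem1p2 (R : realType) (k n : nat) (hk : (2 <= k)%N) (hn : (4 <= n)%N) :
  generic (fun alpha : 'M[R]_(k, n.-1) =>
    forall (ps : 'I_n.-1.+1 -> \bar R) (p : \bar R),
      hoelder_exponents ps p -> ~ nHT_bounded alpha ps p).
Proof.
pose j0 := Ordinal (ltnW hk); pose j1 := Ordinal hk.
have m3 : (3 <= n.-1)%N by rewrite -ltnS prednK// (leq_trans _ hn).
exists [set alpha | chirp_det j0 j1 (extended_row alpha) = 0]; split.
- exists 1%N, (fun=> chirp_det j0 j1 (@mpoly_row R k n.-1)).
  have E alpha : mpoly.meval (mxvec alpha 0) (chirp_det j0 j1 (@mpoly_row R k n.-1)) =
      chirp_det j0 j1 (extended_row alpha).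
    rewrite rmorph_chirp_det; congr (chirp_det _ _).
    by apply/funext => j; apply/funext => l; exact: meval_mpoly_row.
  by apply/seteqP; split => alpha /= h; [move=> _; rewrite E|rewrite -E; exact: h ord0].
(* The exponent is l + 1 because the leading coefficient 1 of an extended row is the power of
   exponent 0. *)
- apply/eqP => /seteqP[_ /(_ (\matrix_(j, l) (j.+2)%:R ^+ l.+1) I)] /=.
  apply/eqP; have := chirp_det_power R m3 (erefl : j0 = 0%N :> nat) (erefl : j1 = 1%N :> nat).
  congr (_ != 0); congr (chirp_det _ _).
  apply/funext => j; apply/funext => l; rewrite /extended_row.
  by case: unliftP => [l' ->|->]; rewrite ?mxE ?expr0.
- move=> alpha /eqP d0 ps p [ps1 p0 _].
  apply: (nHT_unbounded (j0 := j0) (j1 := j1)) => // i.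
  exact: lt_trans (ps1 i).
Qed.
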